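(* Let $\Gamma$ be a profinite group and let $\overline{\Theta}$ be a continuous $k$-valued $G$-pseudocharacter of $\Gamma$. Let $\overline{\rho}:\Gamma\to G(\bar k)$ be a continuous representation whose $G$-pseudocharacter $\Theta_{\overline\rho}$ equals $\overline\Theta$ (more precisely $\overline\Theta\otimes_k\bar k$), let $K=\ker\overline\rho$, and let $Q$ be the quotient of $\Gamma$ fitting into the exact sequence $$0\to K(p)\to Q\to \Gamma/K\to 0,$$ where $K(p)$ is the maximal pro-$p$ quotient of $K$. View $\overline\Theta$ also as a $G$-pseudocharacter of $Q$. Then the natural surjection $$R^{\mathrm{ps},\Gamma}_{\overline\Theta}\twoheadrightarrow R^{\mathrm{ps},Q}_{\overline\Theta}$$ (induced by inflating deformations from $Q$ to $\Gamma$) is an isomorphism. In particular, every deformation of $\overline\Theta$ factors through $Q$.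
   Context: $L$ is a finite extension of $\mathbb{Q}_p$ with ring of integers $\mathcal O$ and residue field $k$; $\bar k$ is an algebraic closure of $k$. $G$ is a generalised reductive group scheme over $\mathcal O$: a smooth affine group scheme with (not necessarily connected) reductive geometric fibres such that $G/G^0$ is finite, where $G^0$ is the neutral component. $G$-pseudocharacters: for a group $\Gamma$ and a commutative $\mathcal O$-algebra $A$, a $G$-pseudocharacter $\Theta$ of $\Gamma$ over $A$ is a sequence of $\mathcal O$-algebra maps $\Theta_n:\mathcal O[G^n]^{G^0}\to \mathrm{Map}(\Gamma^n,A)$, $n\ge1$ (invariants for the action induced by simultaneous conjugation), such that (1) for all $n,m\ge 1$, $\zeta:\{1,\dots,m\}\to\{1,\dots,n\}$, $f\in\mathcal O[G^m]^{G^0}$, $\gamma_i\in\Gamma$: $\Theta_n(f^\zeta)(\gamma_1,\dots,\gamma_n)=\Theta_m(f)(\gamma_{\zeta(1)},\dots,\gamma_{\zeta(m)})$, where $f^\zeta(g_1,\dots,g_n)=f(g_{\zeta(1)},\dots,g_{\zeta(m)})$; (2) for all $n\ge1$, $f\in\mathcal O[G^n]^{G^0}$, $\gamma_i\in\Gamma$: $\Theta_{n+1}(\hat f)(\gamma_1,\dots,\gamma_{n+1})=\Theta_n(f)(\gamma_1,\dots,\gamma_{n-1},\gamma_n\gamma_{n+1})$, where $\hat f(g_1,\dots,g_{n+1})=f(g_1,\dots,g_{n-1},g_ng_{n+1})$. For an $\mathcal O$-algebra map $A\to B$, $\Theta\otimes_AB$ denotes the composition of $\Theta$ with $A\to B$.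 If $\Gamma$ is a topological group and $A$ a topological ring, $\Theta$ is continuous if all $\Theta_n$ take values in continuous maps $\Gamma^n\to A$. To $\rho:\Gamma\to G(A)$ one attaches $\Theta_\rho$ by $\Theta_{\rho,m}(f)(\gamma_1,\dots,\gamma_m)=f(\rho(\gamma_1),\dots,\rho(\gamma_m))$. Finite fields, finite artinian rings and $\bar k$ carry the discrete topology. Deformation ring: let $\mathfrak A_{\mathcal O}$ be the category of artinian local $\mathcal O$-algebras with residue field $k$. For a profinite group $\Gamma$ and a continuous $k$-valued $G$-pseudocharacter $\overline\Theta$, the functor sending $A\in\mathfrak A_{\mathcal O}$ to the set of continuous $A$-valued $G$-pseudocharacters $\Theta$ of $\Gamma$ with $\Theta\otimes_Ak=\overline\Theta$ (deformations of $\overline\Theta$ to $A$) is pro-represented by a local profinite $\mathcal O$-algebra $R^{\mathrm{ps},\Gamma}_{\overline\Theta}$ with residue field $k$. A representation $\overline\rho$ as in the claim always exists, and $Q$ is independent of its choice. $\overline\Theta$ factors through $\Gamma/K$ and hence through $Q$. *)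

(* Defs.v *)
From HB Require Import structures.
From mathcomp Require Import all_boot all_order all_algebra.
From mathcomp Require Import falgebra fieldext.
From mathcomp Require Import boolp classical_sets cardinality.
From mathcomp Require Import topology.
From mathcomp Require mpoly.
Import -(notations) mpoly.

Set Implicit Arguments.
Unset Strict Implicit.
Unset Printing Implicit Defensive.

Import GRing.Theory.
Local Open Scope ring_scope.

(* Z_p is the inverse limit of the rings Z/p^(n+1); note that 'Z_q is Z/q only
   for q > 1, which holds for q = p^(n+1). *)
Section PadicIntegers.
Variables (p : nat) (p_pr : prime p).

Definition padic_seq & prime p := forall n : nat, 'Z_(p ^ n.+1).

Local Notation T := (padic_seq p_pr).

HB.instance Definition _ := gen_eqMixin T.
HB.instance Definition _ := gen_choiceMixin T.

Let addT (x y : T) : T := fun n => x n + y n.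
Let oppT (x : T) : T := fun n => - x n.
Let mulT (x y : T) : T := fun n => x n * y n.
Let zeroT : T := fun=> 0.
Let oneT : T := fun=> 1.

Fact padic_seq_addA : associative addT.
Proof. by move=> x y z; apply: functional_extensionality_dep => n; exact: addrA. Qed.
Fact padic_seq_addC : commutative addT.
Proof. by move=> x y; apply: functional_extensionality_dep => n; exact: addrC. Qed.
Fact padic_seq_add0 : left_id zeroT addT.
Proof. by move=> x; apply: functional_extensionality_dep => n; exact: add0r. Qed.
Fact padic_seq_addN : left_inverse zeroT oppT addT.
Proof. by move=> x; apply: functional_extensionality_dep => n; exact: addNr. Qed.

HB.instance Definition _ :=
  GRing.isZmodule.Build T padic_seq_addA padic_seq_addC padic_seq_add0 padic_seq_addN.

Fact padic_seq_mulA : associative mulT.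
Proof. by move=> x y z; apply: functional_extensionality_dep => n; exact: mulrA. Qed.
Fact padic_seq_mulC : commutative mulT.
Proof. by move=> x y; apply: functional_extensionality_dep => n; exact: mulrC. Qed.
Fact padic_seq_mul1 : left_id oneT mulT.
Proof. by move=> x; apply: functional_extensionality_dep => n; exact: mul1r. Qed.
Fact padic_seq_mulDl : left_distributive mulT addT.
Proof. by move=> x y z; apply: functional_extensionality_dep => n; exact: mulrDl. Qed.
Fact padic_seq_oner_neq0 : oneT != 0.
Proof. by apply/eqP => /(congr1 (@^~ 0%N)) /eqP; rewrite oner_eq0. Qed.

HB.instance Definition _ := GRing.Zmodule_isComNzRing.Build T
  padic_seq_mulA padic_seq_mulC padic_seq_mul1 padic_seq_mulDl padic_seq_oner_neq0.

Definition compatible_seq (x : T) : Prop :=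
  forall n, (x n.+1 : nat) = x n %[mod p ^ n.+1].

Definition compatible : {pred T} := fun x => `[< compatible_seq x >].

Let pX_gt1 n : (1 < p ^ n.+1)%N.
Proof. by rewrite -(exp1n n.+1) ltn_exp2r // prime_gt1. Qed.

Let pX_dvd n : (p ^ n.+1 %| p ^ n.+2)%N.
Proof. by rewrite dvdn_exp2l. Qed.

Let ZpX n : (Zp_trunc (p ^ n.+1)).+2 = (p ^ n.+1)%N.
Proof. exact: Zp_cast. Qed.

Lemma padic_seqD (x y : T) n :
  nat_of_ord ((x + y)%R n) = ((x n + y n) %% p ^ n.+1)%N.
Proof. exact: (congr1 (modn (x n + y n)) (ZpX n)). Qed.

Lemma padic_seqM (x y : T) n :
  nat_of_ord ((x * y)%R n) = ((x n * y n) %% p ^ n.+1)%N.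
Proof. exact: (congr1 (modn (x n * y n)) (ZpX n)). Qed.

Lemma padic_seqN (x : T) n :
  nat_of_ord ((- x)%R n) = ((p ^ n.+1 - x n) %% p ^ n.+1)%N.
Proof. exact: (congr1 (fun q => (q - x n) %% q)%N (ZpX n)). Qed.

Lemma ltn_padic_seq (x : T) n : (x n < p ^ n.+1)%N.
Proof. by rewrite -[X in (_ < X)%N]ZpX ltn_ord. Qed.

Fact compatible_subring : subring_closed compatible.
Proof.
split=> [|x y /asboolP cx /asboolP cy|x y /asboolP cx /asboolP cy]; apply/asboolP=> n.
- by rewrite /= !modn_small ?Zp_cast ?pX_gt1.
- rewrite !padic_seqD !padic_seqN modn_mod modn_dvdm // [RHS]modnDmr.
  rewrite -[LHS]modnDmr modn_dvdm // modnDmr; apply/eqP.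
  rewrite -(eqn_modDr (y n.+1)) -!addnA subnK 1?ltnW ?ltn_padic_seq //.
  rewrite addnA -[X in _ == X]modnDmr cy modnDmr -addnA.
  rewrite subnK 1?ltnW ?ltn_padic_seq // modnDr -modnDmr.
  by have /eqP -> := pX_dvd n; rewrite addn0 cx.
- rewrite !padic_seqM modn_mod modn_dvdm //.
  by rewrite -modnMm cx cy modnMm.
Qed.

HB.instance Definition _ := GRing.isSubringClosed.Build T compatible compatible_subring.

Definition padic_int := {x : T | x \in compatible}.
HB.instance Definition _ := [isSub of padic_int for @sval _ _].
HB.instance Definition _ := [Choice of padic_int by <:].
HB.instance Definition _ := [SubChoice_isSubComNzRing of padic_int by <:].

Definition padic_unit : {pred padic_int} := fun x => `[< exists y, y * x = 1 >].
Definition padic_inv (x : padic_int) : padic_int :=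
  if pselect (exists y, y * x = 1) is left e then sval (cid e) else x.

Fact padic_mulV : {in padic_unit, left_inverse 1 padic_inv *%R}.
Proof.
move=> x /asboolP ux; rewrite /padic_inv; case: pselect => // e.
exact: svalP (cid e).
Qed.
Fact padic_unitP (x y : padic_int) : y * x = 1 -> x \in padic_unit.
Proof. by move=> yx; apply/asboolP; exists y. Qed.
Fact padic_inv_out : {in [predC padic_unit], padic_inv =1 id}.
Proof. by move=> x /asboolPn ux; rewrite /padic_inv; case: pselect. Qed.

HB.instance Definition _ :=
  GRing.ComNzRing_hasMulInverse.Build padic_int padic_mulV padic_unitP padic_inv_out.

Lemma padic_int_modn (x : padic_int) m n :
  (sval x (n + m)%N : nat) = sval x m %[mod p ^ m.+1].
Proof.
elim: n => [|n IHn] //; have /asboolP cx := svalP x.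
rewrite -IHn addSn -(@modn_dvdm (p ^ (n + m).+1)).
  by rewrite cx modn_dvdm // dvdn_exp2l // ltnS leq_addl.
by rewrite dvdn_exp2l // ltnS leq_addl.
Qed.

Lemma padic_int_neq0 (x : padic_int) : x != 0 ->
  exists m, ~~ (p ^ m.+1 %| sval x m)%N.
Proof.
move=> x0; apply: contrapT => xm; case/eqP: x0; apply: val_inj.
apply: functional_extensionality_dep => n; apply: val_inj => /=.
have : (p ^ n.+1 %| sval x n)%N by apply: contraT => xn; case: xm; exists n.
by rewrite /dvdn modn_small ?ltn_padic_seq // => /eqP.
Qed.

Fact padic_idomain (x y : padic_int) : x * y = 0 -> (x == 0) || (y == 0).
Proof.
move=> xy0; case: (eqVneq x 0) => //= /padic_int_neq0 [m xm].
apply: contraT => /padic_int_neq0 [n yn].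
have : (p ^ (m + n).+1.+1 %| sval x (m + n).+1 * sval y (m + n).+1)%N.
  have /(congr1 (fun z : padic_int => (sval z (m + n).+1 : nat))) := xy0.
  rewrite {1}/sval [X in X = _]padic_seqM => /eqP.
  by rewrite [X in _ == X](_ : _ = 0%N) //.
have {}xm : ~~ (p ^ m.+1 %| sval x (m + n).+1)%N.
  apply: contra xm => h; rewrite /dvdn -(padic_int_modn x m n.+1).
  by rewrite addSn addnC.
have {}yn : ~~ (p ^ n.+1 %| sval y (m + n).+1)%N.
  apply: contra yn => h; rewrite /dvdn -(padic_int_modn y n m.+1).
  by rewrite addSn.
have x0 : (0 < sval x (m + n).+1)%N.
  by rewrite lt0n; apply: contraNneq xm => ->.
have y0 : (0 < sval y (m + n).+1)%N.
  by rewrite lt0n; apply: contraNneq yn => ->.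
move: xm yn; rewrite !pfactor_dvdn ?muln_gt0 ?x0 // lognM // -!ltnNge !ltnS.
by move=> xm yn /leq_trans/(_ (leq_add xm yn)); rewrite ltnNge leqnSn.
Qed.

HB.instance Definition _ :=
  GRing.ComUnitRing_isIntegral.Build padic_int padic_idomain.

End PadicIntegers.

(* Q_p is the field of fractions of Z_p, and fieldExtType is a finite extension;
   the ring of integers is the integral closure of Z_p. *)
Section RingOfIntegers.
Variables (p : nat) (p_pr : prime p) (L : fieldExtType {fraction padic_int p_pr}).

Definition padic_in (z : padic_int p_pr) : L := in_alg L (tofrac z).
HB.instance Definition _ :=
  GRing.RMorphism.copy padic_in (in_alg L \o @tofrac (padic_int p_pr)).

Definition integral : {pred L} := fun x => `[< integralOver padic_in x >].

Fact integral_subring : subring_closed integral.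
Proof.
split=> [|x y /asboolP ix /asboolP iy|x y /asboolP ix /asboolP iy];
  apply/asboolP.
- exact: integral1.
- exact: integral_sub.
- exact: integral_mul.
Qed.

HB.instance Definition _ := GRing.isSubringClosed.Build L integral integral_subring.

Definition ring_of_integers := {x : L | x \in integral}.
HB.instance Definition _ := [isSub of ring_of_integers for @sval _ _].
HB.instance Definition _ := [Choice of ring_of_integers by <:].
HB.instance Definition _ := [SubChoice_isSubComNzRing of ring_of_integers by <:].

End RingOfIntegers.


#[short(type="preTopGroupType")]
HB.structure Definition PreTopGroup := {G of Group G & Topological G}.

HB.mixin Record PreTopGroup_isProfinite G of PreTopGroup G := {
  mulg_continuous : continuous (fun x : G * G => (x.1 * x.2)%g);
  invg_continuous : continuous (fun x : G => x^-1%g);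
  profinite_group_compact : compact [set: G];
  profinite_group_hausdorff : hausdorff_space G;
  profinite_group_disconnected : totally_disconnected [set: G]
}.

#[short(type="profiniteGroupType")]
HB.structure Definition ProfiniteGroup :=
  {G of PreTopGroup_isProfinite G & PreTopGroup G}.

#[short(type="preTopAlgType")]
HB.structure Definition PreTopAlg (R : comNzRingType) :=
  {A of GRing.ComAlgebra R A & Topological A}.

(* Continuity of the negation follows from that of the multiplication. *)
HB.mixin Record PreTopAlg_isProfinite (R : comNzRingType) A of PreTopAlg R A := {
  profinite_addr_continuous : continuous (fun x : A * A => x.1 + x.2);
  profinite_mulr_continuous : continuous (fun x : A * A => x.1 * x.2);
  profinite_alg_compact : compact [set: A];
  profinite_alg_hausdorff : hausdorff_space A;
  profinite_alg_disconnected : totally_disconnected [set: A]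
}.

#[short(type="profiniteAlgType")]
HB.structure Definition ProfiniteAlg (R : comNzRingType) :=
  {A of PreTopAlg_isProfinite R A & PreTopAlg R A}.

(* A commutative ring A seen as an R-algebra through s : R -> A. *)
Section StructureMap.
Variables (R A : comNzRingType).

Definition alg_of (s : {rmorphism R -> A}) : Type := A.

Variable s : {rmorphism R -> A}.
HB.instance Definition _ := GRing.ComNzRing.on (alg_of s).

Let scale (a : R) (x : alg_of s) : alg_of s := (s a : alg_of s) * x.

Fact alg_of_scaleA a b x : scale a (scale b x) = scale (a * b) x.
Proof. by rewrite /scale mulrA -rmorphM. Qed.
Fact alg_of_scale1 : left_id 1 scale.
Proof. by move=> x; rewrite /scale rmorph1 mul1r. Qed.
Fact alg_of_scaleDr : right_distributive scale +%R.
Proof. by move=> a x y; rewrite /scale mulrDr. Qed.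
Fact alg_of_scaleDl x : {morph scale^~ x : a b / a + b}.
Proof. by move=> a b; rewrite /scale rmorphD mulrDl. Qed.

HB.instance Definition _ := GRing.Zmodule_isLmodule.Build R (alg_of s)
  alg_of_scaleA alg_of_scale1 alg_of_scaleDr alg_of_scaleDl.

Fact alg_of_scaleAl (a : R) (x y : alg_of s) : a *: (x * y) = a *: x * y.
Proof. exact: mulrA. Qed.

HB.instance Definition _ :=
  GRing.Lmodule_isLalgebra.Build R (alg_of s) alg_of_scaleAl.
HB.instance Definition _ := GRing.Lalgebra_isComAlgebra.Build R (alg_of s).

End StructureMap.

Section StructureMapComp.
Variables (R A B : comNzRingType) (s : {rmorphism R -> A}) (t : {rmorphism A -> B}).

Definition alg_of_map : alg_of s -> alg_of (t \o s) := t.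
HB.instance Definition _ :=
  GRing.RMorphism.copy alg_of_map (t : alg_of s -> alg_of (t \o s)).

Fact alg_of_map_scalable : scalable alg_of_map.
Proof. by move=> a x; exact: rmorphM. Qed.
HB.instance Definition _ := GRing.isScalable.Build R (alg_of s)
  (alg_of (t \o s)) *:%R alg_of_map alg_of_map_scalable.

End StructureMapComp.
Arguments alg_of_map {R A B} s t.
(* For a ring morphism r: R is local and r is its quotient by the maximal ideal. *)
Definition is_residue_map (R : comNzRingType) (k : fieldType) (r : R -> k) :=
  (forall c, exists x, r x = c) /\ (forall x, r x <> 0 -> exists y, y * x = 1).

Definition is_ideal (A : comNzRingType) (I : set A) :=
  [/\ I 0, forall x y, I x -> I y -> I (x + y) & forall a x, I x -> I (a * x)].

Definition is_prime_ideal (A : comNzRingType) (I : set A) :=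
  [/\ is_ideal I, ~ I 1 & forall x y, I (x * y) -> I x \/ I y].

Definition artinian (A : comNzRingType) :=
  forall I : nat -> set A, (forall n, is_ideal (I n)) ->
  (forall n, (I n.+1 `<=` I n)%classic) ->
  exists N, forall n, (N <= n)%N -> I n = I N.

Section Algebras.
Variable R : comNzRingType.

Definition module_finite (B : comAlgType R) :=
  exists n (e : 'I_n -> B), forall b, exists c : 'I_n -> R,
    b = \sum_i c i *: e i.

Definition finitely_presented (B : comAlgType R) :=
  exists n (x : 'I_n -> B), let ev := mmap (in_alg B) x in
  (forall b, exists q, ev q = b) /\
  exists m (r : 'I_m -> mpoly n R), forall q,
    ev q = 0 <-> exists c : 'I_m -> mpoly n R, q = \sum_i c i * r i.

Definition square_zero_extension (C D : comAlgType R) (f : {lrmorphism C -> D}) :=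
  (forall d, exists c, f c = d) /\
  (forall x y, f x = 0 -> f y = 0 -> x * y = 0).

Definition formally_smooth (B : comAlgType R) :=
  forall (C D : comAlgType R) (f : {lrmorphism C -> D}),
  square_zero_extension f -> forall u : {lrmorphism B -> D},
  exists v : {lrmorphism B -> C}, f \o v =1 u.

Definition formally_unramified (B : comAlgType R) :=
  forall (C D : comAlgType R) (f : {lrmorphism C -> D}),
  square_zero_extension f -> forall v w : {lrmorphism B -> C},
  f \o v =1 f \o w -> v =1 w.

Definition smooth (B : comAlgType R) := finitely_presented B /\ formally_smooth B.

Definition etale (B : comAlgType R) := smooth B /\ formally_unramified B.

Definition etale_cover (B : comAlgType R) := etale B /\
  forall P : set R, is_prime_ideal P ->
  exists2 P' : set B, is_prime_ideal P' & P = (in_alg B @^-1` P')%classic.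

End Algebras.

Definition is_normal_subgroup (T : groupType) (U : set T) :=
  [/\ U 1%g, forall x y, U x -> U y -> U (x * y)%g,
      forall x, U x -> U x^-1%g & forall x y, U x -> U (x ^ y)%g].

Section GroupSchemes.
Variable R : comNzRingType.

(* A representable functor from R-algebras to groups.  The zero ring is not a
   comAlgType; it carries no information here, as G 0 is trivial. *)
Record affineGroupScheme := AffineGroupScheme {
  points :> comAlgType R -> groupType;
  pt_map : forall A B : comAlgType R,
    {lrmorphism A -> B} -> {multiplicative points A -> points B};
  pt_map_id : forall (A : comAlgType R) (u : {lrmorphism A -> A}),
    u =1 id -> pt_map u =1 id;
  pt_map_comp : forall (A B C : comAlgType R) (u : {lrmorphism A -> B})
      (v : {lrmorphism B -> C}) (w : {lrmorphism A -> C}),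
    w =1 v \o u -> pt_map w =1 pt_map v \o pt_map u;
  coordRing : comAlgType R;
  univ_point : points coordRing;
  univ_pointP : forall (A : comAlgType R) (g : points A),
    exists u : {lrmorphism coordRing -> A}, pt_map u univ_point = g;
  univ_point_inj : forall (A : comAlgType R) (u v : {lrmorphism coordRing -> A}),
    pt_map u univ_point = pt_map v univ_point -> u =1 v
}.

Arguments pt_map {a A B} u.

Variable G : affineGroupScheme.

(* By Yoneda, the coordinate ring R[G^n] is the ring of morphisms of functors
   from G^n to the affine line. *)
Record regfun n := RegFun {
  regfun_eval :> forall A : comAlgType R, ('I_n -> G A) -> A;
  regfun_nat : forall (A B : comAlgType R) (u : {lrmorphism A -> B})
    (g : 'I_n -> G A), regfun_eval (fun i => pt_map u (g i)) = u (regfun_eval g)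
}.

Section GeometricFibre.
Variables (F : closedFieldType) (s : {rmorphism R -> F}).

Definition fibre : Type := G (alg_of s).
HB.instance Definition _ := Group.on fibre.

(* The coordinate ring of G_F as functions on its F-points: the F-span of the
   restrictions of R[G]. *)
Definition fibre_regular (f : fibre -> F) :=
  exists n (c : 'I_n -> F) (h : 'I_n -> regfun 1),
    forall g, f g = \sum_i c i * (h i (alg_of s) (fun=> g) : F).

Definition basic_open (U : set fibre) :=
  exists2 f, fibre_regular f & U = [set g | f g != 0]%classic.

(* The Zariski topology on G(F). *)
HB.instance Definition _ :=
  isSubBaseTopological.Build fibre basic_open id.

Definition identity_component : set fibre := connected_component setT (1%g : fibre).

(* Right translation by g is locally unipotent on the coordinate ring. *)
Definition unipotent (u : fibre) :=
  forall f, fibre_regular f -> exists N,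
    iter N (fun (f : fibre -> F) x => f (x * u)%g - f x) f =1 fun=> 0.


(* The unipotent radical is trivial; G_F is not required to be connected. *)
Definition reductive_fibre := forall U : set fibre,
  closed U -> connected U -> is_normal_subgroup U ->
  (forall u, U u -> unipotent u) -> U = [set (1%g : fibre)]%classic.

End GeometricFibre.

(* The open subgroup scheme G^0 whose geometric fibres are the identity
   components of those of G. *)
Definition neutral (A : comAlgType R) (g : G A) :=
  forall (F : closedFieldType) (s : {rmorphism R -> F})
    (x : {lrmorphism A -> alg_of s}), identity_component (pt_map x g : fibre s).

Section ComponentScheme.
Variables (E : comAlgType R) (q : forall A : comAlgType R, G A -> {lrmorphism E -> A}).

(* Spec E represents the quotient sheaf G / G^0 for the etale topology. *)
Definition is_component_scheme :=
  [/\ forall (A B : comAlgType R) (u : {lrmorphism A -> B}) (g : G A),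
        q (pt_map u g) =1 u \o q g,
      forall (A : comAlgType R) (g h : G A),
        q g =1 q h <-> neutral (g^-1 * h)%g
    & forall (A : comAlgType R) (x : {lrmorphism E -> A}),
        exists B : comAlgType A, etale_cover B /\
        exists g : G (alg_of (in_alg B \o in_alg A)),
          forall e, q g e = in_alg B (x e)].

End ComponentScheme.

Definition generalised_reductive :=
  [/\ smooth (coordRing G),
      forall (F : closedFieldType) (s : {rmorphism R -> F}), reductive_fibre s
    & exists (E : comAlgType R) (q : forall A : comAlgType R, G A -> {lrmorphism E -> A}),
        module_finite E /\ is_component_scheme q].

(* The invariants R[G^n]^(G^0) for simultaneous conjugation by the group functor
   G^0. *)
Record invfun n := InvFun {
  invfun_fun :> regfun n;
  invfun_inv : forall (A : comAlgType R) (h : G A), neutral h ->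
    forall g : 'I_n -> G A,
      invfun_fun A (fun i => h * g i * h^-1)%g = invfun_fun A g
}.


Variable n : nat.
Implicit Types f : invfun n.

Fact invfun1_nat (A B : comAlgType R) (u : {lrmorphism A -> B}) (g : 'I_n -> G A) :
  1 = u 1.
Proof. by rewrite rmorph1. Qed.
Definition invfun1 : invfun n :=
  @InvFun n (RegFun (regfun_eval := fun A _ => 1) invfun1_nat) (fun _ _ _ _ => erefl).

Fact invfunD_nat f1 f2 (A B : comAlgType R) (u : {lrmorphism A -> B})
    (g : 'I_n -> G A) : let g' i := pt_map u (g i) in
  f1 B g' + f2 B g' = u (f1 A g + f2 A g).
Proof. by rewrite /= !regfun_nat rmorphD. Qed.
Fact invfunD_inv f1 f2 (A : comAlgType R) (h : G A) (hh : neutral h)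
    (g : 'I_n -> G A) : let g' i := (h * g i * h^-1)%g in
  f1 A g' + f2 A g' = f1 A g + f2 A g.
Proof. by rewrite /= !invfun_inv. Qed.
Definition invfunD f1 f2 : invfun n := @InvFun n
  (RegFun (regfun_eval := fun A g => f1 A g + f2 A g) (invfunD_nat f1 f2))
  (invfunD_inv f1 f2).

Fact invfunM_nat f1 f2 (A B : comAlgType R) (u : {lrmorphism A -> B})
    (g : 'I_n -> G A) : let g' i := pt_map u (g i) in
  f1 B g' * f2 B g' = u (f1 A g * f2 A g).
Proof. by rewrite /= !regfun_nat rmorphM. Qed.
Fact invfunM_inv f1 f2 (A : comAlgType R) (h : G A) (hh : neutral h)
    (g : 'I_n -> G A) : let g' i := (h * g i * h^-1)%g in
  f1 A g' * f2 A g' = f1 A g * f2 A g.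
Proof. by rewrite /= !invfun_inv. Qed.
Definition invfunM f1 f2 : invfun n := @InvFun n
  (RegFun (regfun_eval := fun A g => f1 A g * f2 A g) (invfunM_nat f1 f2))
  (invfunM_inv f1 f2).

Fact invfunZ_nat a f (A B : comAlgType R) (u : {lrmorphism A -> B})
    (g : 'I_n -> G A) :
  a *: f B (fun i => pt_map u (g i)) = u (a *: f A g).
Proof. by rewrite regfun_nat linearZ. Qed.
Fact invfunZ_inv a f (A : comAlgType R) (h : G A) (hh : neutral h)
    (g : 'I_n -> G A) :
  a *: f A (fun i => h * g i * h^-1)%g = a *: f A g.
Proof. by rewrite invfun_inv. Qed.
Definition invfunZ a f : invfun n := @InvFun n
  (RegFun (regfun_eval := fun A g => a *: f A g) (invfunZ_nat a f))
  (invfunZ_inv a f).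

Fact invfun_subst_nat m (z : 'I_n -> 'I_m) f (A B : comAlgType R)
    (u : {lrmorphism A -> B}) (g : 'I_m -> G A) :
  f B (fun i => pt_map u (g (z i))) = u (f A (fun i => g (z i))).
Proof. exact: regfun_nat. Qed.
Fact invfun_subst_inv m (z : 'I_n -> 'I_m) f (A : comAlgType R) (h : G A)
    (hh : neutral h) (g : 'I_m -> G A) :
  f A (fun i => h * g (z i) * h^-1)%g = f A (fun i => g (z i)).
Proof. exact: (invfun_inv f hh (fun i => g (z i))). Qed.
Definition invfun_subst m (z : 'I_n -> 'I_m) f : invfun m := @InvFun m
  (RegFun (regfun_eval := fun A g => f A (fun i => g (z i)))
     (invfun_subst_nat z f))
  (invfun_subst_inv z f).

End GroupSchemes.

Arguments pt_map {R a A B} u.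

(* (g_1, .., g_(n+2)) |-> (g_1, .., g_n, g_(n+1) g_(n+2)) *)
Definition merge_last (T : groupType) n (g : 'I_n.+2 -> T) (i : 'I_n.+1) : T :=
  if i == ord_max then (g (widen_ord (leqnSn _) i) * g ord_max)%g
  else g (widen_ord (leqnSn _) i).

Section MergeInvariants.
Variables (R : comNzRingType) (G : affineGroupScheme R) (n : nat).
Variable f : invfun G n.+1.

Fact invfun_merge_nat (A B : comAlgType R) (u : {lrmorphism A -> B})
    (g : 'I_n.+2 -> G A) :
  f B (merge_last (fun i => pt_map u (g i))) = u (f A (merge_last g)).
Proof.
rewrite -regfun_nat; congr (f B _); apply: funext => i.
by rewrite /merge_last; case: ifP => // _; rewrite gmulfM.
Qed.
Fact invfun_merge_inv (A : comAlgType R) (h : G A) (hh : neutral h)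
    (g : 'I_n.+2 -> G A) :
  f A (merge_last (fun i => h * g i * h^-1)%g) = f A (merge_last g).
Proof.
rewrite -[RHS](invfun_inv f hh); congr (f A _); apply: funext => i.
rewrite /merge_last; case: ifP => // _.
by rewrite !mulgA mulgVK.
Qed.
Definition invfun_merge : invfun G n.+2 := @InvFun _ _ n.+2
  (RegFun (regfun_eval := fun A g => f A (merge_last g)) invfun_merge_nat)
  invfun_merge_inv.

End MergeInvariants.

Section Pseudocharacters.
Variables (R : comNzRingType) (G : affineGroupScheme R).

(* The component of index n is Theta_(n+1). The first four axioms say that it is
   an R-algebra map to Map(Gamma^(n+1), A). *)
Record pseudochar (Gamma : groupType) (A : comAlgType R) := Pseudochar {
  theta :> forall n, invfun G n.+1 -> ('I_n.+1 -> Gamma) -> A;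
  theta1 : forall n g, theta (invfun1 G n.+1) g = 1;
  thetaD : forall n (f1 f2 : invfun G n.+1) g,
    theta (invfunD f1 f2) g = theta f1 g + theta f2 g;
  thetaM : forall n (f1 f2 : invfun G n.+1) g,
    theta (invfunM f1 f2) g = theta f1 g * theta f2 g;
  thetaZ : forall n a (f : invfun G n.+1) g,
    theta (invfunZ a f) g = a *: theta f g;
  theta_subst : forall n m (z : 'I_m.+1 -> 'I_n.+1) (f : invfun G m.+1) g,
    theta (invfun_subst z f) g = theta f (g \o z);
  theta_merge : forall n (f : invfun G n.+1) g,
    theta (invfun_merge f) g = theta f (merge_last g)
}.

Definition psc_eq Gamma A (T1 T2 : pseudochar Gamma A) :=
  forall n (f : invfun G n.+1) g, T1 n f g = T2 n f g.

(* Continuity for the discrete topology on A. *)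
Definition psc_continuous (Gamma : preTopGroupType) A (T : pseudochar Gamma A) :=
  forall n (f : invfun G n.+1),
    continuous (T n f : {ptws 'I_n.+1 -> Gamma} -> discrete_topology A).

Section Operations.
Variables (Gamma Delta : groupType) (A B : comAlgType R).

Definition base_change (u : {lrmorphism A -> B}) (T : pseudochar Gamma A) :
  pseudochar Gamma B.
Proof.
exists (fun n f g => u (T n f g)) => *.
- by rewrite theta1 rmorph1.
- by rewrite thetaD rmorphD.
- by rewrite thetaM rmorphM.
- by rewrite thetaZ linearZ.
- by rewrite theta_subst.
- by rewrite theta_merge.
Defined.

Definition inflate (pi : {multiplicative Gamma -> Delta}) (T : pseudochar Delta A) :
  pseudochar Gamma A.
Proof.
exists (fun n f g => T n f (fun i => pi (g i))) => *.
- by rewrite theta1.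
- by rewrite thetaD.
- by rewrite thetaM.
- by rewrite thetaZ.
- by rewrite theta_subst.
- rewrite theta_merge; congr (T _ _ _); apply: funext => i.
  by rewrite /merge_last; case: ifP => // _; rewrite gmulfM.
Defined.

Definition psc_of_rep (rho : {multiplicative Gamma -> G A}) : pseudochar Gamma A.
Proof.
exists (fun n f g => f A (fun i => rho (g i))) => //= n f g.
congr (f A _); apply: funext => i.
by rewrite /merge_last; case: ifP => // _; rewrite gmulfM.
Defined.

End Operations.
End Pseudocharacters.

Section Deformations.
Variables (R : comNzRingType) (k : fieldType) (res : {rmorphism R -> k}).
Local Notation kR := (alg_of res).

(* The category of artinian local R-algebras with residue field k; its
   morphisms are all R-algebra morphisms: when R -> k is surjective, these are
   automatically local and compatible with the residue maps. *)
Record artLocalAlg := ArtLocalAlg {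
  artl_alg :> comAlgType R;
  artl_res : {lrmorphism artl_alg -> kR};
  artl_resP : is_residue_map (artl_res : artl_alg -> k);
  artl_artinian : artinian artl_alg
}.

Variable G : affineGroupScheme R.

Definition is_deformation (Gamma : preTopGroupType) (Tbar : pseudochar G Gamma kR)
    (A : artLocalAlg) (T : pseudochar G Gamma A) :=
  psc_continuous T /\ psc_eq (base_change (artl_res A) T) Tbar.

(* Morphisms into a discrete algebra in the pro-category. *)
Definition discrete_continuous (X : preTopAlgType R) (A : comAlgType R)
    (u : {lrmorphism X -> A}) := continuous (u : X -> discrete_topology A).

Definition is_local_with_residue_field (X : profiniteAlgType R) :=
  exists2 r : {lrmorphism X -> kR}, discrete_continuous r &
    is_residue_map (r : X -> k).

(* X pro-represents the deformation functor of Tbar: a bijection, natural in A,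
   between continuous morphisms X -> A and deformations of Tbar to A.  The value
   of prorep_def at a discontinuous u is irrelevant. *)
Record prorepresents (Gamma : preTopGroupType) (Tbar : pseudochar G Gamma kR)
    (X : profiniteAlgType R) := Prorepresents {
  prorep_local : is_local_with_residue_field X;
  prorep_def :> forall A : artLocalAlg, {lrmorphism X -> A} -> pseudochar G Gamma A;
  prorep_defP : forall (A : artLocalAlg) (u : {lrmorphism X -> A}),
    discrete_continuous u -> is_deformation Tbar (prorep_def u);
  prorep_nat : forall (A B : artLocalAlg) (u : {lrmorphism X -> A})
      (v : {lrmorphism A -> B}), discrete_continuous u ->
    psc_eq (prorep_def (v \o u)) (base_change v (prorep_def u));
  prorep_inj : forall (A : artLocalAlg) (u v : {lrmorphism X -> A}),
    discrete_continuous u -> discrete_continuous v ->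
    psc_eq (prorep_def u) (prorep_def v) -> u =1 v;
  prorep_surj : forall (A : artLocalAlg) (T : pseudochar G Gamma A),
    is_deformation Tbar T ->
    exists2 u : {lrmorphism X -> A}, discrete_continuous u &
      psc_eq (prorep_def u) T
}.

(* The morphism of pro-representing objects corresponding to inflation along
   pi. *)
Definition represents_inflation (Gamma Delta : preTopGroupType)
    (pi : {multiplicative Gamma -> Delta})
    (TG : pseudochar G Gamma kR) (TD : pseudochar G Delta kR)
    (X Y : profiniteAlgType R) (UX : prorepresents TG X) (UY : prorepresents TD Y)
    (phi : {lrmorphism X -> Y}) :=
  continuous phi /\
  forall (A : artLocalAlg) (u : {lrmorphism Y -> A}), discrete_continuous u ->
    psc_eq (UX A (u \o phi)) (inflate pi (UY A u)).

End Deformations.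

Definition is_topological_iso (R : comNzRingType) (X Y : preTopAlgType R)
    (phi : {lrmorphism X -> Y}) :=
  continuous phi /\
  exists psi : {lrmorphism Y -> X},
    [/\ continuous psi, cancel phi psi & cancel psi phi].

Section ProP.
Local Open Scope classical_set_scope.
Variables (Gamma : preTopGroupType) (p : nat).

Definition open_normal_in (K U : set Gamma) :=
  [/\ U `<=` K, exists2 V, open V & U = K `&` V, U 1%g,
      forall x y, U x -> U y -> U (x * y^-1)%g
    & forall x y, U x -> K y -> U (x ^ y)%g].

Definition p_power_index (K U : set Gamma) :=
  exists m, ([set [set (x * u)%g | u in U] | x in K] #= `I_(p ^ m))%card.

(* The kernel of the maximal pro-p quotient K -> K(p): the intersection of the
   open normal subgroups of K of p-power index. *)
Definition prop_kernel (K : set Gamma) : set Gamma :=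
  [set x | K x /\ forall U, open_normal_in K U -> p_power_index K U -> U x].

End ProP.

(* Main.v *)
(** Let [B] be the coordinate ring of [G].  It is torsion free over the Noetherian
    valuation ring [R] of integers of [L], so every [b] in [B] lies in a finite free
    subcomodule of [B] for right translation.  Cayley-Hamilton for the matrix by
    which [y] acts on it gives a linear recurrence satisfied by [b (x y^j)], [j >= 0],
    whose coefficients are class functions of [y]; hence pseudocharacters satisfy
    it too: [T f (.., g y^j z, ..)] is recurrent in [j] with coefficients [T c_j y].
    If [T] deforms [Tbar] and [rho y = 1], these coefficients reduce to those of
    [(X - 1)^d] modulo the nilpotent maximal ideal of [A].  As [p] is nilpotent in
    [A], the characteristic polynomial divides [X^(p^M) - 1] for some [M], and the
    sequence has period [p^M].  The elements of [Gamma] whose insertion in a slot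
    never changes [T f] form an open normal subgroup, which therefore meets
    [ker rho] in a subgroup of [p]-power index and contains the kernel of
    [ker rho -> K(p)].  So [T] descends to [Q], inflation identifies the two
    deformation functors, and the representing algebras are isomorphic by Yoneda. *)

(* A deformation [T] need not come from a representation over [A], so no computation can be made in
   [G A]: every identity is proved between invariant functions on powers of [G] and then carried
   over by [T]. This dictates the shape of the recurrence. Its coefficients must be class functions,
   for only then are their products with the functions f(.., g y^j z, ..) invariant again. The
   subcomodule must be free, not just finite, since the matrix over [B] is well defined and
   multiplicative only by comparison of coefficients along an independent family. That comparison is
   available over torsion-free algebras; generic points live over such algebras, and all other
   points are specialisations of them. Over the valuation ring [R], torsion freeness of [B] amounts
   to flatness; smoothness provides it. The representation [rho] enters through c_j(rho y) = c_j(1),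
   which are the coefficients of (X - 1)^d. The trailing factor z makes the set of harmless
   insertions stable under conjugation. *)
Require Import Defs.
From HB Require Import structures.
From mathcomp Require Import all_boot all_order all_algebra.
From mathcomp Require Import all_fingroup all_solvable.
From mathcomp Require Import falgebra fieldext.
From mathcomp Require Import boolp classical_sets cardinality topology.
From mathcomp Require Import ring zify.
From mathcomp Require mpoly.
Import -(notations) mpoly.

Set Implicit Arguments.
Unset Strict Implicit.
Unset Printing Implicit Defensive.

Import GRing.Theory.
Local Open Scope ring_scope.

(** * Rings of integers of p-adic fields *)

Section PadicFactorization.
Variables (p : nat) (p_pr : prime p).
Local Notation Zp := (padic_int p_pr).

Lemma padic_int_ext (x y : Zp) :
  (forall n, sval x n = sval y n :> nat) -> x = y.
Proof.
move=> xy; apply: val_inj; apply: functional_extensionality_dep => n.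
exact/val_inj/xy.
Qed.

Lemma padic_intM (x y : Zp) n :
  sval (x * y) n = ((sval x n * sval y n) %% p ^ n.+1)%N :> nat.
Proof. exact: padic_seqM. Qed.

Lemma padic_int1 n : sval (1 : Zp) n = 1%N :> nat.
Proof. by rewrite /= modn_small ?Zp_cast // -(exp1n n.+1) ltn_exp2r ?prime_gt1. Qed.

Lemma padic_intS (x : Zp) n : sval x n.+1 = sval x n %[mod p ^ n.+1].
Proof. by rewrite -(padic_int_modn x n 1). Qed.

Lemma padic_int_mk (f : nat -> nat) :
  (forall n, f n.+1 = f n %[mod p ^ n.+1]) ->
  exists x : Zp, forall n, sval x n = (f n %% p ^ n.+1)%N :> nat.
Proof.
move=> fP; pose x : padic_seq p_pr := fun n => (f n)%:R.
have xE n : x n = (f n %% p ^ n.+1)%N :> nat.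
  by rewrite val_Zp_nat // -(exp1n n.+1) ltn_exp2r ?prime_gt1.
have cx : x \in @compatible p p_pr.
  by apply/asboolP => n; rewrite !xE modn_mod modn_dvdm ?fP // dvdn_exp2l.
by exists (exist _ x cx).
Qed.

Lemma padic_nat (m n : nat) : sval (m%:R : Zp) n = (m %% p ^ n.+1)%N :> nat.
Proof.
have [x xE] := @padic_int_mk (fun _ => m) (fun _ => erefl).
rewrite -xE; congr (nat_of_ord (sval _ _)); apply: padic_int_ext => {}n.
rewrite xE; elim: m {x xE} => [|m IHm]; first by rewrite mod0n.
rewrite -[in RHS]addn1 -modnDml -IHm -natr1.
by rewrite [LHS](padic_seqD (sval (m%:R : Zp)) (sval (1 : Zp)) n) padic_int1.
Qed.

(** Modulo p^(n+1) Euler's theorem gives the inverse as a power of y, and uniqueness of inverses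
    makes these residues compatible in n. *)
Lemma padic_coprime_unit (y : Zp) : ~~ (p %| sval y 0)%N -> exists v, y * v = 1.
Proof.
move=> py; have py' n : coprime (sval y n) (p ^ n.+1).
  rewrite coprime_sym coprime_pexpl // prime_coprime //.
  apply: contra py => py; rewrite /dvdn -[p in (_ %% p)%N]expn1.
  by rewrite -(padic_int_modn y 0 n) addn0 expn1.
pose f n := (sval y n ^ (totient (p ^ n.+1)).-1)%N.
have fE n : (sval y n * f n = 1 %[mod p ^ n.+1])%N.
  rewrite -expnS prednK ?Euler_exp_totient //.
  by rewrite totient_gt0 expn_gt0 prime_gt0.
have [n|v vE] := @padic_int_mk f.
  suff: (f n * (sval y n * f n.+1) = f n * (sval y n * f n) %[mod p ^ n.+1])%N.
    by rewrite !mulnA -!(mulnC (sval y n)) => h; rewrite -[LHS]modnMml in h *;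
    move: h; rewrite -[in RHS]modnMml !fE !modnMml !mul1n.
  rewrite -modnMmr -[RHS]modnMmr; congr (_ * _ %% _)%N.
  rewrite fE -modnMml -padic_intS modnMml.
  by rewrite -(@modn_dvdm (p ^ n.+2)) ?dvdn_exp2l // fE modn_dvdm ?dvdn_exp2l.
exists v; apply: padic_int_ext => n.
rewrite padic_intM vE modnMmr fE padic_int1 modn_small //.
by rewrite -(exp1n n.+1) ltn_exp2r ?prime_gt1.
Qed.

Lemma padic_factor (x : Zp) : x != 0 ->
  exists n u v, x = p%:R ^+ n * u /\ u * v = 1.
Proof.
(* The least such n is the valuation of [x], since component n is a residue modulo p^(n+1). *)
move=> /padic_int_neq0; case/ex_minnP => n xn min_n.
have dvd_x k : (p ^ n %| sval x (k + n))%N.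
  case: n xn min_n => [|n] xn min_n; first by rewrite dvd1n.
  have : (p ^ n.+1 %| sval x n)%N by apply: contraT => /min_n; rewrite ltnn.
  by rewrite /dvdn -(padic_int_modn x n k.+1) -addSnnS.
(* Division by p^n loses n digits, so component k of the unit is read off component k + n of [x]. *)
pose f k := (sval x (k + n) %/ p ^ n)%N.
have fE k : (p ^ n * f k = sval x (k + n))%N by rewrite mulnC divnK.
have pn0 : (0 < p ^ n)%N by rewrite expn_gt0 prime_gt0.
have [k|u uE] := @padic_int_mk f.
  apply/eqP; rewrite -(eqn_pmul2l pn0) !muln_modr !fE.
  by rewrite -expnD addnS (addnC n); apply/eqP/padic_intS.
have xE : x = p%:R ^+ n * u.
  apply: padic_int_ext => k; rewrite -natrX padic_intM padic_nat uE.
  rewrite modnMml modnMmr fE addnC padic_int_modn modn_small //.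
  exact: ltn_padic_seq.
have [|v uv] := @padic_coprime_unit u; last by exists n, u, v.
rewrite uE expn1; apply: contra xn; rewrite /dvdn modn_mod => /eqP pf.
by rewrite -[X in (X %% _)%N]/(nat_of_ord (sval x (0 + n)%N)) -fE expnSr
  -muln_modr pf muln0.
Qed.

Lemma padic_total (a b : Zp) : (exists c, b = a * c) \/ (exists c, a = b * c).
Proof.
have [->|a0] := eqVneq a 0; first by right; exists 0; rewrite mulr0.
have [->|b0] := eqVneq b 0; first by left; exists 0; rewrite mulr0.
have [m [u [u' [-> uu']]]] := padic_factor a0.
have [n [v [v' [-> vv']]]] := padic_factor b0.
case/orP: (leq_total m n) => mn; [left|right]; rewrite -(subnK mn).
- exists (p%:R ^+ (n - m) * u' * v).
  by rewrite exprD -[in LHS](mul1r v) -uu'; ring.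
- exists (p%:R ^+ (m - n) * v' * u).
  by rewrite exprD -[in LHS](mul1r u) -vv'; ring.
Qed.

End PadicFactorization.

Lemma fraction_numden (R : idomainType) (z : {fraction R}) :
  exists a b : R, b != 0 /\ tofrac b * z = tofrac a.
Proof.
elim/quotW: z => x; exists (frac x).1, (frac x).2.
split; first exact: denom_ratioP.
unlock tofrac; rewrite -[LHS]FracField.pi_mul; apply/eqmodP; rewrite /= FracField.equivfE.
rewrite /FracField.mulf.
by rewrite !numden_Ratio ?mulf_neq0 ?oner_neq0 ?denom_ratioP // ?mul1r ?mulr1 mulrC.
Qed.

Lemma total_min (T : Type) (r : T -> T -> Prop) n (a : 'I_n.+1 -> T) :
  (forall x y, r x y \/ r y x) -> (forall x y z, r x y -> r y z -> r x z) ->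
  exists i, forall j, r (a i) (a j).
Proof.
move=> tot trans; have refl x : r x x by have [] := tot x x.
elim: n a => [|n IHn] a.
  by exists ord0 => j; rewrite (ord1 j).
have [i min_i] := IHn (a \o lift ord0).
have [le0|le0] := tot (a ord0) (a (lift ord0 i)); [exists ord0|exists (lift ord0 i)].
  move=> j; case: (unliftP ord0 j) => [k ->|->]; last exact: refl.
  exact: trans le0 (min_i k).
move=> j; case: (unliftP ord0 j) => [k ->|-> //]; exact: min_i k.
Qed.

Section ValuationDomains.
Variable R : comNzRingType.

Definition rdivides (a b : R) := exists c, b = a * c.

Definition valuation_domain :=
  (forall a b : R, a * b = 0 -> a = 0 \/ b = 0) /\
  (forall a b : R, rdivides a b \/ rdivides b a).

Definition noetherian := forall I : set R, is_ideal I ->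
  exists n (g : 'I_n -> R), forall x, I x <-> exists c : 'I_n -> R,
    x = \sum_i c i * g i.

Lemma rdivides_refl a : rdivides a a.
Proof. by exists 1; rewrite mulr1. Qed.

Lemma rdivides_trans a b c : rdivides a b -> rdivides b c -> rdivides a c.
Proof. by move=> [x ->] [y ->]; exists (x * y); rewrite mulrA. Qed.

End ValuationDomains.

Section RingOfIntegersValuation.
Variables (p : nat) (p_pr : prime p) (L : fieldExtType {fraction padic_int p_pr}).
Local Notation Zp := (padic_int p_pr).
Local Notation O := (ring_of_integers L).
Local Notation int := (integralOver (@padic_in p p_pr L)).

Lemma padic_in_eq0 (z : Zp) : (padic_in L z == 0) = (z == 0).
Proof.
by rewrite /padic_in fmorph_eq0 tofrac_eq0.
Qed.

Lemma integral_exp (x : L) m : int x -> int (x ^+ m).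
Proof.
move=> ix; elim: m => [|m IHm]; first by rewrite expr0; exact: integral1.
by rewrite exprS; exact: integral_mul.
Qed.

(** In degree n + 1 with leading coefficient b, multiplication by b^n turns the relation into a
    monic one for b x. *)
Lemma integral_lead_mul (x : L) n (a : nat -> L) : (forall i, int (a i)) ->
  \sum_(i < n.+1) a i * x ^+ i = 0 -> int (a n * x).
Proof.
move=> a_int; case: n => [|n].
  by rewrite big_ord1 mulr1 => ->; rewrite mul0r; exact: integral0.
set b := a n.+1 => ax0; pose q := \poly_(i < n.+1) (a i * b ^+ (n - i)).
have qmonic : 'X^(n.+1) + q \is monic.
  by rewrite monicE lead_coefDl ?lead_coefXn // size_polyXn ltnS size_poly.
apply: (integral_root_monic qmonic); last first.
  apply/integral_poly => i; rewrite coefD coefXn coef_poly; apply: integral_add.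
    exact: integral_nat.
  case: ifP => _; last exact: integral0.
  by apply: integral_mul (a_int _) (integral_exp _ (a_int _)).
rewrite rootE hornerD hornerXn horner_poly; apply/eqP.
transitivity (b ^+ n * \sum_(i < n.+2) a i * x ^+ i); last by rewrite ax0 mulr0.
rewrite mulr_sumr [RHS]big_ord_recr addrC /=; congr (_ + _).
  apply: eq_bigr => i _; have le_in : (i <= n)%N by rewrite -ltnS.
  by rewrite exprMn -[X in _ = b ^+ X * _](subnK le_in) exprD; ring.
by rewrite exprMn exprSr -/b mulrA.
Qed.

(** Clear denominators in the minimal polynomial of [x] over Q_p. *)
Lemma alg_dependence (x : L) : exists n (a : nat -> Zp),
  a n != 0 /\ \sum_(i < n.+1) padic_in L (a i) * x ^+ i = 0.
Proof.
have [q qE] := polyOver1P (minPolyOver 1 x).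
have comden m : exists D (A : nat -> Zp), D != 0 /\
    forall i, (i < m)%N -> tofrac D * q`_i = tofrac (A i).
  elim: m => [|m [D [A [D0 AE]]]]; first by exists 1, (fun=> 0); rewrite oner_neq0.
  have [a [b [b0 baE]]] := fraction_numden q`_m.
  exists (b * D), (fun i => if i == m then D * a else b * A i).
  split=> [|i]; first by rewrite mulf_neq0.
  rewrite ltnS leq_eqVlt; case: eqP => [->|_] /= im.
    by rewrite !tofracM -baE; ring.
  by rewrite !tofracM -AE // mulrA.
have q0 : q != 0.
  by rewrite -(map_poly_eq0 (in_alg L)) -qE monic_neq0 // monic_minPoly.
have [D [A [D0 AE]]] := comden (size q).
have sq : (size q).-1.+1 = size q by rewrite prednK // size_poly_gt0.
exists (size q).-1, A; split.
  rewrite -tofrac_eq0 -AE ?sq // mulf_neq0 ?tofrac_eq0 //.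
  by rewrite -lead_coefE lead_coef_eq0.
transitivity (padic_in L D * (minPoly 1 x).[x]); last first.
  by have := root_minPoly 1 x; rewrite rootE => /eqP ->; rewrite mulr0.
rewrite sq qE horner_coef size_map_poly mulr_sumr.
by apply: eq_bigr => i _; rewrite coef_map /padic_in -AE // rmorphM mulrA.
Qed.

Section Local.
Variables (k : fieldType) (res : {rmorphism O -> k}) (k_res : is_residue_map res).

(** The units of [O], viewed in [L] so that quotients can be formed. As 0^-1 = 0 in [L],
    nonvanishing has to be required separately. *)
Definition val_unit (x : L) := [/\ x != 0, int x & int x^-1].

Lemma int_lift (x : L) : int x -> exists y : O, sval y = x.
Proof. by move=> ix; exists (exist _ x (asboolT ix)). Qed.

Lemma int_sval (x : O) : int (sval x).
Proof. by have /asboolP := svalP x. Qed.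

Lemma val_unitP (x : O) : val_unit (sval x) <-> res x <> 0.
Proof.
split=> [[x0 _ /int_lift[y yE]] rx|/(proj2 k_res)[y yx]].
  suff : res (y * x) = 0.
    rewrite (_ : y * x = 1) ?rmorph1; first by apply/eqP/oner_neq0.
    by apply: val_inj; rewrite /= yE mulVf.
  by rewrite rmorphM rx mulr0.
have {}yx : sval y * sval x = 1 by rewrite -[LHS]/(sval (y * x)) yx.
have x0 : sval x != 0.
  by apply/eqP => x0; move/eqP: yx; rewrite x0 mulr0 eq_sym oner_eq0.
split=> //; first exact: int_sval.
by rewrite -[_^-1]mul1r -yx mulfK //; exact: int_sval.
Qed.

(** This is the locality of [O]: its non-units form the kernel of [res]. *)
Lemma val_unitD (x y : L) : int x -> int y -> val_unit (x + y) ->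
  val_unit x \/ val_unit y.
Proof.
move=> /int_lift[{}x <-] /int_lift[{}y <-].
rewrite -[X in val_unit X]/(sval (x + y)) => /val_unitP rxy.
have [rx|rx] := pselect (res x = 0); last by left; apply/val_unitP.
by right; apply/val_unitP => ry; apply: rxy; rewrite rmorphD rx ry addr0.
Qed.

(** Induction on the degree: b = [a n.+1 * x] is integral by [integral_lead_mul], and the leading
    term b x^n is folded into [a n * x ^+ n]. If the given unit is [a n], it is the sum of [a n + b]
    and -b: either the folded relation still has a unit coefficient, or b is a unit and x^-1, the
    quotient of [a n.+1] by b, is integral. *)
Lemma integral_or_inv (x : L) n (a : nat -> L) : (forall i, int (a i)) ->
  \sum_(i < n.+1) a i * x ^+ i = 0 ->
  forall i, (i <= n)%N -> val_unit (a i) -> int x \/ int x^-1.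
Proof.
elim: n a => [|n IHn] a a_int ax0 i le_in ui.
  move: ui; rewrite leqn0 in le_in; rewrite (eqP le_in).
  by case; move: ax0; rewrite big_ord1 mulr1 => ->; rewrite eqxx.
have ib := integral_lead_mul a_int ax0; set b := _ * x in ib.
move: le_in; rewrite leq_eqVlt => /orP[/eqP iE|le_in].
  case: ui; rewrite iE => a0 _ ia; left.
  by rewrite -(mulKf a0 x) -/b; exact: integral_mul.
pose a' j := if j == n then a n + b else a j.
have a'_int j : int (a' j) by rewrite /a'; case: eqP => // _; exact: integral_add.
have a'x0 : \sum_(j < n.+1) a' j * x ^+ j = 0.
  rewrite -[RHS]ax0 !big_ord_recr /= -[RHS]addrA; congr (_ + _).
    by apply: eq_bigr => j _; rewrite /a' ltn_eqF /=.
  by rewrite /a' eqxx mulrDl /b exprS mulrA.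
have [iE|/eqP ni] := eqVneq i n; last first.
  by apply: (IHn a' a'_int a'x0 i) => //; rewrite /a'; case: eqP ni.
move: ui; rewrite iE (_ : a n = a' n + - b); last by rewrite /a' eqxx addrK.
move=> /val_unitD[]; [exact: a'_int|exact: integral_opp|exact: IHn|].
rewrite /val_unit oppr_eq0 invrN mulf_eq0 negb_or => -[/andP[a0 x0] _ /integral_opp].
rewrite opprK invfM => ibV; right.
by rewrite -(mulVKf a0 x^-1); exact: integral_mul.
Qed.

(** Dividing a relation over Z_p by a coefficient of least valuation turns that coefficient into 1,
    so [integral_or_inv] applies. *)
Lemma integral_total (x : L) : int x \/ int x^-1.
Proof.
have [n [a [a0 ax0]]] := alg_dependence x.
have [i min_i] := @total_min Zp (@rdivides Zp) n (fun i => a i) (@padic_total p p_pr) (@rdivides_trans Zp).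
pose c j := if insub j is Some j' then sval (cid (min_i j')) else 0.
have cE (j : 'I_n.+1) : a j = a i * c j.
  by rewrite /c valK; case: cid.
have ai0 : a i != 0.
  apply: contraNneq a0 => ai0; apply/eqP.
  by have := cE ord_max; rewrite ai0 mul0r.
have ci1 : c i = 1.
  by apply: (mulfI ai0); rewrite mulr1 -cE.
apply: (@integral_or_inv x n (fun j => padic_in L (c j)) _ _ i).
- by move=> j; exact: integral_id.
- have ai0' : padic_in L (a i) != 0 by rewrite padic_in_eq0.
  apply: (mulfI ai0'); rewrite mulr0 -[RHS]ax0 mulr_sumr; apply: eq_bigr => j _.
  by rewrite mulrA (cE j) rmorphM.
- by rewrite -ltnS.
- by rewrite ci1 rmorph1 /val_unit oner_neq0 invr1; split=> //; exact: integral1.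
Qed.

Lemma ring_of_integers_valuation : valuation_domain O.
Proof.
split=> a b.
  move=> /(congr1 sval)/eqP; rewrite mulf_eq0 => /orP[]/eqP h;
  by [left; exact: val_inj|right; exact: val_inj].
have [b0|b0] := eqVneq b 0; first by left; exists 0; rewrite b0 mulr0.
have [a0|a0] := eqVneq a 0; first by right; exists 0; rewrite a0 mulr0.
have {}a0 : sval a != 0 by apply: contraNneq a0 => h; apply/eqP/val_inj.
have {}b0 : sval b != 0 by apply: contraNneq b0 => h; apply/eqP/val_inj.
have [] := integral_total (sval a / sval b) => /int_lift[c cE]; [right|left];
  exists c; apply: val_inj => /=; rewrite cE ?invfM ?invrK.
  by rewrite mulrCA mulfV // mulr1.
by rewrite mulVKf.
Qed.

Lemma sval_natr n : sval (n%:R : O) = n%:R.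
Proof. exact: (rmorph_nat (\val : {rmorphism O -> L})). Qed.

Lemma sval_expp n : sval (p%:R ^+ n : O) = p%:R ^+ n.
Proof. by rewrite -sval_natr; exact: (rmorphXn (\val : {rmorphism O -> L})). Qed.

(** If y p = 1 with y integral of degree d, multiplying the equation of y by p^d puts 1 in p Z_p. *)
Lemma residue_p : res p%:R = 0.
Proof.
apply: contrapT => /(proj2 k_res)[y yp].
have {}yp : sval y * p%:R = 1.
  by rewrite -sval_natr -[LHS]/(sval (y * p%:R)) yp (sval_natr 1).
have [q qmonic] := int_sval y.
rewrite rootE horner_coef size_map_poly_id0; last first.
  by rewrite (monicP qmonic) rmorph1 oner_neq0.
have q0 : (0 < size q)%N by rewrite size_poly_gt0 monic_neq0.
rewrite -(prednK q0) big_ord_recr /= coef_map -lead_coefE (monicP qmonic).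
rewrite -[X in _ + X * _]/(padic_in L 1) rmorph1 mul1r => /eqP/(congr1 ( *%R (p%:R ^+ (size q).-1))).
rewrite mulr0 mulrDr -exprMn [p%:R * _]mulrC yp expr1n mulr_sumr.
set S := \sum_(i < _) _ => S0.
have [c cE] : exists c : Zp, S = padic_in L (p%:R * c).
  rewrite /S; elim/big_rec: _ => [|i x _ [c ->]].
    by exists 0; rewrite mulr0 rmorph0.
  exists (q`_i * p%:R ^+ ((size q).-1 - i.+1) + c).
  rewrite mulrDr [in RHS]rmorphD; congr (_ + _).
  rewrite coef_map -[X in p%:R ^+ X](subnK (ltn_ord i)) addnS exprS exprD.
  transitivity (padic_in L q`_i * p%:R * p%:R ^+ ((size q).-1 - i.+1) *
      (sval y * p%:R) ^+ i).
    by rewrite exprMn; ring.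
  by rewrite yp expr1n !rmorphM rmorphXn rmorph_nat; ring.
have : padic_in L (p%:R * c + 1) = 0.
  transitivity (padic_in L (p%:R * c) + padic_in L 1); first exact: rmorphD.
  by rewrite rmorph1 -cE.
move/eqP; rewrite padic_in_eq0 addr_eq0 => /eqP pc.
have : (1 : Zp) = p%:R * - c by rewrite mulrN pc opprK.
move/(congr1 (fun z : Zp => nat_of_ord (sval z 0))).
have pp : (p %% p ^ 1 = 0)%N by rewrite expn1 modnn.
by rewrite padic_intM padic_nat padic_int1 pp mul0n mod0n.
Qed.

Lemma val_unitM x y : val_unit x -> val_unit y -> val_unit (x * y).
Proof.
by move=> [x0 ix ix'] [y0 iy iy']; split; rewrite ?mulf_neq0 ?invfM //;
  exact: integral_mul.
Qed.

Lemma val_unitV x : val_unit x -> val_unit x^-1.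
Proof. by move=> [x0 ix ix']; split; rewrite ?invr_eq0 ?invrK. Qed.

Let p0 : p%:R != 0 :> L.
Proof.
rewrite -(rmorph_nat (padic_in L)) padic_in_eq0; apply/eqP.
move/(congr1 (fun z : Zp => nat_of_ord (sval z 1))).
rewrite padic_nat modn_small /=; first by move=> pE; move: p_pr; rewrite pE.
by rewrite -[X in (X < _)%N]expn1 ltn_exp2l ?prime_gt1.
Qed.

(* The classes of this relation are the cosets of the value group of Q_p in that
   of L. *)
Definition val_sim (x y : L) := exists m : ssrint.int, val_unit (x / y * p%:R ^ m).

Lemma val_sim_sym x y : val_sim x y -> val_sim y x.
Proof.
move=> [m /val_unitV xy]; exists (- m).
by rewrite (_ : _ * _ = (x / y * p%:R ^ m)^-1) // !invfM invrK invr_expz [x^-1 * y]mulrC.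
Qed.

Lemma val_sim_trans x y z : val_sim x y -> val_sim y z -> val_sim x z.
Proof.
move=> [m xy] [n yz]; exists (m + n).
have y0 : y != 0 by case: yz => yz _ _; apply: contraNneq yz => ->; rewrite !mul0r.
rewrite (_ : _ * _ = (x / y * p%:R ^ m) * (y / z * p%:R ^ n)).
  exact: val_unitM.
by rewrite expfzDr // -[x in LHS](divfK y0); ring.
Qed.

Lemma val_sim_padic (a : Zp) y : a != 0 -> y != 0 -> val_sim (padic_in L a * y) y.
Proof.
move=> /padic_factor[n [u [v [-> uv]]]] y0; exists (- n%:Z).
rewrite mulfK // rmorphM rmorphXn rmorph_nat -exprnN mulrAC mulfV ?expf_neq0 // mul1r.
have uv1 : padic_in L u * padic_in L v = 1 by rewrite -rmorphM uv rmorph1.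
have u0 : padic_in L u != 0.
  by apply/eqP => u0; move/eqP: uv1; rewrite u0 mul0r eq_sym oner_eq0.
split=> //; first exact: integral_id.
by rewrite -[_^-1]mulr1 -uv1 mulKf //; exact: integral_id.
Qed.

Lemma val_sim_scale (c : {fraction Zp}) y : c != 0 -> y != 0 -> val_sim (c *: y) y.
Proof.
move=> c0 y0; have [a [b [b0 bc]]] := fraction_numden c.
have b0' : padic_in L b != 0 by rewrite padic_in_eq0.
have a0 : a != 0 by rewrite -tofrac_eq0 -bc mulf_neq0 ?tofrac_eq0.
have cy0 : c *: y != 0 by rewrite scaler_eq0 negb_or c0.
apply: val_sim_trans (val_sim_padic a0 y0).
rewrite (_ : padic_in L a * y = padic_in L b * (c *: y)).
  exact/val_sim_sym/val_sim_padic.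
by rewrite /padic_in !in_algE !mulr_algl scalerA bc.
Qed.

Lemma val_sim_unit x y : val_unit (x / y) -> val_sim x y.
Proof. by move=> xy; exists 0; rewrite expr0z mulr1. Qed.

(** The classical bound of the ramification index by the degree: terms from different classes have
    different valuations, so dividing a vanishing combination by its term of least valuation would
    write -1 as a sum of non-units. *)
Lemma val_sim_bound n (y : 'I_n -> L) : (forall i, y i != 0) ->
  (forall i j, val_sim (y i) (y j) -> i = j) -> (n <= \dim {:L})%N.
Proof.
move=> y0 y_inj; have : free [tuple y i | i < n].
  apply/freeP => c; under eq_bigr => i _ do rewrite -tnth_nth tnth_mktuple.
  case: n y y0 y_inj c => [|n] y y0 y_inj c; first by move=> _ [].
  (* [r u v] means that [u] has at most the valuation of [v], that of 0 being infinite. *)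
  pose r u v := v = 0 \/ u != 0 /\ int (v / u).
  have [m min_m] : exists m, forall j, r (c m *: y m) (c j *: y j).
    apply: total_min => [u v|u v w].
      have [->|u0] := eqVneq u 0; first by right; left.
      have [->|v0] := eqVneq v 0; first by left; left.
      by case: (integral_total (v / u)); [left|rewrite invfM invrK mulrC; right]; right.
    case=> [->|[u0 uv]] [->|[v0 vw]]; try by left.
      by rewrite eqxx in v0.
    right; split=> //; rewrite -[w](divfK v0) -[_ * v / u]mulrA.
    exact: integral_mul vw uv.
  move=> cy0; have tm : c m *: y m = 0.
    apply: contrapT => /eqP tm0.
    pose nonunit x := int x /\ ~ val_unit x.
    suff [_] : nonunit (- 1).
      by apply; split; rewrite ?oppr_eq0 ?oner_neq0 ?invrN ?invr1 //;
        apply/integral_opp/integral1.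
    have -> : -1 = \sum_(j < n.+1 | j != m) (c j *: y j) / (c m *: y m).
      rewrite -mulr_suml; apply: (mulIf tm0); rewrite divfK // mulN1r.
      by move/eqP: cy0; rewrite (bigD1 m) //= addr_eq0 => /eqP->; rewrite opprK.
    apply: big_ind => [|x z [ix ux] [iz uz]|j jm].
    - by split; [exact: integral0|case; rewrite eqxx].
    - by split; [exact: integral_add|case/(val_unitD ix iz)].
    - split=> [|/[dup] uj /val_sim_unit sj].
        by have [->|[]//] := min_m j; rewrite mul0r; exact: integral0.
      case: uj; rewrite mulf_eq0 scaler_eq0 !negb_or => /andP[/andP[cj0 _] _] _ _.
      move: tm0; rewrite scaler_eq0 negb_or => /andP[cm0 _].
      move/eqP: jm; apply; apply: y_inj.
      apply: val_sim_trans (val_sim_sym (val_sim_scale cj0 (y0 j))) _.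
      exact: val_sim_trans sj (val_sim_scale cm0 (y0 m)).
  move=> i; apply/eqP; have := min_m i; rewrite tm /r eqxx => -[/eqP|[//]].
  by rewrite scaler_eq0 (negPf (y0 i)) orbF.
rewrite /free size_tuple => /eqP <-; apply: dimvS; exact: subvf.
Qed.

(** Otherwise inequivalent elements could be added one by one beyond the bound of
    [val_sim_bound]. *)
Lemma val_sim_transversal : exists n (y : nat -> L),
  forall x, x != 0 -> exists2 i, (i < n)%N & val_sim x (y i).
Proof.
apply: contrapT => noT.
suff /(_ (\dim {:L}).+1)[y [y0 y_inj]] : forall n, exists y : nat -> L,
    (forall i, (i < n)%N -> y i != 0) /\
    (forall i j, (i < n)%N -> (j < n)%N -> val_sim (y i) (y j) -> i = j).
  suff : ((\dim {:L}).+1 <= \dim {:L})%N by rewrite ltnn.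
  apply: (@val_sim_bound _ (fun i => y i)) => [i|i j ij]; first exact/y0/ltn_ord.
  by apply: val_inj; apply: y_inj => //; exact: ltn_ord.
elim=> [|n [y [y0 y_inj]]]; first by exists (fun=> 0); split.
have [x [x0 xy]] : exists x, x != 0 /\ forall i, (i < n)%N -> ~ val_sim x (y i).
  apply: contrapT => nx; apply: noT; exists n, y => x x0.
  by apply: contrapT => xy; apply: nx; exists x; split=> // i ilt s; apply: xy; exists i.
exists (fun i => if i == n then x else y i); split=> [i|i j].
  by rewrite ltnS leq_eqVlt; case: eqP => //= _; exact: y0.
rewrite !ltnS [(i <= n)%N]leq_eqVlt [(j <= n)%N]leq_eqVlt; case: eqP => [->|_] /=; case: eqP => [->|_] //= ilt jlt.
- by move=> /(xy _ jlt).
- by move=> /val_sim_sym/(xy _ ilt).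
- exact: y_inj.
Qed.

(** The leading coefficient of an equation of x^-1 over Z_p is p^N times a unit, and its quotient by
    x is integral, so x divides p^N. As p is not a unit, no higher power of p divides x. *)
Lemma p_power_bound (x : O) : x != 0 ->
  exists N, forall n, rdivides (p%:R ^+ n) x -> (n <= N)%N.
Proof.
move=> x0; have sx0 : sval x != 0 by apply: contraNneq x0 => h; apply/eqP/val_inj.
have [d [a [a0 ax0]]] := alg_dependence (sval x)^-1.
have iax := integral_lead_mul (fun i => integral_id _ (a i)) ax0.
have [N [u [v [aE uv]]]] := padic_factor a0.
have [w wE] : exists w : O, sval w * sval x = p%:R ^+ N.
  have /int_lift[w wE] : int (padic_in L v * (padic_in L (a d) / sval x)).
    by apply: integral_mul iax; exact: integral_id.
  exists w; rewrite wE -mulrA divfK // aE -rmorphM mulrCA [v * u]mulrC uv mulr1.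
  by rewrite rmorphXn rmorph_nat.
have pO0 : (p%:R : O) != 0 by apply: contraNneq p0 => h; rewrite -sval_natr h.
exists N => n [c xE]; rewrite leqNgt; apply/negP => ltNn.
have [tot _] := ring_of_integers_valuation.
have wxE : w * x = p%:R ^+ N.
  by apply: val_inj; rewrite /= wE sval_expp.
have [] := tot (p%:R ^+ N : O) (p%:R ^+ (n - N) * c * w - 1).
- rewrite mulrBr mulr1 -{2}wxE xE -[in p%:R ^+ n](subnKC (ltnW ltNn)) exprD.
  by ring.
- move/(congr1 sval); rewrite sval_expp => /eqP.
  by rewrite expf_eq0 (negPf p0) andbF.
move/(congr1 res); rewrite rmorphB !rmorphM rmorphXn residue_p expr0n subn_eq0.
rewrite leqNgt ltNn rmorph1 !mul0r sub0r [RHS]rmorph0 => /eqP.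
by rewrite oppr_eq0 oner_eq0.
Qed.

Lemma ideal_sum (R : comNzRingType) (I : set R) n (c g : 'I_n -> R) :
  is_ideal I -> (forall i, I (g i)) -> I (\sum_i c i * g i).
Proof.
by move=> [I0 ID IM] Ig; apply: big_ind => // i _; exact: IM.
Qed.

Lemma ring_of_integers_noetherian : noetherian O.
Proof.
move=> I iI; have [n [y yP]] := val_sim_transversal.
have gP (i : 'I_n) : exists g, I g /\
    forall x, I x -> x != 0 -> val_sim (sval x) (y i) -> rdivides g x.
  pose S x := [/\ I x, x != 0 & val_sim (sval x) (y i)].
  have [[x0 Sx0]|noS] := pselect (exists x, S x); last first.
    exists 0; split; first by case: iI.
    by move=> x Ix xn0 sx; case: noS; exists x.
  have [N bound] : exists N, forall m, rdivides (p%:R ^+ m) x0 -> (m <= N)%N.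
    by case: Sx0 => _ /p_power_bound.
  (* Within a class, valuations differ by multiples of that of p. So the largest m such that some x
     p^m divides the fixed [x0] is attained at an x of least valuation; [p_power_bound] bounds m. *)
  pose P m := `[< exists2 x, S x & rdivides (x * p%:R ^+ m) x0 >].
  have P0 : exists m, P m.
    by exists 0%N; apply/asboolP; exists x0 => //; rewrite mulr1; exact: rdivides_refl.
  have PN m : P m -> (m <= N)%N.
    move=> /asboolP[x _ [c x0E]]; apply: bound; exists (x * c).
    by rewrite x0E; ring.
  case: (ex_maxnP P0 PN) => m /asboolP[g [Ig g0 sg] gx0] max_m.
  exists g; split=> // x Ix xn0 sx.
  have [d xg] := val_sim_trans sx (val_sim_sym sg).
  have sg0 : sval g != 0 by apply: contraNneq g0 => h; apply/eqP/val_inj.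
  (* For d <= 0 the unit x / g p^d shows that [g] divides [x]; for d > 0 it contradicts the
     maximality of [m]. *)
  case: d xg => d xg; last first.
    case: xg => _ /int_lift[c cE] _; exists (c * p%:R ^+ d.+1); apply: val_inj.
    rewrite /= sval_expp cE NegzE.
    by rewrite -exprnN divfK ?expf_neq0 // mulrC divfK.
  case: d xg => [|d] xg.
    case: xg => _ /int_lift[c cE] _; exists c; apply: val_inj.
    by rewrite /= cE mulr1 mulrC divfK.
  have /max_m : P (d.+1 + m)%N; last by rewrite addSn ltnNge leq_addl.
  apply/asboolP; exists x => //.
  apply: (rdivides_trans _ gx0).
  case: xg => x0' _ /int_lift[c cE]; exists c; apply: val_inj.
  have sx0 : sval x != 0 by apply: contraNneq xn0 => h; apply/eqP/val_inj.
  rewrite -[LHS]/(sval g * sval _) -[RHS]/(sval x * sval _ * sval c) cE !sval_expp.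
  have : p%:R ^+ d.+1 != 0 :> L by rewrite expf_neq0.
  rewrite -exprnP exprD; move: (p%:R ^+ d.+1) => q q0.
  by field; rewrite sx0 sg0 q0.
pose g i := sval (cid (gP i)).
have Ig i : I (g i) by rewrite /g; case: cid => ? [].
have gdvd (i : 'I_n) x : I x -> x != 0 -> val_sim (sval x) (y i) -> rdivides (g i) x.
  by rewrite /g; case: cid => g' [] _ /= h; exact: h.
exists n, g => x; split=> [Ix|[c ->]]; last exact: ideal_sum.
have [->|x0] := eqVneq x 0.
  by exists (fun=> 0); rewrite big1 // => i _; rewrite mul0r.
have sx0 : sval x != 0 by apply: contraNneq x0 => h; apply/eqP/val_inj.
have [i ilt /(gdvd (Ordinal ilt) _ Ix x0)[c xE]] := yP _ sx0.
exists (fun j => if j == Ordinal ilt then c else 0).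
rewrite (bigD1 (Ordinal ilt)) //= eqxx big1 ?addr0 1?mulrC // => j /negPf ->.
by rewrite mul0r.
Qed.

End Local.
End RingOfIntegersValuation.

(** * The Hilbert basis theorem *)

Lemma dependent_choice_seq (T : choiceType) (P : seq T -> T -> Prop) :
  (forall s, exists x, P s x) -> exists g : nat -> T, forall n, P (mkseq g n) (g n).
Proof.
move=> ex; pose pick s := sval (cid (ex s)).
pose S n := iter n (fun s => rcons s (pick s)) [::].
have SE n : S n = mkseq (pick \o S) n.
  by elim: n => // n IHn; rewrite mkseqS -IHn.
by exists (pick \o S) => n; rewrite -SE /= /pick; case: cid.
Qed.

Section HilbertBasis.

(** The ideal spanned by all terms is finitely generated, and its generators involve only the terms
    below some M. *)
Lemma noetherian_seq (R : comNzRingType) (a : nat -> R) : noetherian R ->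
  exists M (c : nat -> R), a M = \sum_(i < M) c i * a i.
Proof.
move=> noeth; pose span M x := exists c : nat -> R, x = \sum_(i < M) c i * a i.
have spanS M N x : (M <= N)%N -> span M x -> span N x.
  move=> MN [c ->]; exists (fun i => if (i < M)%N then c i else 0).
  rewrite (big_ord_widen N (fun i => c i * a i) MN) big_mkcond.
  by apply: eq_bigr => i _; case: ifP; rewrite ?mul0r.
have [|n [g gP]] := noeth (fun x => exists M, span M x).
  split=> [|x y [M xM] [N yN]|b x [M [c ->]]].
  - by exists 0%N, (fun=> 0); rewrite big_ord0.
  - have [c ->] := spanS _ _ _ (leq_maxl M N) xM.
    have [d ->] := spanS _ _ _ (leq_maxr M N) yN.
    exists (maxn M N), (fun i => c i + d i); rewrite -big_split /=.
    by apply: eq_bigr => i _; rewrite mulrDl.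
  - exists M, (fun i => b * c i); rewrite mulr_sumr.
    by apply: eq_bigr => i _; rewrite mulrA.
have gM (i : 'I_n) : exists M, span M (g i).
  apply/gP; exists (fun j => (j == i)%:R).
  rewrite (bigD1 i) //= eqxx mul1r big1 ?addr0 // => j /negPf ->.
  by rewrite mul0r.
pose M := (\max_(i < n) sval (cid (gM i)))%N.
have gspan i : span M (g i).
  by apply: spanS (svalP (cid (gM i))); exact: (@leq_bigmax _ (fun i => sval (cid (gM i)))).
exists M; have [d ->] : exists d : 'I_n -> R, a M = \sum_i d i * g i.
  apply/gP; exists M.+1, (fun i => (i == M)%:R).
  rewrite big_ord_recr /= eqxx mul1r big1 ?add0r // => i _.
  by rewrite ltn_eqF // mul0r.
apply: (big_ind (span M)) => [|_ _ [c ->] [c' ->]|i _].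
- by exists (fun=> 0); rewrite big1 // => i _; rewrite mul0r.
- exists (fun i => c i + c' i); rewrite -big_split /=.
  by apply: eq_bigr => i _; rewrite mulrDl.
- have [c ->] := gspan i; exists (fun j => d i * c j); rewrite mulr_sumr.
  by apply: eq_bigr => j _; rewrite mulrA.
Qed.

(** Hilbert's argument: if no finite list generates [I], let g_n have least degree outside the span
    of its predecessors. By [noetherian_seq] the leading term of some g_M can be cancelled, and the
    remainder has too small a degree to lie outside the span. *)
Lemma noetherian_poly (R : comNzRingType) : noetherian R -> noetherian {poly R}.
Proof.
move=> noeth I iI; have [I0 ID IM] := iI.
pose span (s : seq {poly R}) x := exists c : nat -> {poly R},
  x = \sum_(i < size s) c i * s`_i.
have [[s [sI Is]]|nfg] := pselect (exists s : seq {poly R},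
    (forall i : 'I_(size s), I s`_i) /\ forall x, I x -> span s x).
  exists (size s), (fun i => s`_i) => x; split=> [/Is[c xE]|[c ->]].
    by exists (fun i => c i).
  exact: ideal_sum.
have [g gP] : exists g : nat -> {poly R}, forall n, (forall i : 'I_n, I (g i)) ->
    [/\ I (g n), ~ span (mkseq g n) (g n) &
      forall x : {poly R}, I x -> ~ span (mkseq g n) x -> (size (g n) <= size x)%N].
  have [s|g gP] := @dependent_choice_seq {poly R} (fun s x =>
      (forall i : 'I_(size s), I s`_i) ->
      [/\ I x, ~ span s x & forall y : {poly R}, I y -> ~ span s y -> (size x <= size y)%N]).
    have [sI|] := pselect (forall i : 'I_(size s), I s`_i); last by exists 0.
    pose P n := `[< exists2 x : {poly R}, size x = n & I x /\ ~ span s x >].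
    have Pex : exists n, P n.
      apply: contrapT => nP; apply: nfg; exists s; split=> // x Ix.
      by apply: contrapT => nx; apply: nP; exists (size x); apply/asboolP; exists x.
    case: (ex_minnP Pex) => n /asboolP[x xn [Ix sx]] min_n.
    exists x => _; split=> // y Iy sy; rewrite xn; apply: min_n.
    by apply/asboolP; exists y.
  exists g => n gI; apply: gP => -[i]; rewrite size_mkseq => ilt /=.
  by rewrite nth_mkseq //; exact: (gI (Ordinal ilt)).
have gI n : I (g n).
  elim/ltn_ind: n => n IHn; have [i|//] := gP n.
  exact: IHn.
have spanE n x : span (mkseq g n) x <-> exists c : nat -> {poly R},
    x = \sum_(i < n) c i * g i.
  rewrite /span size_mkseq.
  by split=> -[c ->]; exists c; apply: eq_bigr => i _; rewrite nth_mkseq.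
have size_g i n : (i < n)%N -> (size (g i) <= size (g n))%N.
  move=> lt_in; have [_ _ min_i] := gP i (fun j => gI j).
  have [_ ngn _] := gP n (fun j => gI j).
  apply: min_i => // /spanE[c gE]; apply/ngn/spanE.
  exists (fun j => if (j < i)%N then c j else 0).
  rewrite gE (big_ord_widen n (fun j => c j * g j) (ltnW lt_in)) big_mkcond.
  by apply: eq_bigr => j _; case: ifP; rewrite ?mul0r.
have [M [c aM]] := noetherian_seq (fun n => lead_coef (g n)) noeth.
have [_ ngM min_M] := gP M (fun j => gI j).
have gM0 : g M != 0.
  apply/eqP => g0; apply/ngM/spanE; exists (fun=> 0).
  by rewrite g0 big1 // => i _; rewrite mul0r.
pose d i := c i *: 'X^(size (g M) - size (g i)).
pose h := g M - \sum_(i < M) d i * g i.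
have : (size h < size (g M))%N.
  rewrite -[X in (_ < X)%N]prednK ?size_poly_gt0 // ltnS.
  apply/leq_sizeP => j; rewrite leq_eqVlt => /orP[/eqP <-|].
    rewrite /h coefB coef_sum -lead_coefE aM -sumrB big1 // => i _.
    rewrite -scalerAl coefZ [_ * g i]mulrC coefMXn.
    have [gi0|gi0] := eqVneq (g i) 0.
      by rewrite gi0 lead_coef0 !coef0 if_same !mulr0 subrr.
    have gi : (0 < size (g i))%N by rewrite size_poly_gt0.
    have gig := size_g _ _ (ltn_ord i).
    rewrite ifF; last by apply/negbTE; rewrite -leqNgt; lia.
    rewrite (_ : _ - _ = (size (g i)).-1)%N -?lead_coefE ?subrr //; lia.
  rewrite prednK ?size_poly_gt0 // => gj; rewrite /h coefB coef_sum big1 ?subr0 => [|i _].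
    by rewrite nth_default.
  have gig := size_g _ _ (ltn_ord i).
  rewrite -scalerAl coefZ [_ * g i]mulrC coefMXn.
  case: ifP => [|/negbT]; rewrite ?mulr0 // => jg.
  rewrite nth_default ?mulr0 //; move: (size (g M)) (size (g i)) gj gig jg => a b; lia.
rewrite ltnNge min_M //.
  by apply: ID => //; rewrite -mulN1r; apply: IM; exact: ideal_sum.
move=> /spanE[e hE]; apply/ngM/spanE; exists (fun i => e i + d i).
rewrite -[LHS](subrK (\sum_(i < M) d i * g i)) -/h hE -big_split /=.
by apply: eq_bigr => i _; rewrite mulrDl.
Qed.

Lemma noetherian_surj (R S : comNzRingType) (f : {rmorphism R -> S}) :
  (forall y, exists x, f x = y) -> noetherian R -> noetherian S.
Proof.
move=> surj noeth I [I0 ID IM]; have [|n [g gP]] := noeth (f @^-1` I)%classic.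
  split=> /= [|x y|a x]; rewrite ?rmorph0 ?rmorphD ?rmorphM //; [exact: ID|exact: IM].
exists n, (f \o g) => y; have [x xE] := surj y; rewrite -xE; split=> [/gP[c ->]|[c yE]].
  by exists (f \o c); rewrite rmorph_sum; apply: eq_bigr => i _; rewrite rmorphM.
rewrite yE; apply: ideal_sum => // i; apply/gP; exists (fun j => (j == i)%:R).
rewrite (bigD1 i) //= eqxx mul1r big1 ?addr0 // => j /negPf ->.
by rewrite mul0r.
Qed.

Lemma mpoly_subring (R : comNzRingType) n (S : set (mpoly n R)) :
  (forall c, S (mpolyC n c)) -> (forall i, S (mpolyX R (mnm1 i))) ->
  (forall x y, S x -> S y -> S (x + y)) -> (forall x y, S x -> S y -> S (x * y)) ->
  forall x, S x.
Proof.
move=> SC SX SD SM x; have S0 : S 0 by rewrite -mpolyC0.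
have S1 : S 1 by rewrite -mpolyC1.
rewrite (mpolyE x); apply: (big_ind S) => // m _.
rewrite -mul_mpolyC; apply: (SM) => //; rewrite mpolyXE_id.
apply: (big_ind S S1 (fun x y => @SM x y)) => // i _; elim: (m i) => [|e IHe]; first by rewrite expr0.
by rewrite exprS; exact: SM.
Qed.

Lemma noetherian_mpoly (R : comNzRingType) n : noetherian R -> noetherian (mpoly n R).
Proof.
move=> noeth; elim: n => [|n IHn].
  apply: (@noetherian_surj R _ (@mpolyC 0 R) _ noeth) => p.
  by exists (mcoeff mnm0 p); rewrite /= -nvar0_mpolyC.
pose w : {rmorphism mpoly n R -> mpoly n.+1 R} :=
  mmap (@mpolyC n.+1 R) (fun i => mpolyX R (mnm1 (widen_ord (leqnSn n) i))).
pose f : {rmorphism {poly mpoly n R} -> mpoly n.+1 R} :=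
  horner_eval (mpolyX R (mnm1 ord_max)) \o map_poly w.
apply: (noetherian_surj (f := f) _ (noetherian_poly IHn)).
apply: mpoly_subring => [c|i|_ _ [x <-] [y <-]|_ _ [x <-] [y <-]].
- by exists (mpolyC n c)%:P; rewrite /f /= map_polyC /horner_eval hornerC /= mmapC.
- case: (unliftP ord_max i) => [j ->|->].
    exists (mpolyX R (mnm1 j))%:P.
    rewrite /f /= map_polyC /horner_eval hornerC /= mmapX mmap1U.
    by congr (mpolyX R (mnm1 _)); apply: val_inj; rewrite /= /bump leqNgt ltn_ord.
  by exists 'X; rewrite /f /= map_polyX /horner_eval hornerX.
- by exists (x + y); rewrite rmorphD.
- by exists (x * y); rewrite rmorphM.
Qed.

End HilbertBasis.

(** * Smooth algebras are torsion free *)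

Section AlgebraMorphisms.
Variable R : comNzRingType.

Lemma lrmorphism_of (A B : comAlgType R) (f : A -> B) : f 1 = 1 ->
  {morph f : x y / x + y} -> {morph f : x y / x * y} -> scalable f ->
  exists g : {lrmorphism A -> B}, g =1 f.
Proof.
move=> f1 fD fM fZ.
have fB : zmod_morphism f.
  by move=> x y; rewrite fD -[- y]scaleN1r fZ scaleN1r.
pose mB := GRing.isZmodMorphism.Build A B f fB.
pose mM := GRing.isMonoidMorphism.Build A B f (conj f1 fM).
pose mZ := GRing.isScalable.Build R A B *:%R f fZ.
pose g : {lrmorphism A -> B} := HB.pack f mB mM mZ.
by exists g.
Qed.

(** Leibniz equality allows rewriting of morphisms that occur as arguments of [pt_map] or of a
    relation. *)
Lemma lrmorphism_ext (A B : comAlgType R) (u v : {lrmorphism A -> B}) :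
  u =1 v -> u = v.
Proof.
case: u v => [f [[fB] [fM] [fZ]]] [g [[gB] [gM] [gZ]]] /= /funext fg.
subst g; rewrite (Prop_irrelevance fB gB) (Prop_irrelevance fM gM).
by rewrite (Prop_irrelevance fZ gZ).
Qed.

Lemma lrmorphism_factor (P D E : comAlgType R) (pr : {lrmorphism P -> D})
    (f : {lrmorphism P -> E}) :
  (forall d, exists x, pr x = d) -> (forall x, pr x = 0 -> f x = 0) ->
  exists g : {lrmorphism D -> E}, g \o pr =1 f.
Proof.
move=> surj ker; pose s d := sval (cid (surj d)).
have sK d : pr (s d) = d by rewrite /s; case: cid.
have fE x y : pr x = pr y -> f x = f y.
  move=> xy; apply/eqP; rewrite -subr_eq0 -rmorphB; apply/eqP/ker.
  by rewrite [LHS]rmorphB /= xy subrr.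
have [|x y|x y|a x|g gE] := @lrmorphism_of D E (f \o s).
- by rewrite /= -(rmorph1 f); apply: fE; rewrite sK rmorph1.
- by rewrite /= -rmorphD; apply: fE; rewrite rmorphD /= !sK.
- by rewrite /= -rmorphM; apply: fE; rewrite rmorphM /= !sK.
- by rewrite /= -linearZ; apply: fE; rewrite linearZ /= !sK.
by exists g => x; rewrite /= gE; apply: fE; rewrite sK.
Qed.

End AlgebraMorphisms.

Section Quotient.
Variables (R : comNzRingType) (P : comAlgType R) (I : set P).
Hypotheses (iI : is_ideal I) (I1 : ~ I 1).

(** The two proofs are arguments so that the ideal structure can be declared on this predicate. *)
Definition ideal_pred of is_ideal I & ~ I 1 : {pred P} := fun x => `[< I x >].

Fact ideal_pred_closed : idealr_closed (ideal_pred iI I1).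
Proof.
have [I0 ID IM] := iI; split; first exact/asboolP.
  exact/asboolP.
by move=> a x y /asboolP Ix /asboolP Iy; apply/asboolP; apply: ID => //; exact: IM.
Qed.
HB.instance Definition _ := isIdealr.Build P (ideal_pred iI I1) ideal_pred_closed.

Local Notation D := {ideal_quot (ideal_pred iI I1)}.

Definition quot_pr (x : P) : D := (\pi_D x)%qT.

Fact quot_pr_zmod : zmod_morphism quot_pr.
Proof. by move=> x y; rewrite /quot_pr !piE. Qed.
Fact quot_pr_monoid : monoid_morphism quot_pr.
Proof. by split=> [|x y]; rewrite /quot_pr !piE. Qed.
HB.instance Definition _ := GRing.isZmodMorphism.Build P D quot_pr quot_pr_zmod.
HB.instance Definition _ := GRing.isMonoidMorphism.Build P D quot_pr quot_pr_monoid.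

(** Properness of [I] keeps the quotient nonzero, as a [comAlgType] must be. *)
Lemma quotient_alg : exists (E : comAlgType R) (pr : {lrmorphism P -> E}),
  (forall d, exists x, pr x = d) /\ (forall x, pr x = 0 <-> I x).
Proof.
pose E := alg_of (quot_pr \o in_alg P).
have [|x y|x y|a x|pr prE] := @lrmorphism_of R P E quot_pr.
- exact: (rmorph1 quot_pr).
- exact: (rmorphD quot_pr).
- exact: (rmorphM quot_pr).
- by rewrite -mulr_algl; exact: (rmorphM quot_pr).
exists E, pr; split=> [d|x].
  by elim/quotW: d => x; exists x; rewrite prE.
rewrite prE; split=> [|Ix].
  rewrite -[0 in X in X -> _](rmorph0 quot_pr) => /eqP.
  by rewrite /quot_pr -Quotient.idealrBE subr0 => /asboolP.
apply/eqP; rewrite -[X in _ == X](rmorph0 quot_pr).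
by rewrite /quot_pr -Quotient.idealrBE subr0; apply/asboolP.
Qed.

End Quotient.

Section TorsionFree.
Variables (R : comNzRingType) (B : comAlgType R) (n : nat) (x : 'I_n -> B).

Lemma mmap_lrmorphism : exists ev : {lrmorphism mpoly n R -> B},
  ev =1 mmap (in_alg B) x.
Proof.
apply: lrmorphism_of => [|p q|p q|a p]; rewrite ?rmorph1 ?rmorphD ?rmorphM //.
by rewrite mmapZ mulr_algl.
Qed.

End TorsionFree.

Section IdealPowers.
Variables (P : comNzRingType) (m : nat) (r : 'I_m -> P).

Fixpoint ideal_pow N : set P :=
  if N is N'.+1 then [set q | exists2 w : 'I_m -> P,
    (forall j, ideal_pow N' (w j)) & q = \sum_j w j * r j]%classic
  else setT.

Lemma ideal_pow_ideal N : is_ideal (ideal_pow N).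
Proof.
elim: N => [|N [I0 ID IM]]; first by split.
split=> [|_ _ [v Iv ->] [w Iw ->]|a _ [w Iw ->]].
- by exists (fun=> 0) => //; rewrite big1 // => j _; rewrite mul0r.
- exists (fun j => v j + w j) => [j|]; first exact: ID (Iv j) (Iw j).
  by rewrite -big_split; apply: eq_bigr => j _; rewrite mulrDl.
- exists (fun j => a * w j) => [j|]; first exact: IM (Iw j).
  by rewrite mulr_sumr; apply: eq_bigr => j _; rewrite mulrA.
Qed.

Lemma ideal_powS N q : ideal_pow N.+1 q -> ideal_pow N q.
Proof.
elim: N q => [//|N IHN] q [w Iw ->]; exists w => // j; exact/IHN/Iw.
Qed.

Lemma ideal_pow1 N q : ideal_pow N.+1 q -> ideal_pow 1 q.
Proof. by elim: N => // N IHN /ideal_powS. Qed.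

Lemma ideal_powM N q s : ideal_pow N.+1 q -> ideal_pow N.+1 s ->
  ideal_pow N.+2 (q * s).
Proof.
move=> /ideal_pow1[w _ ->] Is; exists (fun j => w j * s) => [j|].
  by have [_ _] := ideal_pow_ideal N.+1; apply.
by rewrite mulr_suml; apply: eq_bigr => j _; ring.
Qed.

(* The Rees algebra of the ideal is the image of this morphism. *)
Definition rees : {rmorphism mpoly m P -> {poly P}} :=
  mmap polyC (fun j => (r j)%:P * 'X).

Lemma reesC c : rees (mpolyC m c) = c%:P.
Proof. exact: mmapC. Qed.

Lemma reesX j : rees (mpolyX P (mnm1 j)) = (r j)%:P * 'X.
Proof. by rewrite /rees /= mmapX mmap1U. Qed.

Lemma rees_ideal_pow N q : ideal_pow N q -> exists Q, rees Q = q%:P * 'X^N.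
Proof.
elim: N q => [|N IHN] q.
  by move=> _; exists (mpolyC m q); rewrite reesC expr0 mulr1.
move=> [w /(_ _)/IHN Iw ->].
exists (\sum_j sval (cid (Iw j)) * mpolyX P (mnm1 j)).
rewrite rmorph_sum [in RHS]rmorph_sum mulr_suml; apply: eq_bigr => j _.
by case: cid => Q QE /=; rewrite [LHS]rmorphM [rees Q]QE reesX polyCM exprS; ring.
Qed.

Lemma rees_coef Q k : (0 < k)%N -> ideal_pow 1 (rees Q)`_k.
Proof.
move: Q k; have iI := ideal_pow_ideal 1; have [I0 ID IM] := iI.
apply: mpoly_subring => [c k k0|j k k0|Q Q' IQ IQ' k k0|Q Q' IQ IQ' k k0].
- by rewrite reesC coefC gtn_eqF.
- rewrite reesX mulrC coefXM gtn_eqF // coefC; case: ifP => // _.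
  exists (fun i => (i == j)%:R) => //.
  by rewrite (bigD1 j) //= eqxx mul1r big1 ?addr0 // => i /negPf ->; rewrite mul0r.
- by rewrite rmorphD coefD; apply: ID; [exact: IQ|exact: IQ'].
- rewrite rmorphM coefM; apply: big_ind => // i _.
  have [i0|i0] := posnP i; last by rewrite mulrC; apply/IM/IQ.
  by apply/IM/IQ'; rewrite i0 subn0.
Qed.

End IdealPowers.

(* Formal smoothness lifts id_B to sections of P/I^N -> B, where B = P/I, so a
   torsion element b has representatives x_N with t x_N in I^N.  By the Hilbert
   basis theorem for P[Y], mapped to P[T] by Y_j |-> r_j T, some t x_M is a combination
   of the t x_i, i < M, with coefficients in I, and b = 0. *)
Lemma smooth_torsion_free (R : comNzRingType) (B : comAlgType R) (t : R) (b : B) :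
  noetherian R -> smooth B -> (forall a, t * a = 0 -> a = 0) -> t *: b = 0 -> b = 0.
Proof.
move=> noeth [[n [x]] /= [evS [m [r kerP]]] fsm] t_reg tb0.
have [ev evE] := mmap_lrmorphism x.
have {}evS b' : exists q, ev q = b' by have [q <-] := evS b'; exists q; rewrite evE.
have ker_ev q : ev q = 0 <-> ideal_pow r 1 q.
  by rewrite evE kerP; split=> [[c ->]|[c _ ->]]; exists c.
have proper N : ~ ideal_pow r N.+1 1.
  by move=> /ideal_pow1/ker_ev/eqP; rewrite rmorph1 oner_eq0.
have lift N (D : comAlgType R) (pr : {lrmorphism mpoly n R -> D}) :
    (forall d, exists q, pr q = d) -> (forall q, pr q = 0 <-> ideal_pow r N.+1 q) ->
    exists v : {lrmorphism B -> D}, forall b' q, v b' = pr q -> ev q = b'.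
  elim: N D pr => [|N IHN] D pr prS prK.
    have [q|v vE] := lrmorphism_factor (f := pr) evS.
      by move=> /ker_ev/prK.
    exists v => b' q; have [s <-] := evS b'.
    rewrite -[v (ev s)]/((v \o ev) s) vE => /eqP; rewrite -subr_eq0 -rmorphB => /eqP/prK/ker_ev.
    by rewrite rmorphB => /eqP; rewrite subr_eq0 => /eqP.
  have [E [pr' [pr'S pr'K]]] := quotient_alg (ideal_pow_ideal r N.+1) (@proper N).
  have [v vE] := IHN E pr' pr'S pr'K.
  have [q|f fE] := lrmorphism_factor (f := pr') prS.
    by move=> /prK/ideal_powS/pr'K.
  (* The kernel is I^(N+1)/I^(N+2), whose square vanishes. *)
  have fsq : square_zero_extension f.
    split=> [d|d e].
      by have [q <-] := pr'S d; exists (pr q); rewrite -[LHS]/((f \o pr) q) fE.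
    have [q <-] := prS d; have [s <-] := prS e.
    rewrite -[f (pr q)]/((f \o pr) q) -[f (pr s)]/((f \o pr) s) !fE -rmorphM.
    by move=> /pr'K Iq /pr'K Is; apply/prK/ideal_powM.
  have [v' v'E] := fsm D E f fsq v; exists v' => b' q v'b; apply: vE.
  by rewrite -fE /= -v'b -v'E.
have rep N : exists y, ev y = b /\ ideal_pow r N.+1 (t *: y).
  have [E [pr [prS prK]]] := quotient_alg (ideal_pow_ideal r N.+1) (@proper N).
  have [v vE] := lift N E pr prS prK; have [y yE] := prS (v b).
  exists y; split; first by apply: vE.
  by apply/prK; rewrite linearZ /= yE -linearZ /= tb0 linear0.
pose y N := sval (cid (rep N)).
have evy N : ev (y N) = b by rewrite /y; case: cid => ? [].
have Iy N : ideal_pow r N.+1 (t *: y N) by rewrite /y; case: cid => ? [].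
have lftP N := cid (rees_ideal_pow (Iy N)).
have [M [c]] := noetherian_seq (fun N => sval (lftP N)) (noetherian_mpoly (noetherian_mpoly noeth)).
(* The i-th lift maps to t y_i T^(i+1), so in degree M + 1 it meets the coefficient of T^(M-i) of
   its multiplier. This coefficient is in I because i < M. *)
move/(congr1 (fun Q => (rees r Q)`_M.+1)).
rewrite (svalP (lftP M)) coefMXn ltnn subnn coefC eqxx rmorph_sum coef_sum.
have yE (i : 'I_M) : (rees r (c i * sval (lftP i)))`_M.+1 =
    t *: ((rees r (c i))`_(M - i) * y i).
  rewrite rmorphM (svalP (lftP i)) mulrA coefMXn.
  by rewrite ltnS ltnNge ltnW //= subSS coefMC scalerAr.
rewrite (eq_bigr _ (fun i _ => yE i)) -scaler_sumr => /eqP.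
rewrite -subr_eq0 -scalerBr => /eqP ty.
have {ty} : y M - \sum_(i < M) (rees r (c i))`_(M - i) * y i = 0.
  apply/mpolyP => e; rewrite mcoeff0; apply: t_reg.
  by rewrite -mcoeffZ ty mcoeff0.
move/eqP; rewrite subr_eq0 => /eqP yM; rewrite -(evy M) yM; apply/ker_ev.
have [I0 ID IM] := ideal_pow_ideal r 1.
apply: big_ind => // i _; rewrite mulrC; apply/IM/rees_coef.
by rewrite subn_gt0.
Qed.

(** * Torsion-free modules over a Noetherian valuation ring *)

Section Spans.
Variables (R : comNzRingType) (V : lmodType R).

Definition in_span n (v : 'I_n -> V) x := exists c : 'I_n -> R, x = \sum_i c i *: v i.

Definition independent n (v : 'I_n -> V) :=
  forall c : 'I_n -> R, \sum_i c i *: v i = 0 -> forall i, c i = 0.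

Definition torsion_free := forall (t : R) (x : V), t <> 0 -> t *: x = 0 -> x = 0.

Definition is_submodule (S : set V) :=
  [/\ S 0, forall x y, S x -> S y -> S (x + y) & forall a x, S x -> S (a *: x)].

Lemma sum_delta n (v : 'I_n -> V) i : \sum_j (j == i)%:R *: v j = v i.
Proof.
rewrite (bigD1 i) //= eqxx scale1r big1 ?addr0 // => j /negPf ->.
by rewrite scale0r.
Qed.

Lemma in_span_id n (v : 'I_n -> V) i : in_span v (v i).
Proof. by exists (fun j => (j == i)%:R); rewrite sum_delta. Qed.

Lemma in_span_submodule n (v : 'I_n -> V) : is_submodule (in_span v).
Proof.
split=> [|_ _ [c ->] [d ->]|a _ [c ->]].
- by exists (fun=> 0); rewrite big1 // => i _; rewrite scale0r.
- exists (fun i => c i + d i); rewrite -big_split /=.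
  by apply: eq_bigr => i _; rewrite scalerDl.
- exists (fun i => a * c i); rewrite scaler_sumr.
  by apply: eq_bigr => i _; rewrite scalerA.
Qed.

Lemma submodule_sum (S : set V) n (c : 'I_n -> R) (v : 'I_n -> V) :
  is_submodule S -> (forall i, S (v i)) -> S (\sum_i c i *: v i).
Proof. by move=> [S0 SD SZ] Sv; apply: big_ind => // i _; exact: SZ. Qed.

Lemma in_span_sub n m (v : 'I_n -> V) (w : 'I_m -> V) x :
  (forall i, in_span w (v i)) -> in_span v x -> in_span w x.
Proof. by move=> vw [c ->]; apply: submodule_sum => //; exact: in_span_submodule. Qed.

Hypotheses (vR : valuation_domain R) (tfV : torsion_free).

(** In a nontrivial relation some coefficient divides all others and, by torsion freeness, can be
    cancelled; the vector that carried it is then redundant. *)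
Lemma independent_generators n (v : 'I_n -> V) : exists d (e : 'I_d -> V),
  [/\ independent e, forall i, in_span e (v i) & forall j, in_span v (e j)].
Proof.
elim: n v => [|n IHn] v.
  by exists 0%N, v; split=> [c _ []|i|i] //; exact: in_span_id.
have [vi|nvi] := pselect (independent v).
  by exists n.+1, v; split=> // i; exact: in_span_id.
have [c [cv [i ci]]] : exists c, \sum_i c i *: v i = 0 /\ exists i, c i <> 0.
  apply: contrapT => nc; apply: nvi => c cv i; apply: contrapT => ci.
  by apply: nc; exists c; split=> //; exists i.
have [m min_m] := total_min c (proj2 vR) (@rdivides_trans R).
pose q j := sval (cid (min_m j)).
have qE j : c j = c m * q j by rewrite /q; case: cid.
have cm : c m <> 0 by move=> cm; apply: ci; rewrite qE cm mul0r.
have qm : q m = 1.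
  have /(proj1 vR)[//|] : c m * (q m - 1) = 0 by rewrite mulrBr -qE mulr1 subrr.
  by move/eqP; rewrite subr_eq0 => /eqP.
have qv : \sum_j q j *: v j = 0.
  apply: tfV cm _; rewrite scaler_sumr -[RHS]cv; apply: eq_bigr => j _.
  by rewrite scalerA -qE.
have [d [e [ie ev ve]]] := IHn (v \o lift m); exists d, e; split=> // j.
  case: (unliftP m j) => [l ->|->]; first exact: ev.
  have [_ _ SZ] := in_span_submodule e.
  move/eqP: qv; rewrite (bigD1_ord m) //= qm scale1r addr_eq0 => /eqP->.
  rewrite -scaleN1r; apply: SZ; apply: submodule_sum => [|l]; [exact: in_span_submodule|exact: ev].
by apply: in_span_sub (ve j) => l; exact: in_span_id.
Qed.

Lemma independent_generators_fin (T : finType) (v : T -> V) :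
  exists d (e : 'I_d -> V), independent e /\ forall i, in_span e (v i).
Proof.
have [d [e [ie ev _]]] := independent_generators (v \o @enum_val T T).
by exists d, e; split=> // i; have := ev (enum_rank i); rewrite /= enum_rankK.
Qed.

(** Induction on [n]: take generators of the part of [S] in the span of the last vectors, and lifts
    to [S] of generators of the ideal of coefficients at [v ord0]. *)
Lemma submodule_generators n (v : 'I_n -> V) (S : set V) : noetherian R ->
  is_submodule S -> (forall x, S x -> in_span v x) ->
  exists m (w : 'I_m -> V), forall x, S x <-> in_span w x.
Proof.
move=> noeth; elim: n v S => [|n IHn] v S sS Sv.
  exists 0%N, (fun=> 0) => x; have [S0 _ _] := sS; split=> [/Sv|] [c ->].
    by exists (fun=> 0); rewrite !big_ord0.
  by rewrite big_ord0.
have [S0 SD SZ] := sS; pose v' := v \o lift ord0.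
have [T0 TD TZ] := in_span_submodule v'.
have [|x []//|m [w wP]] := IHn v' (fun x => S x /\ in_span v' x).
  split=> [//|x y [Sx Tx] [Sy Ty]|a x [Sx Tx]]; first by split; [exact: SD|exact: TD].
  by split; [exact: SZ|exact: TZ].
have [|l [a aP]] := noeth (fun a => exists2 y, in_span v' y & S (a *: v ord0 + y)).
  split=> [|b b' [y Ty Sy] [y' Ty' Sy']|b b' [y Ty Sy]].
  - by exists 0; rewrite // scale0r addr0.
  - exists (y + y'); first exact: TD.
    by rewrite scalerDl addrACA; exact: SD.
  - by exists (b *: y); [exact: TZ|rewrite -scalerA -scalerDr; exact: SZ].
have sP (j : 'I_l) : exists y, in_span v' y /\ S (a j *: v ord0 + y).
  have [|y Ty Sy] := proj2 (aP (a j)); last by exists y.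
  exists (fun i => (i == j)%:R).
  rewrite (bigD1 j) //= eqxx mul1r big1 ?addr0 // => i /negPf ->.
  by rewrite mul0r.
pose y j := sval (cid (sP j)).
have yP j : in_span v' (y j) /\ S (a j *: v ord0 + y j) by rewrite /y; case: cid.
pose u (i : 'I_(l + m)) := match split i with
  inl j => a j *: v ord0 + y j | inr j => w j end.
have uS i : S (u i).
  rewrite /u; case: (split i) => j; first by have [] := yP j.
  by have [] := proj2 (wP (w j)) (in_span_id w j).
exists (l + m)%N, u => x; split=> [Sx|[c ->]]; last exact: submodule_sum.
have [c xE] := Sv x Sx.
have [|b bE] := proj1 (aP (c ord0)).
  exists (\sum_i c (lift ord0 i) *: v' i); first by eexists.
  by move: Sx; rewrite xE big_ord_recl.
pose z := x - \sum_j b j *: (a j *: v ord0 + y j).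
have : S z /\ in_span v' z.
  split; first by apply: SD => //; rewrite -scaleN1r; apply: SZ; apply: submodule_sum => // j; have [] := yP j.
  rewrite /z xE big_ord_recl bE.
  under [X in _ - X]eq_bigr => j _ do rewrite scalerDr scalerA.
  rewrite big_split /= -scaler_suml opprD addrACA subrr add0r.
  apply: TD; first by eexists.
  rewrite -scaleN1r; apply: TZ; apply: submodule_sum => [|j].
    exact: in_span_submodule.
  by have [] := yP j.
move=> /wP[e zE]; exists (fun i => match split i with inl j => b j | inr j => e j end).
rewrite big_split_ord /= -[LHS](subrK (\sum_j b j *: (a j *: v ord0 + y j))) -/z zE addrC.
by congr (_ + _); apply: eq_bigr => j _;
  rewrite /u ?(unsplitK (inl _ j)) ?(unsplitK (inr _ j)).
Qed.

End Spans.

(** Linear algebra over the fraction field with denominators cleared: the first coordinate is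
    eliminated without division by means of a pivot [v p]. This is what lets independence survive
    base change. *)
Lemma linear_functional (R : comNzRingType) n m (v : 'I_m -> 'I_n -> R) (u : 'I_n -> R) :
  (forall a b : R, a * b = 0 -> a = 0 \/ b = 0) ->
  (exists t (c : 'I_m -> R), t <> 0 /\ forall j, t * u j = \sum_i c i * v i j) \/
  (exists l : 'I_n -> R, (forall i, \sum_j l j * v i j = 0) /\ \sum_j l j * u j <> 0).
Proof.
move=> dom; elim: n v u => [|n IHn] v u.
  left; exists 1, (fun=> 0); split=> [|[]//]; exact/eqP/oner_neq0.
have [[p vp]|vn] := pselect (exists p, v p ord0 <> 0); last first.
  have v0 i : v i ord0 = 0 by apply: contrapT => vi; apply: vn; exists i.
  have [u0|u0] := pselect (u ord0 = 0); last first.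
    right; exists (fun j => (j == ord0)%:R).
    split=> [i|]; rewrite big_ord_recl eqxx mul1r big1 ?addr0 // => j _;
    by rewrite mul0r.
  have [[t [c [t0 cE]]]|[l [lv lu]]] :=
      IHn (fun i => v i \o lift ord0) (u \o lift ord0); [left|right].
    exists t, c; split=> // j; case: (unliftP ord0 j) => [k ->|->]; first exact: cE.
    by rewrite u0 mulr0 big1 // => i _; rewrite v0 mulr0.
  exists (fun j => if unlift ord0 j is Some k then l k else 0).
  split=> [i|]; rewrite big_ord_recl unlift_none mul0r add0r;
    under eq_bigr => j _ do rewrite liftK; by [exact: lv|exact: lu].
pose a := v p ord0; pose red (w : 'I_n.+1 -> R) j :=
  a * w (lift ord0 j) - w ord0 * v p (lift ord0 j).
have [[t [c [t0 cE]]]|[l [lv lu]]] := IHn (fun i => red (v i)) (red u); [left|right].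
  exists (t * a), (fun i => c i * a + (i == p)%:R * (t * u ord0 - \sum_k c k * v k ord0)).
  split=> [|j]; first by move=> /dom[].
  under eq_bigr => i _ do rewrite mulrDl.
  rewrite big_split /= [X in _ + X](bigD1 p) //= eqxx mul1r.
  rewrite [X in _ + (_ + X)]big1 ?addr0 => [|i /negPf ->]; last by rewrite !mul0r.
  case: (unliftP ord0 j) => [k ->|->]; last first.
    rewrite mulrBl mulr_suml; under eq_bigr => i _ do rewrite mulrAC.
    by rewrite addrC subrK /a; ring.
  have := cE k; rewrite /red /=.
  under eq_bigr => i _ do rewrite mulrBr !mulrA.
  rewrite sumrB -mulr_suml mulrBr !mulrA => /eqP; rewrite subr_eq => /eqP ->.
  by ring.
exists (fun j => if unlift ord0 j is Some k then a * l k
  else - \sum_k l k * v p (lift ord0 k)).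
have redE w : \sum_j (if unlift ord0 j is Some k then a * l k
    else - \sum_k l k * v p (lift ord0 k)) * w j = \sum_j l j * red w j.
  rewrite big_ord_recl unlift_none mulNr mulr_suml -sumrN -big_split /=.
  by apply: eq_bigr => j _; rewrite liftK /red; ring.
by split=> [i|]; rewrite redE.
Qed.

(** * Tensor products *)

Section TensorProduct.
Variables (R : comNzRingType) (B C : comAlgType R) (n : nat).
Variables (ev : {lrmorphism mpoly n R -> B}) (eps : {lrmorphism B -> C}).
Hypothesis evS : forall b, exists q, ev q = b.

Local Notation CX := (alg_of (@mpolyC n C \o in_alg C)).

Definition scalar_ext : mpoly n R -> CX := map_mpoly (in_alg C).
HB.instance Definition _ := GRing.RMorphism.copy scalar_ext (map_mpoly (in_alg C)).

Fact scalar_ext_scalable : scalable scalar_ext.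
Proof.
move=> a q; rewrite -mul_mpolyC [LHS](rmorphM scalar_ext).
by congr (_ * _); exact: map_mpolyC.
Qed.
HB.instance Definition _ :=
  GRing.isScalable.Build R (mpoly n R) CX *:%R scalar_ext scalar_ext_scalable.

Lemma scalar_extX m : scalar_ext (mpolyX R m) = mpolyX C m.
Proof. exact: (map_mpolyX (in_alg C)). Qed.

Lemma scalar_extC a : scalar_ext (mpolyC n a) = mpolyC n (in_alg C a).
Proof. exact: (map_mpolyC n (in_alg C)). Qed.

Definition coefC : C -> CX := @mpolyC n C.
HB.instance Definition _ := GRing.RMorphism.copy coefC (@mpolyC n C).

Fact coefC_scalable : scalable coefC.
Proof. by move=> a c; rewrite -mulr_algl [LHS](rmorphM coefC). Qed.
HB.instance Definition _ := GRing.isScalable.Build R C CX *:%R coefC coefC_scalable.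

(* B (x) C is the quotient of C[X] by this ideal. *)
Definition tensor_ideal : set CX := fun x => exists2 l : seq (C * mpoly n R),
  (forall e, e \in l -> ev e.2 = 0) & x = \sum_(e <- l) coefC e.1 * scalar_ext e.2.

Lemma tensor_ideal_ideal : is_ideal tensor_ideal.
Proof.
have JD x y : tensor_ideal x -> tensor_ideal y -> tensor_ideal (x + y).
  move=> [l lP ->] [l' lP' ->]; exists (l ++ l'); last by rewrite big_cat.
  by move=> e; rewrite mem_cat => /orP[/lP|/lP'].
split=> //; first by exists [::]; rewrite ?big_nil.
pose S (a : mpoly n C) := forall x : CX, tensor_ideal x -> tensor_ideal ((a : CX) * x).
apply: (@mpoly_subring _ _ S) => [c|i|a b Sa Sb|a b Sa Sb] x.
- move=> [l lP ->]; exists [seq (c * e.1, e.2) | e <- l].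
    by move=> _ /mapP[e el ->]; exact: (lP e el).
  rewrite big_map mulr_sumr; apply: eq_bigr => e _ /=.
  by rewrite [coefC (_ * _)](rmorphM coefC) -mulrA.
- move=> [l lP ->]; exists [seq (e.1, mpolyX R (mnm1 i) * e.2) | e <- l].
    by move=> _ /mapP[e el ->] /=; rewrite rmorphM /= lP ?mulr0.
  rewrite big_map mulr_sumr; apply: eq_bigr => e _ /=.
  rewrite [scalar_ext (_ * _)](rmorphM scalar_ext) mulrCA; congr (_ * (_ * _)).
  exact/esym/scalar_extX.
- by move=> Jx; rewrite mulrDl; apply: JD; [exact: Sa|exact: Sb].
- by move=> Jx; rewrite -mulrA; apply/Sa/Sb.
Qed.

Lemma tensor_lift (E : comAlgType R) (f : {lrmorphism C -> E}) (g : {lrmorphism B -> E}) :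
  exists h : {lrmorphism CX -> E}, h \o coefC =1 f /\ h \o scalar_ext =1 g \o ev.
Proof.
pose h0 : {rmorphism mpoly n C -> E} := mmap f (fun i => g (ev (mpolyX R (mnm1 i)))).
have h0C c : h0 (mpolyC n c) = f c by rewrite /h0 /= mmapC.
have [|x y|x y|a x|h hE] := @lrmorphism_of R CX E h0.
- exact: (rmorph1 h0).
- exact: (rmorphD h0).
- exact: (rmorphM h0).
- rewrite (_ : a *: x = (mpolyC n (in_alg C a) : CX) * x) // [LHS](rmorphM h0).
  by rewrite [X in X * _](h0C (in_alg C a)) in_algE linearZ /= rmorph1 mulr_algl.
exists h; split=> [c|]; first by rewrite /= hE h0C.
apply: mpoly_subring => [a|i|x y /= hx hy|x y /= hx hy] /=.
- rewrite hE scalar_extC h0C in_algE -[mpolyC n a]mulr1.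
  by rewrite mul_mpolyC !linearZ /= !rmorph1.
- by rewrite hE scalar_extX /h0 /= mmapX mmap1U.
- by rewrite !rmorphD /= hx hy.
- by rewrite !rmorphM /= hx hy.
Qed.

(** The morphism [eps] induces one from the tensor product to [C], so the tensor product is not the
    zero ring. *)
Lemma tensor_ideal1 : ~ tensor_ideal 1.
Proof.
have [id_C idE] := @lrmorphism_of R C C id (erefl _) (fun _ _ => erefl) (fun _ _ => erefl)
  (fun _ _ => erefl).
have [h [hC hB]] := tensor_lift id_C eps.
move=> [l lP /(congr1 h)/eqP]; rewrite rmorph1 rmorph_sum big1_seq ?oner_eq0 // => e el.
by rewrite [LHS]rmorphM [X in _ * X](hB e.2) /= lP // rmorph0 mulr0.
Qed.

Lemma msupp_scalar_ext q m : mcoeff m (scalar_ext q) = in_alg C (mcoeff m q).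
Proof. exact: mcoeff_map_mpoly. Qed.

(** Only finitely many monomials matter. Either a nonzero multiple of [q i0] is a combination of the
    other [q i] and of the kernel elements in the relation, against independence in [B]; or a
    functional over [R] on coefficients kills all of these but not [q i0]. Extended to [C], it
    reduces the relation to a nonzero scalar times [c i0]. *)
Lemma tensor_independent N (c : 'I_N -> C) (q : 'I_N -> mpoly n R) :
  (forall a b : R, a * b = 0 -> a = 0 \/ b = 0) -> torsion_free C ->
  independent (ev \o q) -> tensor_ideal (\sum_i coefC (c i) * scalar_ext (q i)) ->
  forall i, c i = 0.
Proof.
move=> dom tfC ind [l lP qE] i0.
pose s (j : 'I_(size l)) := tnth (in_tuple l) j.
have evs j : ev (s j).2 = 0 by apply: lP; exact: mem_tnth.
pose ms := flatten ([seq msupp (q i) | i <- enum 'I_N] ++ [seq msupp e.2 | e <- l]).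
have msq i m : m \notin ms -> mcoeff m (q i) = 0.
  move=> mms; apply: memN_msupp_eq0; apply: contra mms => mq.
  apply/flattenP; exists (msupp (q i)) => //; rewrite mem_cat; apply/orP; left.
  by apply/mapP; exists i; rewrite // mem_enum.
have mss j m : m \notin ms -> mcoeff m (s j).2 = 0.
  move=> mms; apply: memN_msupp_eq0; apply: contra mms => mq.
  apply/flattenP; exists (msupp (s j).2) => //; rewrite mem_cat; apply/orP; right.
  by apply/mapP; exists (s j); rewrite // mem_tnth.
pose nm (j : 'I_(size ms)) := tnth (in_tuple ms) j.
(* Writing 0 in place of [q i0] leaves the indices of the other vectors unchanged. *)
pose q' i := if i == i0 then 0 else q i.
pose v (j : 'I_(N + size l)) := match split j with
  inl i => q' i | inr j => (s j).2 end.
have [[t [d [t0 dE]]]|[lam [lamv lamq]]] :=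
    linear_functional (fun j k => mcoeff (nm k) (v j)) (fun k => mcoeff (nm k) (q i0)) dom.
  have tq : t *: q i0 = \sum_j d j *: v j.
    apply/mpolyP => m; rewrite mcoeffZ linear_sum /=.
    under eq_bigr => j _ do rewrite mcoeffZ.
    have [mms|mms] := boolP (m \in ms).
      have /tnthP[k mk] : m \in in_tuple ms by [].
      by rewrite mk dE.
    rewrite msq // mulr0 big1 // => j _; rewrite /v /q'; case: (split j) => k.
      by case: ifP; rewrite ?mcoeff0 ?msq ?mulr0.
    by rewrite mss ?mulr0.
  case: t0; pose d' i := d (lshift (size l) i).
  have := ind (fun i => if i == i0 then t else - d' i).
  move=> /(_ _ i0); rewrite eqxx; apply.
  rewrite (bigD1 i0) //= eqxx -linearZ /= tq big_split_ord /= linearD !linear_sum /=.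
  rewrite [X in _ + X + _]big1 ?addr0 => [|j _]; last first.
    by rewrite linearZ /= /v (unsplitK (inr _ j)) evs scaler0.
  rewrite (bigD1 i0) //= /v (unsplitK (inl _ i0)) /q' eqxx scaler0 linear0 add0r.
  rewrite -big_split big1 //= => i /negPf ni.
  by rewrite (unsplitK (inl _ i)) ni linearZ /= scaleNr addrN.
have lamE (w : mpoly n R) (c0 : C) :
    \sum_k lam k *: mcoeff (nm k) (coefC c0 * scalar_ext w) =
    (\sum_k lam k * mcoeff (nm k) w) *: c0.
  rewrite scaler_suml; apply: eq_bigr => k _.
  rewrite [mcoeff _ _]mcoeffCM msupp_scalar_ext in_algE.
  by rewrite -scalerAr mulr1 scalerA.
have : \sum_k lam k *: mcoeff (nm k) (\sum_i coefC (c i) * scalar_ext (q i) : CX) = 0.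
  rewrite qE (big_tnth _ _ l); under eq_bigr => k _ do rewrite linear_sum scaler_sumr.
  rewrite exchange_big /= big1 // => j _; rewrite [LHS]lamE.
  have := lamv (rshift N j); rewrite /v (unsplitK (inr _ j)) => ->.
  by rewrite scale0r.
under eq_bigr => k _ do rewrite linear_sum scaler_sumr.
rewrite exchange_big /=; rewrite (eq_bigr _ (fun i _ => lamE (q i) (c i))).
rewrite (bigD1 i0) //= [X in _ + X]big1 ?addr0 => [|i /negPf ni]; last first.
  have := lamv (lshift (size l) i); rewrite /v (unsplitK (inl _ i)) /q' ni => ->.
  by rewrite scale0r.
exact: tfC.
Qed.

Lemma tensor_alg : exists (D : comAlgType R)
  (iC : {lrmorphism C -> D}) (iB : {lrmorphism B -> D}),
  [/\ forall (E : comAlgType R) (f : {lrmorphism C -> E}) (g : {lrmorphism B -> E}),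
        exists h : {lrmorphism D -> E}, h \o iC =1 f /\ h \o iB =1 g,
      forall d, exists l : seq (C * B), d = \sum_(e <- l) iC e.1 * iB e.2
    & (forall a b : R, a * b = 0 -> a = 0 \/ b = 0) -> torsion_free C ->
      forall N (c : 'I_N -> C) (b : 'I_N -> B), independent b ->
      \sum_i iC (c i) * iB (b i) = 0 -> forall i, c i = 0].
Proof.
have [D [pr [prS prK]]] := quotient_alg tensor_ideal_ideal tensor_ideal1.
have [q|iB iBE] := lrmorphism_factor (f := pr \o scalar_ext) evS.
  move=> q0; apply/prK; exists [:: (1, q)] => [e|].
    by rewrite inE => /eqP ->.
  by rewrite big_seq1 [coefC 1](rmorph1 coefC) mul1r.
exists D, (pr \o coefC), iB; split=> [E f g|d|dom tfC N c b ib].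
- have [h0 [h0C h0B]] := tensor_lift f g.
  have [x|h hE] := lrmorphism_factor (f := h0) prS.
    move=> /prK[l lP ->]; rewrite rmorph_sum big1_seq // => e el.
    by rewrite [LHS]rmorphM [X in _ * X](h0B e.2) /= lP // rmorph0 mulr0.
  exists h; split=> [c|b]; first by rewrite -h0C /= -[LHS]/((h \o pr) _) hE.
  have [q <-] := evS b; rewrite /= -[iB _]/((iB \o ev) q) iBE.
  by rewrite /= -[LHS]/((h \o pr) _) hE -[LHS]/((h0 \o scalar_ext) q) h0B.
- have [x <-] := prS d.
  exists [seq (mcoeff m x, ev (mpolyX R m)) | m <- msupp (x : mpoly n C)].
  rewrite big_map [in LHS](mpolyE (x : mpoly n C)) [LHS]rmorph_sum; apply: eq_bigr => m _ /=.
  rewrite -mul_mpolyC [LHS]rmorphM -[iB _]/((iB \o ev) _) iBE /=; congr (_ * pr _).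
  by rewrite scalar_extX.
- pose q i := sval (cid (evS (b i))).
  have qE i : ev (q i) = b i by rewrite /q; case: cid.
  move=> cb; apply: (@tensor_independent N c q) => //.
    by move=> d; under eq_bigr => i _ do rewrite /= qE; exact: ib.
  apply/prK; rewrite -[RHS]cb rmorph_sum; apply: eq_bigr => i _.
  by rewrite rmorphM -(qE i) -[iB _]/((iB \o ev) _) iBE.
Qed.

End TensorProduct.

(** * Points of affine group schemes *)

Lemma multiplicative1 (H K : groupType) (f : {multiplicative H -> K}) : f 1%g = 1%g.
Proof. by apply: (@mulgI _ (f 1%g)); rewrite -gmulfM !mulg1. Qed.

Lemma multiplicativeV (H K : groupType) (f : {multiplicative H -> K}) x :
  f x^-1%g = (f x)^-1%g.
Proof.
by apply: (@mulgI _ (f x)); rewrite -gmulfM !mulgV multiplicative1.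
Qed.

Section Points.
Variables (R : comNzRingType) (G : affineGroupScheme R).
Local Notation B := (coordRing G).

(** The value b(x) of a function at a point: by Yoneda a point is a morphism out of the coordinate
    ring. *)
Definition pt_eval (E : comAlgType R) (x : G E) : {lrmorphism B -> E} :=
  sval (cid (univ_pointP x)).

Lemma pt_evalP (E : comAlgType R) (x : G E) : pt_map (pt_eval x) (univ_point G) = x.
Proof. by rewrite /pt_eval; case: cid. Qed.

Lemma pt_eval_uniq (E : comAlgType R) (x : G E) (u : {lrmorphism B -> E}) :
  pt_map u (univ_point G) = x -> u =1 pt_eval x.
Proof. by move=> ux; apply: univ_point_inj; rewrite pt_evalP. Qed.

Lemma pt_map1 (A C : comAlgType R) (u : {lrmorphism A -> C}) :
  pt_map u 1%g = 1%g :> G C.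
Proof. exact: multiplicative1. Qed.

Lemma pt_map_comp1 (A C D : comAlgType R) (u : {lrmorphism A -> C})
    (v : {lrmorphism C -> D}) (x : G A) : pt_map (v \o u) x = pt_map v (pt_map u x).
Proof. exact: (pt_map_comp (w := v \o u)). Qed.

Lemma pt_map_ext (A C : comAlgType R) (u v : {lrmorphism A -> C}) :
  u =1 v -> pt_map u =1 pt_map v :> (G A -> G C).
Proof. by move=> /lrmorphism_ext ->. Qed.

Lemma pt_eval_map (A C : comAlgType R) (u : {lrmorphism A -> C}) (x : G A) b :
  pt_eval (pt_map u x) b = u (pt_eval x b).
Proof.
by apply/esym; apply: (@pt_eval_uniq _ _ (u \o pt_eval x)); rewrite pt_map_comp1 pt_evalP.
Qed.

Lemma pt_eval_univ b : pt_eval (univ_point G) b = b.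
Proof.
have [id_B idE] := @lrmorphism_of R B B id (erefl _) (fun _ _ => erefl)
  (fun _ _ => erefl) (fun _ _ => erefl).
by rewrite -[RHS]idE; apply/esym/pt_eval_uniq/pt_map_id.
Qed.

Hypothesis B_gen : exists n (ev : {lrmorphism mpoly n R -> B}), forall b, exists q, ev q = b.

(** [D] is the coordinate ring of [G] over [C] and [w] its generic point. The unit of [G C] supplies
    the morphism from [B] to [C] that keeps [D] nonzero. *)
Lemma tensor_point (C : comAlgType R) : exists (D : comAlgType R)
    (iC : {lrmorphism C -> D}) (w : G D),
  [/\ forall (E : comAlgType R) (f : {lrmorphism C -> E}) (z : G E),
        exists h : {lrmorphism D -> E}, h \o iC =1 f /\ pt_map h w = z,
      forall d, exists l : seq (C * B), d = \sum_(e <- l) iC e.1 * pt_eval w e.2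
    & (forall a b : R, a * b = 0 -> a = 0 \/ b = 0) -> torsion_free C ->
      forall N (c : 'I_N -> C) (b : 'I_N -> B), independent b ->
      \sum_i iC (c i) * pt_eval w (b i) = 0 -> forall i, c i = 0].
Proof.
have [n [ev evS]] := B_gen.
have [D [iC [iB [univ dec ind]]]] := tensor_alg (pt_eval (1%g : G C)) evS.
exists D, iC, (pt_map iB (univ_point G)).
have evE b : pt_eval (pt_map iB (univ_point G)) b = iB b.
  by rewrite pt_eval_map pt_eval_univ.
split=> [E f z|d|dom tfC N c b ib cb].
- have [h [hC hB]] := univ E f (pt_eval z); exists h; split=> //.
  by rewrite -pt_map_comp1 (pt_map_ext hB) pt_evalP.
- by have [l ->] := dec d; exists l; apply: eq_bigr => e _; rewrite evE.
- by apply: (ind dom tfC _ _ _ ib); rewrite -[RHS]cb; apply: eq_bigr => i _; rewrite evE.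
Qed.

Lemma univ_tuple n : exists (C : comAlgType R) (g : 'I_n -> G C),
  forall (E : comAlgType R) (g' : 'I_n -> G E), exists h : {lrmorphism C -> E},
    forall i, pt_map h (g i) = g' i.
Proof.
elim: n => [|n [C [g gP]]].
  exists R^o, (fun=> 1%g) => E g'.
  have [|x y|x y|a x|h _] := @lrmorphism_of R R^o E (in_alg E).
  - exact: rmorph1.
  - exact: rmorphD.
  - exact: rmorphM.
  - by rewrite !in_algE scalerA.
  by exists h => -[].
have [D [iC [w [univ _ _]]]] := tensor_point C.
exists D, (fun i => if unlift ord0 i is Some j then pt_map iC (g j) else w) => E g'.
have [f fE] := gP E (g' \o lift ord0).
have [h [hC hw]] := univ E f (g' ord0).
exists h => i; case: (unliftP ord0 i) => [j|] ->; last by rewrite hw.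
by rewrite -pt_map_comp1 (pt_map_ext hC) fE.
Qed.

Hypotheses (vR : valuation_domain R) (noeth : noetherian R) (tfB : torsion_free B).

(** One independent family serves all the [d i]: it generates a module that contains all their
    [B]-components. *)
Lemma tensor_decomposition (C D : comAlgType R) (iC : {lrmorphism C -> D}) (w : G D) q
    (d : 'I_q -> D) :
  (forall d, exists l : seq (C * B), d = \sum_(e <- l) iC e.1 * pt_eval w e.2) ->
  exists s (b : 'I_s -> B) (c : 'I_q -> 'I_s -> C), independent b /\
    forall i, d i = \sum_j iC (c i j) * pt_eval w (b j).
Proof.
move=> dec; pose l i := sval (cid (dec (d i))).
have lE i : d i = \sum_(e <- l i) iC e.1 * pt_eval w e.2 by rewrite /l; case: cid.
pose T : finType := {i : 'I_q & 'I_(size (l i))}.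
pose v (k : T) := (tnth (in_tuple (l (tag k))) (tagged k)).2.
have [s [b [ib vb]]] := independent_generators_fin vR tfB v.
suff dP i : exists c : 'I_s -> C, d i = \sum_j iC (c j) * pt_eval w (b j).
  by exists s, b, (fun i => sval (cid (dP i))); split=> // i; case: cid.
pose a k := sval (cid (vb k)).
have aE k : v k = \sum_j a k j *: b j by rewrite /a; case: cid.
pose e j := tnth (in_tuple (l i)) j.
exists (fun j => \sum_(k < size (l i)) a (Tagged (fun i => 'I_(size (l i))) k) j *: (e k).1).
rewrite lE big_tnth; under [RHS]eq_bigr => j _ do rewrite linear_sum mulr_suml.
rewrite exchange_big; apply: eq_bigr => k _ /=.
rewrite -[(tnth _ k).2]/(v (Tagged (fun i => 'I_(size (l i))) k)) aE linear_sum mulr_sumr.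
by apply: eq_bigr => j _; rewrite !linearZ /= -scalerAl -scalerAr.
Qed.

Lemma tensor_torsion_free (C D : comAlgType R) (iC : {lrmorphism C -> D}) (w : G D) :
  torsion_free C ->
  (forall d, exists l : seq (C * B), d = \sum_(e <- l) iC e.1 * pt_eval w e.2) ->
  (torsion_free C -> forall N (c : 'I_N -> C) (b : 'I_N -> B), independent b ->
      \sum_i iC (c i) * pt_eval w (b i) = 0 -> forall i, c i = 0) ->
  torsion_free D.
Proof.
move=> tfC dec ind t d t0.
have [s [b [c [ib dE]]]] := tensor_decomposition (fun _ : 'I_1 => d) dec.
rewrite (dE ord0) scaler_sumr => tc; rewrite big1 // => j _.
suff -> : c ord0 j = 0 by rewrite rmorph0 mul0r.
apply: (tfC _ _ t0); move: j; apply: (ind tfC _ _ _ ib); rewrite -[RHS]tc.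
by apply: eq_bigr => j _; rewrite linearZ /= scalerAl.
Qed.

(** Comparison of coefficients; the decisive test is the generic point over [C]. *)
Lemma independent_pt_eval (C : comAlgType R) N (c : 'I_N -> C) (b : 'I_N -> B) :
  torsion_free C -> independent b ->
  (forall (E : comAlgType R) (f : {lrmorphism C -> E}) (w : G E),
    \sum_i f (c i) * pt_eval w (b i) = 0) -> forall i, c i = 0.
Proof.
move=> tfC ib cb; have [D [iC [w [_ _ ind]]]] := tensor_point C.
exact: (ind (proj1 vR) tfC _ _ _ ib).
Qed.

(** Identities in two points can be checked at this generic pair, where torsion freeness makes
    [independent_pt_eval] available, and then specialised. *)
Lemma univ_pair : exists (C : comAlgType R) (x y : G C), torsion_free C /\
  forall (E : comAlgType R) (x' y' : G E), exists h : {lrmorphism C -> E},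
    pt_map h x = x' /\ pt_map h y = y'.
Proof.
have [D [iB [w [univ dec ind]]]] := tensor_point B.
exists D, (pt_map iB (univ_point G)), w; split.
  exact: tensor_torsion_free tfB dec (ind (proj1 vR)).
move=> E x' y'; have [h [hB hw]] := univ E (pt_eval x') y'; exists h; split=> //.
by rewrite -pt_map_comp1 (pt_map_ext hB) pt_evalP.
Qed.

(** Decompose the value at the product of two generic points, then specialise these to x and y. *)
Lemma comultiplication q (d : 'I_q -> B) :
  exists s (b : 'I_s -> B) (a : 'I_q -> 'I_s -> B), independent b /\
    forall i (E : comAlgType R) (x y : G E),
      pt_eval (x * y)%g (d i) = \sum_j pt_eval x (a i j) * pt_eval y (b j).
Proof.
have [D [iB [w [univ dec _]]]] := tensor_point B.
pose x0 := pt_map iB (univ_point G).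
have [s [b [a [ib dE]]]] := tensor_decomposition (fun i => pt_eval (x0 * w)%g (d i)) dec.
exists s, b, a; split=> // i E x y.
have [h [hB hw]] := univ E (pt_eval x) y.
have hx : pt_map h x0 = x by rewrite -pt_map_comp1 (pt_map_ext hB) pt_evalP.
rewrite -{1}hx -{1}hw -gmulfM pt_eval_map dE rmorph_sum; apply: eq_bigr => j _.
by rewrite rmorphM -hw pt_eval_map -(hB (a i j)).
Qed.

End Points.

(** * Cayley-Hamilton on finite free subcomodules *)

(** Iterated products replace ring powers so that dimension 0 is included; [Cayley_Hamilton] is
    applied in positive dimension. *)
Lemma char_poly_iter_mulmx (R : comNzRingType) n (A : 'M[R]_n) :
  \sum_(j < n.+1) (char_poly A)`_j *: iter j (mulmx A) 1%:M = 0.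
Proof.
case: n A => [|n] A; first by apply/matrixP; case.
rewrite -[RHS](Cayley_Hamilton A) -[char_poly A in RHS]coefK poly_def size_char_poly.
rewrite linear_sum; apply: eq_bigr => j _; rewrite linearZ /= rmorphXn /= horner_mx_X.
congr (_ *: _); elim: (j : nat) => [|i IHi]; first by rewrite expr0.
by rewrite iterS IHi exprS.
Qed.

Section Comodules.
Variables (R : comNzRingType) (G : affineGroupScheme R).
Local Notation B := (coordRing G).
Hypothesis B_gen : exists n (ev : {lrmorphism mpoly n R -> B}), forall b, exists q, ev q = b.
Hypotheses (vR : valuation_domain R) (noeth : noetherian R) (tfB : torsion_free B).

Lemma pt_eval_span (E : comAlgType R) (x : G E) n (c : 'I_n -> R) (b : 'I_n -> B) :
  pt_eval x (\sum_i c i *: b i) = \sum_i c i *: pt_eval x (b i).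
Proof. by rewrite linear_sum; apply: eq_bigr => i _; rewrite linearZ. Qed.

(* If the b_i (x y) lie in N (x) B with N spanned by the a_j, then the b in B such
   that b (x y) lies in N (x) B form a submodule of N which is a subcomodule. *)
Lemma free_subcomodule q (b : 'I_q -> B) :
  exists d (e : 'I_d -> B) (M : 'M[B]_d), [/\ independent e,
    forall i, in_span e (b i)
    & forall k (E : comAlgType R) (x y : G E),
        pt_eval (x * y)%g (e k) = \sum_l pt_eval x (e l) * pt_eval y (M l k)].
Proof.
have [s [beta [alpha [_ bE]]]] := comultiplication B_gen vR tfB b.
have [r [a [ia aP]]] := independent_generators_fin vR tfB (fun k => alpha k.1 k.2).
pose coact (f : B) (m : 'I_r -> B) := forall (E : comAlgType R) (x y : G E),
  pt_eval (x * y)%g f = \sum_j pt_eval x (a j) * pt_eval y (m j).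
pose W : set B := fun f => exists m, coact f m.
have W_sub : is_submodule W.
  split=> [|f g [m fm] [m' gm]|t f [m fm]].
  - by exists (fun=> 0) => E x y; rewrite rmorph0 big1 // => j _; rewrite rmorph0 mulr0.
  - exists (fun j => m j + m' j) => E x y; rewrite rmorphD /= fm gm -big_split.
    by apply: eq_bigr => j _; rewrite rmorphD mulrDr.
  - exists (fun j => t *: m j) => E x y; rewrite linearZ /= fm scaler_sumr.
    by apply: eq_bigr => j _; rewrite linearZ /= scalerAr.
(* Take the generic point for x and 1 for y: the values m_j(1) come from [R]. *)
have W_a f : W f -> in_span a f.
  move=> [m fm]; have [C [g gP]] := univ_tuple B_gen 0.
  have [iR _] := @lrmorphism_of R R^o B (in_alg B) (rmorph1 _) (rmorphD _) (rmorphM _)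
    (fun a x => etrans (in_algE _ _) (esym (scalerA a x 1))).
  exists (fun j => pt_eval (1%g : G R^o) (m j)).
  rewrite -[LHS]pt_eval_univ -[univ_point G]mulg1 fm; apply: eq_bigr => j _.
  rewrite pt_eval_univ -(pt_map1 _ iR) pt_eval_map mulrC.
  move: (pt_eval _ _) => t; rewrite -[t in iR t]mulr1 -[t * 1]/(t *: (1 : R^o)).
  by rewrite linearZ rmorph1 mulr_algl.
have Wb i : W (b i).
  pose c k := sval (cid (aP k)).
  have cE k : alpha k.1 k.2 = \sum_j c k j *: a j by rewrite /c; case: cid.
  exists (fun l => \sum_j c (i, j) l *: beta j) => E x y.
  rewrite bE; under eq_bigr => j _ do rewrite (cE (i, j)) pt_eval_span mulr_suml.
  rewrite exchange_big; apply: eq_bigr => l _ /=; rewrite pt_eval_span mulr_sumr.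
  by apply: eq_bigr => j _; rewrite -scalerAl -scalerAr.
have [m [w wP]] := submodule_generators noeth W_sub W_a.
have [d [e [ie we ew]]] := independent_generators vR tfB w.
have eP f : W f <-> in_span e f.
  by split=> [/wP/(in_span_sub we)|/(in_span_sub ew)/wP].
have We k : W (e k) by apply/eP/in_span_id.
pose mu k := sval (cid (We k)).
have muE k : coact (e k) (mu k) by rewrite /mu; case: cid.
(* The e_k and their components mu_kj are expanded along one independent family [eta], so that
   coefficients can be compared. *)
pose T : finType := ('I_d + 'I_d * 'I_r)%type.
pose fam (t : T) := match t with inl k => e k | inr kj => mu kj.1 kj.2 end.
have [z [eta [A [ieta AE]]]] := comultiplication B_gen vR tfB (fam \o @enum_val T T).
have famE t (E : comAlgType R) (x y : G E) : pt_eval (x * y)%g (fam t) =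
    \sum_j pt_eval x (A (enum_rank t) j) * pt_eval y (eta j).
  by rewrite -AE /= enum_rankK.
(* Coassociativity: expand e_k((x y) v) and e_k(x (y v)) and compare the coefficients of
   eta_u(v). *)
have Weps k u : W (A (enum_rank (inl k : T)) u).
  exists (fun j => A (enum_rank (inr (k, j) : T)) u).
  have [C [x2 [y2 [tfC univ]]]] := univ_pair B_gen vR tfB.
  suff Gam0 : pt_eval (x2 * y2)%g (A (enum_rank (inl k : T)) u) =
      \sum_j pt_eval x2 (a j) * pt_eval y2 (A (enum_rank (inr (k, j) : T)) u).
    move=> E x y; have [h [<- <-]] := univ E x y.
    rewrite -gmulfM pt_eval_map Gam0 rmorph_sum; apply: eq_bigr => j _.
    by rewrite rmorphM !pt_eval_map.
  apply/eqP; rewrite -subr_eq0; apply/eqP; move: u.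
  apply: (independent_pt_eval B_gen vR tfC ieta) => E f v.
  under eq_bigr => u _ do rewrite rmorphB rmorph_sum mulrBl mulr_suml /= -pt_eval_map gmulfM.
  rewrite sumrB -(famE (inl k)) exchange_big /= -mulgA muE; apply/eqP.
  rewrite subr_eq0; apply/eqP; apply: eq_bigr => j _.
  rewrite (famE (inr (k, j))) mulr_sumr; apply: eq_bigr => u _.
  by rewrite rmorphM !pt_eval_map mulrA.
have Weps' k u : in_span e (A (enum_rank (inl k : T)) u) by apply/eP.
pose c k u := sval (cid (Weps' k u)).
have cE k u : A (enum_rank (inl k : T)) u = \sum_l c k u l *: e l by rewrite /c; case: cid.
exists d, e, (\matrix_(l, k) \sum_u c k u l *: eta u); split=> // [i|k E x y]; first exact/eP.
rewrite (famE (inl k)); under eq_bigr => u _ do rewrite cE pt_eval_span mulr_suml.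
rewrite exchange_big; apply: eq_bigr => l _ /=; rewrite mxE pt_eval_span mulr_sumr.
by apply: eq_bigr => u _; rewrite -scalerAl -scalerAr.
Qed.

Section Matrix.
Variables (d : nat) (e : 'I_d -> B) (M : 'M[B]_d).
Hypotheses (ie : independent e) (eM : forall k (E : comAlgType R) (x y : G E),
        pt_eval (x * y)%g (e k) = \sum_l pt_eval x (e l) * pt_eval y (M l k)).

(** Column k holds the coordinates of the right translate of [e k] by [y]. *)
Definition comod_mx (E : comAlgType R) (y : G E) : 'M[E]_d := map_mx (pt_eval y) M.

Lemma comod_mx_map (E F : comAlgType R) (u : {lrmorphism E -> F}) (y : G E) :
  comod_mx (pt_map u y) = map_mx u (comod_mx y).
Proof. by apply/matrixP => i j; rewrite !mxE pt_eval_map. Qed.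

(** Associativity in e_k(w x y), compared along the independent [e l] over the algebra of a generic
    pair. *)
Lemma comod_mxM (E : comAlgType R) (x y : G E) :
  comod_mx (x * y)%g = comod_mx x *m comod_mx y.
Proof.
have [C [x2 [y2 [tfC univ]]]] := univ_pair B_gen vR tfB.
have [h [<- <-]] := univ E x y.
rewrite -gmulfM !comod_mx_map -map_mxM; congr map_mx; apply/matrixP => l k.
apply/eqP; rewrite -subr_eq0; apply/eqP; move: l.
apply: (independent_pt_eval B_gen vR tfC ie) => F f w.
under eq_bigr => l _ do rewrite rmorphB mulrBl.
rewrite sumrB; apply/eqP; rewrite subr_eq0; apply/eqP.
transitivity (pt_eval (w * (pt_map f x2 * pt_map f y2))%g (e k)).
  by rewrite eM -gmulfM; apply: eq_bigr => l _; rewrite mulrC mxE pt_eval_map.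
rewrite mulgA eM; under eq_bigr => j _ do rewrite eM mulr_suml.
rewrite exchange_big; apply: eq_bigr => l _ /=; rewrite mxE rmorph_sum mulr_suml.
by apply: eq_bigr => j _; rewrite rmorphM !mxE !pt_eval_map -mulrA mulrC.
Qed.

Lemma comod_mx1 (E : comAlgType R) : comod_mx (1%g : G E) = 1%:M.
Proof.
rewrite -(pt_map1 _ (pt_eval (1%g : G E))) comod_mx_map -(map_mx1 (pt_eval (1%g : G E))).
congr map_mx; apply/matrixP => l k.
apply/eqP; rewrite -subr_eq0; apply/eqP; move: l.
apply: (independent_pt_eval B_gen vR tfB ie) => F f w.
under eq_bigr => l _ do rewrite rmorphB mulrBl.
rewrite sumrB; apply/eqP; rewrite subr_eq0; apply/eqP.
transitivity (pt_eval (w * 1)%g (e k)).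
  rewrite eM -(pt_map1 _ f); apply: eq_bigr => l _.
  by rewrite mulrC mxE pt_eval_map.
rewrite mulg1 (bigD1 k) //= mxE eqxx rmorph1 mul1r big1 ?addr0 // => l /negPf kl.
by rewrite mxE kl rmorph0 mul0r.
Qed.

Definition comod_char_coef j : B := (char_poly M)`_j.

Lemma comod_char_coefE (E : comAlgType R) (y : G E) j :
  pt_eval y (comod_char_coef j) = (char_poly (comod_mx y))`_j.
Proof. by rewrite /comod_mx -map_char_poly coef_map. Qed.

(** Multiplicativity of [comod_mx] makes the matrices of conjugate points similar. *)
Lemma comod_char_coefJ (E : comAlgType R) (h y : G E) j :
  pt_eval (h * y * h^-1)%g (comod_char_coef j) = pt_eval y (comod_char_coef j).
Proof.
rewrite !comod_char_coefE; congr (polyseq _)`_j; rewrite /char_poly /char_poly_mx !comod_mxM.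
have hV : comod_mx h *m comod_mx h^-1%g = 1%:M by rewrite -comod_mxM mulgV comod_mx1.
pose X A : 'M[{poly E}]_d := map_mx polyC A.
have XV : X (comod_mx h) *m X (comod_mx h^-1%g) = 1%:M.
  by rewrite -map_mxM hV map_mx1.
rewrite [LHS](_ : _ = \det (X (comod_mx h) *m ('X%:M - X (comod_mx y)) *m X (comod_mx h^-1%g))).
  by rewrite !det_mulmx mulrAC -det_mulmx XV det1 mul1r.
congr (\det _); rewrite mulmxBr mulmxBl; congr (_ - _).
  by rewrite scalar_mxC -mulmxA XV mulmx1.
by rewrite /X !map_mxM.
Qed.

Lemma comod_char_coef1 (E : comAlgType R) j :
  pt_eval (1%g : G E) (comod_char_coef j) = (('X - 1) ^+ d : {poly E})`_j.
Proof.
rewrite comod_char_coefE comod_mx1 /char_poly /char_poly_mx map_scalar_mx /=.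
by rewrite -raddfB det_scalar polyC1.
Qed.

Lemma comod_char_coef_monic : comod_char_coef d = 1.
Proof.
have /monicP := char_poly_monic M.
by rewrite /lead_coef size_char_poly.
Qed.

Lemma comod_mxX (E : comAlgType R) (x y : G E) k n :
  pt_eval (x * y ^+ n)%g (e k) =
  (\row_l pt_eval x (e l) *m iter n (mulmx (comod_mx y)) 1%:M) 0 k.
Proof.
elim: n x => [|n IHn] x; first by rewrite expg0 mulg1 mulmx1 mxE.
rewrite expgS mulgA IHn iterS mulmxA; congr ((_ *m _) 0 k).
by apply/rowP => l; rewrite !mxE eM; apply: eq_bigr => j _; rewrite !mxE.
Qed.

Lemma comod_recurrence (E : comAlgType R) (x y : G E) f : in_span e f ->
  \sum_(j < d.+1) pt_eval y (comod_char_coef j) * pt_eval (x * y ^+ j)%g f = 0.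
Proof.
move=> [c ->]; under eq_bigr => j _ do rewrite pt_eval_span mulr_sumr.
rewrite exchange_big big1 //= => k _.
under eq_bigr => j _ do rewrite -scalerAr.
rewrite -scaler_sumr (_ : \sum_j _ = 0) ?scaler0 //.
under eq_bigr => j _ do rewrite comod_mxX comod_char_coefE.
transitivity ((\row_l pt_eval x (e l) *m
  (\sum_(j < d.+1) (char_poly (comod_mx y))`_j *: iter j (mulmx (comod_mx y)) 1%:M)) 0 k).
  rewrite mulmx_sumr summxE; apply: eq_bigr => j _.
  by rewrite -scalemxAr [in RHS]mxE.
rewrite (_ : \sum_j _ = 0) ?mulmx0 ?mxE //.
exact: char_poly_iter_mulmx.
Qed.

End Matrix.
End Comodules.

(** * Recurrences for pseudocharacters *)

Section SlotRecurrence.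
Variables (R : comNzRingType) (G : affineGroupScheme R).
Local Notation B := (coordRing G).
Hypothesis B_gen : exists n (ev : {lrmorphism mpoly n R -> B}), forall b, exists q, ev q = b.
Hypotheses (vR : valuation_domain R) (noeth : noetherian R) (tfB : torsion_free B).

(** With z and the other arguments generic over [C], the value of [f] is an element of the tensor
    product of [C] and [B] in the variable x of slot [s]. Its finitely many components in [B] lie in
    one free subcomodule, and the recurrence there for x = g_s y^j passes to [f]. *)
Lemma slot_recurrence n (f : regfun G n) (s : 'I_n) : exists d (c : nat -> B),
  [/\ c d = 1,
      forall (E : comAlgType R) (h y : G E) j,
        pt_eval (h * y * h^-1)%g (c j) = pt_eval y (c j),
      forall (E : comAlgType R) j,
        pt_eval (1%g : G E) (c j) = (('X - 1) ^+ d : {poly E})`_j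
    & forall (E : comAlgType R) (g : 'I_n -> G E) (y z : G E),
        \sum_(j < d.+1) pt_eval y (c j) *
          f E (fun i => if i == s then (g i * y ^+ j * z)%g else g i) = 0].
Proof.
(* Of these n + 1 generic points, the one at [ord0] plays z and the others play the [g i]. *)
have [C [g0 univ]] := univ_tuple B_gen n.+1.
have [D [iC [w [univD dec _]]]] := tensor_point B_gen C.
pose slot (E : comAlgType R) (g : 'I_n -> G E) (x z : G E) i :=
  if i == s then (x * z)%g else g i.
pose d0 := f D (slot D (fun i => pt_map iC (g0 (lift ord0 i))) w (pt_map iC (g0 ord0))).
have [r [b [a [_ dE]]]] := tensor_decomposition vR tfB (fun _ : 'I_1 => d0) dec.
have [d [e [M [ie be eM]]]] := free_subcomodule B_gen vR noeth tfB b.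
exists d, (comod_char_coef M); split=> [|E h y j|E j|E g y z].
- exact: comod_char_coef_monic.
- exact: (comod_char_coefJ B_gen vR tfB ie eM).
- exact: (comod_char_coef1 B_gen vR tfB ie eM).
pose g1 i := if unlift ord0 i is Some j then g j else z.
have [h0 h0E] := univ E g1.
have slotE x : f E (slot E g x z) = \sum_j h0 (a ord0 j) * pt_eval x (b j).
  have [h [hC hw]] := univD E h0 x.
  transitivity (h d0).
    rewrite /d0 -regfun_nat; congr (f E _); apply: funext => i; rewrite /slot.
    case: ifP => _; rewrite ?gmulfM ?hw -pt_map_comp1 (pt_map_ext hC) h0E /g1.
      by rewrite unlift_none.
    by rewrite liftK.
  rewrite (dE ord0) rmorph_sum; apply: eq_bigr => j _.
  by rewrite rmorphM -(hC (a ord0 j)) -hw pt_eval_map.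
transitivity (\sum_(j < d.+1) \sum_l pt_eval y (comod_char_coef M j) *
    (h0 (a ord0 l) * pt_eval (g s * y ^+ j)%g (b l))).
  apply: eq_bigr => j _; rewrite -mulr_sumr -slotE; congr (_ * f E _).
  by apply: funext => i; rewrite /slot; case: eqP => [->|].
rewrite exchange_big big1 //= => l _.
under eq_bigr => j _ do rewrite mulrCA.
by rewrite -mulr_sumr (comod_recurrence eM) ?mulr0.
Qed.

End SlotRecurrence.

Section InvariantFunctions.
Variables (R : comNzRingType) (G : affineGroupScheme R).

Lemma invfun_ext n (f1 f2 : invfun G n) : (forall E g, f1 E g = f2 E g) -> f1 = f2.
Proof.
case: f1 f2 => [[e1 n1] i1] [[e2 n2] i2] /= e12.
have ee : e1 = e2 by do 2!apply: functional_extensionality_dep => ?; exact: e12.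
subst e2; rewrite (Prop_irrelevance n1 n2) in i1 *.
by rewrite (Prop_irrelevance i1 i2).
Qed.

Lemma invfun_sum n k (F : nat -> invfun G n.+1) : exists S : invfun G n.+1,
  (forall E g, S E g = \sum_(j < k) F j E g) /\
  forall (Gamma : groupType) (A : comAlgType R) (T : pseudochar G Gamma A) g,
    T n S g = \sum_(j < k) T n (F j) g.
Proof.
elim: k => [|k [S [SE TS]]].
  exists (invfunZ 0 (invfun1 G n.+1)); split=> [E|Gamma A T] g; rewrite big_ord0 /=.
    exact: scale0r.
  by rewrite thetaZ scale0r.
exists (invfunD S (F k)); split=> [E|Gamma A T] g; rewrite big_ord_recr /=.
  by rewrite SE.
by rewrite thetaD TS.
Qed.

Lemma theta_eq0 (Gamma : groupType) (A : comAlgType R) (T : pseudochar G Gamma A) n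
    (f : invfun G n.+1) g : (forall E x, f E x = 0) -> T n f g = 0.
Proof.
move=> f0; rewrite (@invfun_ext _ f (invfunZ 0 (invfun1 G n.+1))).
  by rewrite thetaZ scale0r.
by move=> E x; rewrite f0 /= scale0r.
Qed.

(** Word maps with which every pseudocharacter is compatible. The axioms grant reindexing and
    multiplication of the last two variables; composition yields the other words. *)
Definition substitutable n m (W : forall T : groupType, ('I_n.+1 -> T) -> 'I_m.+1 -> T) :=
  forall f : invfun G m.+1, exists f' : invfun G n.+1,
    (forall E g, f' E g = f E (W _ g)) /\
    forall (Gamma : groupType) (A : comAlgType R) (T : pseudochar G Gamma A) g,
      T n f' g = T m f (W _ g).

Lemma substitutable_comp n m l W V : @substitutable n m W -> @substitutable m l V ->
  @substitutable n l (fun T g => V T (W T g)).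
Proof.
move=> sW sV f; have [f' [f'E f'T]] := sV f; have [f'' [f''E f''T]] := sW f'.
by exists f''; split=> [E|Gamma A T] g; rewrite ?f''E ?f''T.
Qed.

Lemma substitutable_subst n m (z : 'I_m.+1 -> 'I_n.+1) :
  substitutable (fun T g => g \o z).
Proof.
by move=> f; exists (invfun_subst z f); split=> [E|Gamma A T] g //; rewrite theta_subst.
Qed.

Lemma substitutable_merge n : @substitutable n.+1 n (fun T => @merge_last T n).
Proof.
by move=> f; exists (invfun_merge f); split=> [E|Gamma A T] g //; rewrite theta_merge.
Qed.

Definition mul_slot n (s u : 'I_n) (T : groupType) (g : 'I_n -> T) i :=
  if i == s then (g i * g u)%g else g i.

Lemma substitutable_mul_slot n (s u : 'I_n.+1) : substitutable (mul_slot s u).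
Proof.
(* Copies of the variables at [s] and [u] are appended; merging them puts g_s g_u last, from where
   [z2] moves it to slot [s]. *)
pose z1 (i : 'I_n.+3) : 'I_n.+1 :=
  if (i < n.+1)%N then inord i else if (i == n.+1 :> nat) then s else u.
pose z2 (i : 'I_n.+1) : 'I_n.+2 := if i == s then ord_max else widen_ord (leqnSn _) i.
have := substitutable_comp (substitutable_subst z1)
  (substitutable_comp (@substitutable_merge n.+1) (substitutable_subst z2)).
congr (substitutable _); apply: functional_extensionality_dep => T; apply: funext => g.
apply: funext => i; rewrite /mul_slot /= /z2 /merge_last.
have [->|_] := eqVneq i s.
  by rewrite eqxx /= /z1 /= ltnn eqxx ltnNge leqW //= gtn_eqF.
rewrite ifF; last by apply/eqP => /(congr1 val) /= iE; have := ltn_ord i; rewrite iE ltnn.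
by rewrite /= /z1 /= ltn_ord inord_val.
Qed.

(** The tuple is read as (g_0, .., g_n, z, y), with the variable to be raised to a power in last
    place. *)
Definition power_slot n (s : 'I_n.+1) j (T : groupType) (g : 'I_n.+3 -> T) (i : 'I_n.+1) :=
  let: w := widen_ord (leq_trans (leqnSn _) (leqnSn _)) in
  if i == s then (g (w i) * g ord_max ^+ j * g (widen_ord (leqnSn _) ord_max))%g
  else g (w i).

Lemma substitutable_power_slot n (s : 'I_n.+1) j : substitutable (power_slot s j).
Proof.
pose w := @widen_ord n.+1 n.+3 (leq_trans (leqnSn _) (leqnSn _)).
elim: j => [|j IHj].
  have := substitutable_comp
    (substitutable_mul_slot (w s) (widen_ord (leqnSn _) ord_max)) (substitutable_subst w).
  congr (substitutable _); apply: functional_extensionality_dep => T; apply: funext => g.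
  apply: funext => i; rewrite /mul_slot /power_slot /= -val_eqE /=.
  by rewrite val_eqE expg0 mulg1.
(* The word g_s y^(j+1) z is the word of exponent j with g_s y for g_s. *)
have := substitutable_comp (substitutable_mul_slot (w s) ord_max) IHj.
congr (substitutable _); apply: functional_extensionality_dep => T; apply: funext => g.
apply: funext => i; rewrite /mul_slot /power_slot /= -!val_eqE /=.
have si := ltn_ord s; rewrite (gtn_eqF si) (gtn_eqF (leqW si)).
case: (eqVneq i s) => [->|ns]; first by rewrite !eqxx expgS !mulgA.
by case: eqP => // is_; case/eqP: ns; exact: val_inj.
Qed.

Hypothesis B_gen : exists n (ev : {lrmorphism mpoly n R -> coordRing G}),
  forall b, exists q, ev q = b.
Hypotheses (vR : valuation_domain R) (noeth : noetherian R).
Hypothesis tfB : torsion_free (coordRing G).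

Section ClassFunction.
Variable c : coordRing G.
Hypothesis cJ : forall (E : comAlgType R) (h y : G E),
  pt_eval (h * y * h^-1)%g c = pt_eval y c.

Fact class_invfun_nat (A C : comAlgType R) (u : {lrmorphism A -> C}) (g : 'I_1 -> G A) :
  pt_eval (pt_map u (g ord0)) c = u (pt_eval (g ord0) c).
Proof. exact: pt_eval_map. Qed.

Definition class_invfun : invfun G 1 :=
  @InvFun R G 1 (RegFun class_invfun_nat) (fun A h _ g => cJ h (g ord0)).

End ClassFunction.

(** The sum in [slot_recurrence] is an invariant function of n + 3 variables, because its
    coefficients are class functions. It vanishes at all points, hence is the zero function, and [T]
    kills it. *)
Lemma pseudochar_recurrence n (f : invfun G n.+1) (s : 'I_n.+1) :
  exists d (c : nat -> invfun G 1), [/\ c d = invfun1 G 1,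
    forall (E : comAlgType R) j,
      c j E (fun=> 1%g) = (('X - 1) ^+ d : {poly E})`_j
  & forall (Gamma : groupType) (A : comAlgType R) (T : pseudochar G Gamma A)
      (g : 'I_n.+1 -> Gamma) (y z : Gamma),
      \sum_(j < d.+1) T 0 (c j) (fun=> y) *
        T n f (fun i => if i == s then (g i * y ^+ j * z)%g else g i) = 0].
Proof.
have [d [c [cd cJ c1 cf]]] := slot_recurrence B_gen vR noeth tfB f s.
pose ci j := class_invfun (fun E h y => cJ E h y j).
exists d, ci; split=> [|E j|Gamma A T g y z].
- by apply: invfun_ext => E g; rewrite /= cd rmorph1.
- exact: c1.
pose fj j := sval (cid (substitutable_power_slot s j f)).
have fjE j E x : fj j E x = f E (power_slot s j x) by rewrite /fj; case: cid => ? [].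
have fjT j x : T n.+2 (fj j) x = T n f (power_slot s j x).
  by rewrite /fj; case: cid => ? [] ? /= ->.
pose F j := invfunM (invfun_subst (fun _ : 'I_1 => @ord_max n.+2) (ci j)) (fj j).
have [S [SE TS]] := invfun_sum d.+1 F.
pose x (i : 'I_n.+3) : Gamma :=
  if insub (val i) is Some j then g j else if i == ord_max then y else z.
have xg (i : 'I_n.+1) : x (widen_ord (leq_trans (leqnSn _) (leqnSn _)) i) = g i.
  by rewrite /x /= valK.
have xy : x ord_max = y by rewrite /x insubF ?eqxx //= ltnNge leqW.
have xz : x (widen_ord (leqnSn _) ord_max) = z.
  by rewrite /x insubF /= ?ltnn // -val_eqE /= ltn_eqF.
transitivity (T n.+2 S x).
  rewrite TS; apply: eq_bigr => j _; rewrite thetaM theta_subst fjT.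
  congr (_ * T n f _); first by congr (T 0 _ _); apply: funext => i; rewrite /= xy.
  by apply: funext => i; rewrite /power_slot xg xy xz.
apply: theta_eq0 => E x'; rewrite SE -[RHS](cf E (fun i => x' (widen_ord
  (leq_trans (leqnSn _) (leqnSn _)) i)) (x' ord_max) (x' (widen_ord (leqnSn _) ord_max))).
by apply: eq_bigr => j _ /=; rewrite fjE.
Qed.

End InvariantFunctions.

(** * Unipotent elements have p-power order *)

Section Unipotence.
Variable A : comNzRingType.

Definition nilpotent_elt (x : A) := exists n, x ^+ n = 0.

Lemma nilpotent_eltD (x y : A) :
  nilpotent_elt x -> nilpotent_elt y -> nilpotent_elt (x + y).
Proof.
move=> [m xm] [n yn]; exists (m + n)%N; rewrite exprDn big1 // => i _.
have [le_in|lt_ni] := leqP i n.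
  by rewrite -addnBA // exprD xm mul0r mul0r mul0rn.
by rewrite -(subnK (ltnW lt_ni)) exprD yn !mulr0 mul0rn.
Qed.

Lemma nilpotent_eltM (x y : A) : nilpotent_elt x -> nilpotent_elt (x * y).
Proof. by move=> [n xn]; exists n; rewrite exprMn xn mul0r. Qed.

End Unipotence.

Lemma nilpotent_poly (A : comNzRingType) (P : {poly A}) :
  (forall j, nilpotent_elt P`_j) -> nilpotent_elt P.
Proof.
move=> nP; rewrite -[P]coefK poly_def; apply: big_ind => [|x y|j _].
- by exists 1%N.
- exact: nilpotent_eltD.
- rewrite -mul_polyC; apply: nilpotent_eltM; have [n Pn] := nP j.
  by exists n; rewrite -rmorphXn Pn rmorph0.
Qed.

(** From j C(p^M, j) = p^M C(p^M - 1, j - 1), since the exponent of p in j is less than j. *)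
Lemma dvdn_bin_prime_power p M j : prime p -> (0 < j)%N ->
  (p ^ (M - j) %| 'C(p ^ M, j))%N.
Proof.
move=> p_pr j0; have [lt_pMj|le_jpM] := ltnP (p ^ M) j.
  by rewrite bin_small // dvdn0.
have C0 : (0 < 'C(p ^ M, j))%N by rewrite bin_gt0.
rewrite pfactor_dvdn // leq_subLR.
have : (M <= logn p (j * 'C(p ^ M, j)))%N.
  rewrite -pfactor_dvdn ?muln_gt0 ?j0 // -[(p ^ M)%N]prednK ?expn_gt0 ?prime_gt0 //.
  rewrite -[j]prednK // -mul_bin_diag; exact: dvdn_mulr.
rewrite lognM // => /leq_trans; apply; rewrite leq_add2r ltnW //.
exact: ltn_logl.
Qed.

Lemma unipotent_power (A : comNzRingType) p d (P : {poly A}) : prime p ->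
  nilpotent_elt (p%:R : A) -> (forall j, nilpotent_elt (P`_j - (('X - 1) ^+ d)`_j)) ->
  exists M H, 'X^(p ^ M) - 1 = H * P.
Proof.
move=> p_pr [e pe] nP; pose N := ('X - 1) ^+ d - P.
have [s Ns] : nilpotent_elt N.
  apply: nilpotent_poly => j; rewrite coefB -[X in nilpotent_elt X]opprB -[X in nilpotent_elt X]mulrN1.
  exact/nilpotent_eltM/nP.
have [H0 XH0] : exists H0, ('X - 1) ^+ (d * s) = H0 * P.
  (* Modulo P, the nilpotent N is ('X - 1) ^+ d. *)
  have XN : ('X - 1) ^+ d - N = P by rewrite /N opprB addrCA subrr addr0.
  have := subrXX (('X - 1) ^+ d) N s; rewrite Ns subr0 XN mulrC -exprM => ->.
  by eexists.
(* Expand ((X - 1) + 1)^(p^M). Terms of degree at least m in X - 1 are multiples of (X - 1)^m; for 0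
   < j < m the binomial coefficient is divisible by p^(M-j), hence by p^e = 0, as M = e + m. *)
pose m := (d * s)%N; exists (e + m)%N; set M := (e + m)%N.
suff [H XH] : exists H, 'X^(p ^ M) - 1 = H * ('X - 1 : {poly A}) ^+ m.
  by exists (H * H0); rewrite -mulrA -XH0.
rewrite -{1}['X](subrK 1) exprD1n.
rewrite big_ord_recl expr0 bin0 mulr1n addrC addKr.
apply: (big_ind (fun x => exists H, x = H * ('X - 1 : {poly A}) ^+ m)).
- by exists 0; rewrite mul0r.
- by move=> _ _ [x ->] [y ->]; exists (x + y); rewrite mulrDl.
move=> j _; rewrite lift0; have [le_mj|lt_jm] := leqP m j.+1.
  exists (('X - 1) ^+ (j.+1 - m) *+ 'C(p ^ M, j.+1)).
  by rewrite mulrnAl -exprD subnK.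
exists 0; rewrite mul0r -mulr_natr.
have /dvdnP[c ->] : (p ^ e %| 'C(p ^ M, j.+1))%N.
  apply: dvdn_trans (dvdn_bin_prime_power M p_pr (ltn0Sn j)).
  by rewrite dvdn_exp2l // /M -addnBA ?leq_addr // ltnW.
rewrite natrM natrX -[p%:R]polyC_natr -[X in _ * (_ * X)]rmorphXn pe.
by rewrite rmorph0 !mulr0.
Qed.

(** The ideals (a^n) stabilise, so a^N = c a^(N+1); as 1 - c a is a unit, a^N = 0. *)
Lemma artinian_local_nilpotent (R : comNzRingType) (k : fieldType)
    (res : {rmorphism R -> k}) (A : artLocalAlg res) (a : A) :
  artl_res A a = 0 -> nilpotent_elt a.
Proof.
move=> ra; pose I n : set A := fun x => exists c, x = c * a ^+ n.
have [n|n x [c ->]|N] := @artl_artinian _ _ _ A I.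
- split=> [|x y [c ->] [d ->]|b x [c ->]].
  + by exists 0; rewrite mul0r.
  + by exists (c + d); rewrite mulrDl.
  + by exists (b * c); rewrite mulrA.
- by exists (c * a); rewrite exprS mulrA.
move=> /(_ N.+1 (leqnSn N)) IN; exists N.
have : I N (a ^+ N) by exists 1; rewrite mul1r.
rewrite -IN => -[c aN].
have [_ /(_ (1 - c * a))[|u uc]] := artl_resP A.
  rewrite rmorphB rmorphM /= ra mulr0 subr0 rmorph1; exact/eqP/oner_neq0.
rewrite -[LHS]mul1r -uc -mulrA mulrBl mul1r {1}aN exprS mulrA subrr.
by rewrite mulr0.
Qed.

(** The recurrence says that the linear form sending X^j to [psi j] vanishes on the ideal generated
    by [P], which contains X^q - 1. *)
Lemma recurrence_period (A : comNzRingType) (P : {poly A}) (psi : nat -> A) H q :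
  (forall i, \sum_(j < size P) P`_j * psi (i + j)%N = 0) -> 'X^q - 1 = H * P ->
  psi q = psi 0%N.
Proof.
move=> rec XH; pose L (F : {poly A}) := \sum_(j < size F) F`_j * psi j.
have LE n (F : {poly A}) : (size F <= n)%N -> L F = \sum_(j < n) F`_j * psi j.
  move=> sF; rewrite /L (big_ord_widen n (fun j => F`_j * psi j) sF) big_mkcond.
  apply: eq_bigr => j _; case: ltnP => // le_Fj.
  by rewrite nth_default ?mul0r.
have LD F F' : L (F + F') = L F + L F'.
  pose n := maxn (size F) (size F').
  rewrite (LE n _ (size_polyD _ _)) (LE n F (leq_maxl _ _)) (LE n F' (leq_maxr _ _)).
  by rewrite -big_split; apply: eq_bigr => j _; rewrite coefD mulrDl.
have LZ a F : L (a *: F) = a * L F.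
  rewrite (LE (size F)) ?size_scale_leq // /L mulr_sumr.
  by apply: eq_bigr => j _; rewrite coefZ mulrA.
have LX n : L 'X^n = psi n.
  rewrite (LE n.+1) ?size_polyXn // big_ord_recr /= coefXn eqxx mul1r big1 ?add0r //.
  by move=> j _; rewrite coefXn ltn_eqF // mul0r.
have LXP i : L ('X^i * P) = 0.
  rewrite (LE (i + size P)%N); last first.
    have [->|P0] := eqVneq P 0; first by rewrite mulr0 size_poly0.
    by rewrite (leq_trans (size_polyMleq _ _)) // size_polyXn addSn.
  rewrite big_split_ord /= big1 ?add0r => [|j _]; last by rewrite coefXnM ltn_ord mul0r.
  rewrite -[RHS](rec i); apply: eq_bigr => j _.
  by rewrite coefXnM ltnNge leq_addr /= addKn.
have LHP : L (H * P) = 0.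
  rewrite -[H]coefK poly_def mulr_suml; apply: (big_ind (fun F => L F = 0)).
  - by rewrite -(scale0r P) LZ mul0r.
  - by move=> F F' LF LF'; rewrite LD LF LF' addr0.
  - by move=> j _; rewrite -scalerAl LZ LXP mulr0.
have : L ('X^q + (-1) *: 'X^0) = 0 by rewrite -LHP -XH scaleN1r.
by rewrite LD LZ !LX mulN1r => /eqP; rewrite subr_eq0 => /eqP.
Qed.

Section SmoothCoordinateRing.
Variables (R : comNzRingType) (B : comAlgType R).

Lemma smooth_generated : smooth B ->
  exists n (ev : {lrmorphism mpoly n R -> B}), forall b, exists q, ev q = b.
Proof.
move=> [[n [x]] /= [evS _] _]; have [ev evE] := mmap_lrmorphism x.
by exists n, ev => b; have [q <-] := evS b; exists q; rewrite evE.
Qed.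

Lemma smooth_torsion_freeP : valuation_domain R -> noetherian R -> smooth B ->
  torsion_free B.
Proof.
move=> [dom _] noeth sB t b t0; apply: smooth_torsion_free => // a /dom[|//].
by move=> t0'; case: t0.
Qed.

End SmoothCoordinateRing.

Lemma map_coef_X1 (R S : nzRingType) (f : {rmorphism R -> S}) d j :
  f (('X - 1) ^+ d : {poly R})`_j = (('X - 1) ^+ d : {poly S})`_j.
Proof. by rewrite -coef_map rmorphXn rmorphB rmorph1 /= map_polyX. Qed.

Section DeformationPeriod.
Variables (R : comNzRingType) (k : fieldType) (res : {rmorphism R -> k}) (p : nat).
Hypotheses (p_pr : prime p) (res_p : res p%:R = 0).
Hypotheses (vR : valuation_domain R) (noeth : noetherian R).
Variables (G : affineGroupScheme R) (K : fieldType) (iota : {rmorphism k -> K}).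
Hypothesis G_smooth : smooth (coordRing G).
Variables (Gamma : groupType) (Tbar : pseudochar G Gamma (alg_of res)).
Variable rho : {multiplicative Gamma -> G (alg_of (iota \o res))}.
Hypothesis rho_Tbar : psc_eq (psc_of_rep rho) (base_change (alg_of_map res iota) Tbar).
Variables (A : artLocalAlg res) (T : pseudochar G Gamma A).
Hypothesis T_Tbar : psc_eq (base_change (artl_res A) T) Tbar.

(** [M] is uniform in [g] and [z] because the coefficients of the recurrence involve [y] alone. This
    uniformity is what puts y^(p^M) in the subgroup of harmless insertions. *)
Lemma deformation_period n (f : invfun G n.+1) (s : 'I_n.+1) y : rho y = 1%g ->
  exists M, forall (g : 'I_n.+1 -> Gamma) z,
    T n f (fun i => if i == s then (g i * y ^+ (p ^ M) * z)%g else g i) =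
    T n f (fun i => if i == s then (g i * z)%g else g i).
Proof.
move=> rho_y.
have [d [c [cd c1 crec]]] := pseudochar_recurrence (smooth_generated G_smooth) vR noeth
  (smooth_torsion_freeP vR noeth G_smooth) f s.
pose P : {poly A} := \poly_(j < d.+1) T 0 (c j) (fun=> y).
have Pd : size P = d.+1.
  by rewrite size_poly_eq // cd theta1 oner_neq0.
have nilP j : nilpotent_elt (P`_j - (('X - 1) ^+ d)`_j).
  rewrite coef_poly; case: ltnP => [_|lt_dj]; last first.
    rewrite sub0r nth_default ?oppr0; first by exists 1%N.
    by rewrite -['X - 1]/('X - 1%:P) size_exp_XsubC.
  apply: (@artinian_local_nilpotent _ _ res); rewrite rmorphB.
  apply/eqP; rewrite subr_eq0; apply/eqP; apply: (fmorph_inj iota).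
  (* Modulo the maximal ideal and inside [K], the coefficient becomes c_j(rho y) = c_j(1). *)
  rewrite -[X in iota X]/((base_change (artl_res A) T) 0 (c j) (fun=> y)) T_Tbar.
  transitivity (c j (alg_of (iota \o res)) (fun=> 1%g)).
    by have := rho_Tbar (c j) (fun=> y); rewrite /= rho_y => /esym.
  rewrite c1 [in RHS](map_coef_X1 (artl_res A)).
  exact: (esym (map_coef_X1 iota d j)).
have nilp : nilpotent_elt (p%:R : A).
  by apply: (@artinian_local_nilpotent _ _ res); rewrite rmorph_nat -res_p rmorph_nat.
have [M [H XH]] := unipotent_power p_pr nilp nilP.
exists M => g z; pose psi j :=
  T n f (fun i => if i == s then (g i * y ^+ j * z)%g else g i).
transitivity (psi 0%N); last first.
  by congr (T n f _); apply: funext => i; rewrite expg0 mulg1.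
apply: (recurrence_period (psi := psi) _ XH) => i.
(* The recurrence shifted by i is the one with g_s y^i in place of g_s. *)
rewrite Pd -[RHS](crec Gamma A T (fun j => if j == s then (g j * y ^+ i)%g else g j) y z).
apply: eq_bigr => j _; rewrite coef_poly ltn_ord; congr (_ * T n f _).
by apply: funext => l; case: eqP => // _; rewrite expgnDr mulgA.
Qed.

End DeformationPeriod.

(** * Compactness *)

Section ProductContinuity.
Local Open Scope classical_set_scope.

Lemma ptws_continuous (X V : topologicalType) (I : Type) (f : X -> {ptws I -> V}) :
  (forall i, continuous (fun x => f x i)) -> continuous f.
Proof.
move=> cf x; apply/cvg_sup => i U [? /= [[W oW <-]]] /= Wfx /filterS; apply.
by apply: cf; exact: open_nbhs_nbhs.
Qed.

Lemma ptws_eval_continuous (X V : topologicalType) (I : eqType)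
    (f : X -> {ptws I -> V}) i : continuous f -> continuous (fun x => f x i).
Proof.
move=> cf x; apply: (@cvg_comp _ _ _ f (fun g : {ptws I -> V} => g i)); first exact: cf.
exact: (@proj_continuous I (fun=> V) i).
Qed.

Lemma ptws_compact (V : topologicalType) (I : eqType) :
  compact [set: V] -> compact [set: {ptws I -> V}].
Proof.
move=> cV; have := @tychonoff I (fun=> V) (fun=> setT) (fun=> cV).
by congr compact; rewrite eqEsubset; split.
Qed.

Lemma discrete_eq_nbhs (X : topologicalType) (D : choiceType) (f g : X -> discrete_topology D) x :
  continuous f -> continuous g -> f x = g x -> \forall y \near x, f y = g y.
Proof.
move=> cf cg fgx.
have nf : nbhs x [set y | f y = f x] by apply: (cf x [set z | z = f x]); exact: discrete_set1.
have ng : nbhs x [set y | g y = g x] by apply: (cg x [set z | z = g x]); exact: discrete_set1.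
by apply: filterS2 nf ng => y /= -> ->.
Qed.

(** The tube lemma; it makes stabilisers of locally constant conditions on compact spaces open. *)
Lemma open_forall (X Y : topologicalType) (P : X -> Y -> Prop) :
  compact [set: Y] -> (forall x y, P x y -> \forall q \near (y, x), P q.2 q.1) ->
  open [set x | forall y, P x y].
Proof.
move=> cY nP; rewrite openE => x Px.
have nc : \forall x' \near x, [set: Y] `<=` P x'.
  move/compact_near_coveringP : cY; apply=> y _.
  exact: nP (Px y).
by apply: filterS nc => x' Yx' y; exact: Yx'.
Qed.

Lemma compact_finite_cover (X : topologicalType) (E : X -> X -> Prop) :
  compact [set: X] -> (forall x, nbhs x (E x)) ->
  exists s : seq X, forall y, exists2 x, x \in s & E x y.
Proof.
(* The filter of all sufficiently large finite lists turns compactness by near coverings into a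
   finite cover. *)
move=> cX nE; pose F : set_system (seq X) :=
  [set A | exists s0 : seq X, forall s : seq X, {subset s0 <= s} -> A s].
have FF : Filter F.
  split=> [|A B [s sA] [t tB]|A B AB [s sA]].
  - by exists [::].
  - exists (s ++ t) => u su; split; [apply: sA|apply: tB] => x xs;
    by apply: su; rewrite mem_cat xs ?orbT.
  - by exists s => t /sA/AB.
have /compact_near_coveringP/(_ (seq X) F
  (fun s y => exists2 x, x \in s & E x y) FF) := cX.
case=> [x _|s sP]; last by exists s => x; apply: (sP s).
exists (E x, [set s : seq X | x \in s]); last by move=> [y s] /= [Exy xs]; exists x.
by split=> //=; exists [:: x] => s; apply; rewrite inE.
Qed.

End ProductContinuity.

Section FiniteQuotients.
Local Open Scope classical_set_scope.
Variable Gamma : profiniteGroupType.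

Lemma mulg_continuous2 (X : topologicalType) (f g : X -> Gamma) :
  continuous f -> continuous g -> continuous (fun x => (f x * g x)%g).
Proof.
move=> cf cg x; apply: (@cvg_comp _ _ _ (fun x => (f x, g x)) (fun q => (q.1 * q.2)%g)).
  exact: (cvg_pair (cf x) (cg x)).
exact: (@mulg_continuous Gamma (f x, g x)).
Qed.

Variable V : set Gamma.
Hypotheses (V_open : open V) (V_normal : is_normal_subgroup V).

Lemma finite_coset_cover : exists s : seq Gamma, forall x, exists2 r, r \in s & V (r^-1 * x)%g.
Proof.
have [V1 _ _ _] := V_normal.
apply: (@compact_finite_cover Gamma (fun r x => V (r^-1 * x)%g)) => [|x].
  exact: profinite_group_compact.
have := @mulg_continuous2 Gamma (fun=> x^-1%g) id (fun _ => cvg_cst _) (fun _ => cvg_id) x V.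
by apply; apply: open_nbhs_nbhs; split; rewrite ?mulVg.
Qed.

(** Both images are the quotient of [K] by the same equivalence relation. *)
Lemma image_card_eq (T X Y : Type) (K : set T) (f : T -> X) (g : T -> Y) :
  (forall x y, K x -> K y -> f x = f y <-> g x = g y) -> (f @` K #= g @` K)%card.
Proof.
move=> fg; have [[x0 Kx0]|K0] := pselect (exists x, K x); last first.
  have K_0 : K = set0 by rewrite -subset0 => x Kx; case: K0; exists x.
  by rewrite K_0 !image_set0 card_eq00.
pose h y := if pselect (exists2 x, K x & g x = y) is left e
  then f (s2val (cid2 e)) else f x0.
have hE x : K x -> h (g x) = f x.
  move=> Kx; rewrite /h; case: pselect => [e|[]]; last by exists x.
  by case: (cid2 e) => z Kz /= gzx; apply/fg.
rewrite (_ : f @` K = h @` (g @` K)).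
  apply: inj_card_eq => _ _ /set_mem[x Kx <-] /set_mem[y Ky <-].
  by rewrite !hE // => /fg; apply.
rewrite eqEsubset; split=> [_ [x Kx <-]|_ [_ [x Kx <-] <-]].
  by exists (g x); [exists x|exact: hE].
by exists x => //; rewrite hE.
Qed.

Lemma card_finset_II (T : finType) (H : {set T}) : ([set t | t \in H] #= `I_#|H|)%card.
Proof.
rewrite (_ : [set t | t \in H] = (@enum_val T (mem H)) @` setT).
  apply: (card_eq_trans (inj_card_eq _)); first by move=> i j _ _; exact: enum_val_inj.
  by rewrite card_eq_sym; exact: card_II.
rewrite eqEsubset; split=> [t tH|_ [i _ <-]]; last exact: enum_valP.
by exists (enum_rank_in tH t) => //; rewrite enum_rankK_in.
Qed.

(** The quotient of [K] by its intersection with [V] is realised as a group [H] of permutations of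
    the cosets of [V], so that Cauchy's theorem applies: a prime dividing the order of [H] is the
    order of an element, hence divides a power of p. *)
Lemma p_power_index_of_exponent (p : nat) (K : set Gamma) : prime p ->
  K 1%g -> (forall x y, K x -> K y -> K (x * y)%g) -> (forall x, K x -> K x^-1%g) ->
  (forall x, K x -> exists M, V (x ^+ (p ^ M))%g) -> p_power_index p K (K `&` V).
Proof.
move=> p_pr K1 KM KV Kp; have [V1 VM VV VJ] := V_normal.
have [s sP] := finite_coset_cover.
pose r (i : 'I_(size s)) := tnth (in_tuple s) i.
have rP x : exists i, V ((r i)^-1 * x)%g.
  have [z zs Vz] := sP x; have /tnthP[i zE] : z \in in_tuple s by [].
  by exists i; rewrite /r -zE.
have [i0 _] := rP 1%g.
(* The first suitable index depends only on the coset of x; the default [i0] is never reached. *)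
pose rep x := odflt i0 [pick i | `[< V ((r i)^-1 * x)%g >]].
have repP x : V ((r (rep x))^-1 * x)%g.
  rewrite /rep; case: pickP => [i /asboolP//|no]; have [i Vi] := rP x.
  by have := no i; rewrite asboolT.
have repE x y : rep x = rep y <-> V (x^-1 * y)%g.
  split=> [xy|Vxy].
    have := VM _ _ (VV _ (repP x)) (repP y).
    by rewrite xy invgM invgK -mulgA mulKVg.
  rewrite /rep; congr odflt; apply: eq_pick => i; apply: asbool_equiv_eq.
  split=> Vi; first by have := VM _ _ Vi Vxy; rewrite -mulgA mulKVg.
  by have := VM _ _ Vi (VV _ Vxy); rewrite invgM invgK -mulgA mulKVg.
(* Indices of redundant representatives are left fixed, so that [act x] permutes the whole list. *)
pose act x i := if rep (r i) == i then rep (x * r i)%g else i.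
have rrep x : rep (r (rep x)) = rep x by apply/repE; exact: repP.
have act_rep x y : act x (rep y) = rep (x * y)%g.
  rewrite /act rrep eqxx; apply/repE; rewrite invgM -mulgA mulKg.
  exact: repP.
have act_inj x : injective (act x).
  move=> i j; rewrite /act; case: eqP => [ri|ri]; case: eqP => [rj|rj] //.
  - by move/repE; rewrite invgM -mulgA mulKg => /repE; rewrite ri rj.
  - by move=> h; case: rj; rewrite -h rrep.
  - by move=> h; case: ri; rewrite h rrep.
pose sigma x : 'S_(size s) := perm (act_inj x).
(* Permutations compose from left to right, whence the reversed order. *)
have sigmaM x y : sigma (x * y)%g = (sigma y * sigma x)%g.
  apply/permP => i; rewrite permM !permE /act; case: (eqVneq (rep (r i)) i) => [ri|ri].
    by rewrite -[RHS]/(act x (rep (y * r i)%g)) act_rep mulgA.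
  by rewrite (negPf ri).
have sigmaE x y : sigma x = sigma y <-> V (x^-1 * y)%g.
  split=> [xy|Vxy].
    apply/repE; rewrite -[x]mulg1 -[y]mulg1 -!act_rep.
    by move/permP/(_ (rep 1%g)): xy; rewrite !permE.
  apply/permP => i; rewrite !permE /act; case: ifP => // _; apply/repE.
  have := VJ _ (r i) Vxy; rewrite conjgE invgM.
  by rewrite !mulgA.
have sigma1 : sigma 1%g = 1%g.
  apply/permP => i; rewrite permE perm1 /act mul1g.
  by case: eqP.
have sigmaX x n : sigma (x ^+ n)%g = (sigma x ^+ n)%g.
  by elim: n => [|n IHn]; rewrite ?expg0 // expgSr sigmaM IHn expgS.
pose H := [set t : 'S_(size s) | `[< exists2 x, K x & sigma x = t >]]%SET.
have HP t : t \in H <-> exists2 x, K x & sigma x = t.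
  by rewrite finset.in_set; split=> [/asboolP|h] //; exact/asboolP.
have H_group : group_set H.
  apply/group_setP; split; first by apply/HP; exists 1%g.
  move=> u v /HP[x Kx xu] /HP[y Ky yv]; apply/HP.
  by exists (y * x)%g; [exact: (KM _ _ Ky Kx)|rewrite sigmaM xu yv].
have pH : p.-nat #|H|.
  apply/pnatP; first by rewrite (cardG_gt0 (Group H_group)).
  move=> q q_pr qH; have [t] := Cauchy q_pr (qH : (q %| #|Group H_group|)%N).
  move=> /HP[x Kx xt] oq; have [M VM'] := Kp x Kx.
  have : (q %| p ^ M)%N.
    rewrite -oq -xt order_dvdn -sigmaX -sigma1; apply/eqP/sigmaE.
    by rewrite mulg1; exact: VV.
  by rewrite Euclid_dvdX // dvdn_prime2 // => /andP[].
have [m Hm] := p_natP pH.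
exists m; rewrite -Hm; apply: card_eq_trans (card_finset_II H).
have -> : [set t | t \in H] = sigma @` K.
  by rewrite eqEsubset; split=> t /= /HP.
apply: image_card_eq => x y Kx Ky; split=> [xy|/sigmaE Vxy].
  apply/sigmaE; have : [set (y * u)%g | u in K `&` V] y.
    by exists 1%g; rewrite ?mulg1.
  by rewrite -xy => -[u [_ Vu] <-]; rewrite mulKg.
rewrite eqEsubset; split=> _ [u [Ku Vu] <-].
  exists (y^-1 * (x * u))%g; last by rewrite mulKVg.
  split; first by apply: (KM); [exact: KV|exact: KM].
  by rewrite mulgA; apply: (VM) => //; have := VV _ Vxy; rewrite invgM invgK.
exists (x^-1 * (y * u))%g; last by rewrite mulKVg.
split; first by apply: (KM); [exact: KV|exact: KM].
by rewrite mulgA; exact: VM.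
Qed.

End FiniteQuotients.

(** * Descent of deformations *)

Section Descent.
Local Open Scope classical_set_scope.
Variables (R : comNzRingType) (k : fieldType) (res : {rmorphism R -> k}) (p : nat).
Hypotheses (p_pr : prime p) (res_p : res p%:R = 0).
Hypotheses (vR : valuation_domain R) (noeth : noetherian R).
Variables (G : affineGroupScheme R) (K : fieldType) (iota : {rmorphism k -> K}).
Hypothesis G_smooth : smooth (coordRing G).
Variables (Gamma : profiniteGroupType) (Tbar : pseudochar G Gamma (alg_of res)).
Variable rho : {multiplicative Gamma -> G (alg_of (iota \o res))}.
Hypothesis rho_Tbar : psc_eq (psc_of_rep rho) (base_change (alg_of_map res iota) Tbar).
Local Notation N := [set h | rho h = 1%g].

Section Invariance.
Variables (A : artLocalAlg res) (T : pseudochar G Gamma A).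
Hypothesis T_def : is_deformation Tbar T.

Lemma slot_continuous n (s : 'I_n) (X : topologicalType) (g : X -> {ptws 'I_n -> Gamma})
    (h : X -> Gamma) : continuous g -> continuous h ->
  continuous (fun x => (fun i => if i == s then (g x i * h x)%g else g x i) :
    {ptws 'I_n -> Gamma}).
Proof.
move=> cg ch; apply: ptws_continuous => i.
have cgi : continuous (fun x => g x i) by exact: ptws_eval_continuous.
by case: eqP => _ //; exact: mulg_continuous2.
Qed.

Lemma prop_kernel_slot n (f : invfun G n.+1) (s : 'I_n.+1) y : prop_kernel p N y ->
  forall g : 'I_n.+1 -> Gamma,
    T n f (fun i => if i == s then (g i * y)%g else g i) = T n f g.
Proof.
have [T_cont T_Tbar] := T_def.
pose slot (g : {ptws 'I_n.+1 -> Gamma}) (x : Gamma) : {ptws 'I_n.+1 -> Gamma} :=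
  fun i => if i == s then (g i * x)%g else g i.
(* The free factor [q.2] after x makes the condition stable under conjugation; compactness of the
   range of [q] makes it open. *)
pose V := [set x | forall q : ({ptws 'I_n.+1 -> Gamma} * Gamma)%type,
  T n f (slot q.1 (x * q.2)%g) = T n f (slot q.1 q.2)].
have slotM g x z : slot g (x * z)%g = slot (slot g x) z.
  by apply: funext => i; rewrite /slot; case: ifP => // _; rewrite mulgA.
have slot1 g : slot g 1%g = g.
  by apply: funext => i; rewrite /slot mulg1; case: ifP.
have VP x : V x <-> forall g z, T n f (slot g (x * z)%g) = T n f (slot g z).
  by split=> [Vx g z|Vx [g z]]; [exact: (Vx (g, z))|exact: Vx].
have V_open : open V.
  apply: open_forall => [|x q].
    rewrite -setXTT; apply: compact_setX; last exact: profinite_group_compact.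
    exact/ptws_compact/profinite_group_compact.
  pose X := (({ptws 'I_n.+1 -> Gamma} * Gamma) * Gamma)%type.
  have c1 : continuous (fun z : X => z.1.1).
    by move=> z; apply: (@cvg_comp _ _ _ fst fst); exact: cvg_fst.
  have c2 : continuous (fun z : X => z.1.2).
    by move=> z; apply: (@cvg_comp _ _ _ fst snd); [exact: cvg_fst|exact: cvg_snd].
  have c3 : continuous (fun z : X => z.2) by move=> z; exact: cvg_snd.
  apply: (@discrete_eq_nbhs X A (fun z => T n f (slot z.1.1 (z.2 * z.1.2)%g))
    (fun z => T n f (slot z.1.1 z.1.2)) (q, x)) => z.
  - have cs : continuous (fun z : X => slot z.1.1 (z.2 * z.1.2)%g).
      exact: (@slot_continuous _ s _ _ _ c1 (mulg_continuous2 c3 c2)).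
    exact: (continuous_comp (cs z) (T_cont n f _)).
  - have cs : continuous (fun z : X => slot z.1.1 z.1.2).
      exact: (@slot_continuous _ s _ _ _ c1 c2).
    exact: (continuous_comp (cs z) (T_cont n f _)).
have V_normal : is_normal_subgroup V.
  split=> [|x z /VP Vx /VP Vz|x /VP Vx|x z /VP Vx]; apply/VP => g w.
  - by rewrite mul1g.
  - by rewrite -mulgA Vx Vz.
  - by rewrite -Vx mulKVg.
  - by rewrite conjgE -!mulgA slotM Vx -slotM mulKg.
have N1 : N 1%g by exact: multiplicative1.
have NM x z : N x -> N z -> N (x * z)%g by rewrite /= gmulfM => -> ->; rewrite mulg1.
have NV x : N x -> N x^-1%g by rewrite /= multiplicativeV => ->; rewrite invg1.
have [V1 VM VV VJ] := V_normal.
move=> [Ny yP]; have [_ Vy] : (N `&` V) y.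
  apply: yP; first split.
  - by move=> x [].
  - by exists V.
  - by split.
  - by move=> x z [Nx Vx] [Nz Vz]; split; [apply: NM|apply: VM] => //; [exact: NV|exact: VV].
  - move=> x z [Nx Vx] Nz; split; last exact: VJ.
    by rewrite conjgE; exact: NM (NV _ Nz) (NM _ _ Nx Nz).
  apply: p_power_index_of_exponent => // x Nx.
  have [M xM] := deformation_period p_pr res_p vR noeth G_smooth rho_Tbar T_Tbar f s Nx.
  exists M; apply/VP => g z; rewrite -[RHS](xM g z); congr (T n f _).
  by apply: funext => i; rewrite /slot mulgA.
by move=> g; move/VP: Vy => /(_ g 1%g); rewrite mulg1 slot1.
Qed.

(** The coordinates of [g] are exchanged for those of [h] one at a time. *)
Lemma prop_kernel_invariant n (f : invfun G n.+1) (g h : 'I_n.+1 -> Gamma) :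
  (forall i, prop_kernel p N ((g i)^-1 * h i)%g) -> T n f g = T n f h.
Proof.
move=> gh; pose mix m (i : 'I_n.+1) := if (i < m)%N then h i else g i.
suff mixE m : (m <= n.+1)%N -> T n f (mix m) = T n f g.
  by rewrite -(mixE n.+1) //; congr (T n f _); apply: funext => i; rewrite /mix ltn_ord.
elim: m => [|m IHm] lt_mn; first by congr (T n f _); apply: funext.
rewrite -(IHm (ltnW lt_mn)) -[RHS](prop_kernel_slot f (Ordinal lt_mn) (gh (Ordinal lt_mn)) (mix m)).
congr (T n f _); apply: funext => i; rewrite /mix ltnS leq_eqVlt.
have [->|ni] := eqVneq i (Ordinal lt_mn); first by rewrite /= eqxx ltnn mulKVg.
by case: eqP => // im; case/eqP: ni; exact: val_inj.
Qed.

End Invariance.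

Variables (Q : profiniteGroupType) (pi : {multiplicative Gamma -> Q}).
Hypothesis pi_cont : continuous pi.
Hypothesis pi_surj : forall x, exists g, pi g = x.
Hypothesis pi_ker : forall g, pi g = 1%g -> prop_kernel p N g.
Variable TbarQ : pseudochar G Q (alg_of res).
Hypothesis TbarQ_infl : psc_eq (inflate pi TbarQ) Tbar.

Lemma map_tuple_continuous n : continuous (fun g : {ptws 'I_n -> Gamma} =>
  (fun i => pi (g i)) : {ptws 'I_n -> Q}).
Proof.
apply: ptws_continuous => i g.
apply: (@cvg_comp _ _ _ (fun h : {ptws 'I_n -> Gamma} => h i) pi); last exact: pi_cont.
exact: (@proj_continuous _ (fun=> Gamma) i).
Qed.

Lemma inflation_continuous (A : comAlgType R) (TQ : pseudochar G Q A) :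
  psc_continuous TQ -> psc_continuous (inflate pi TQ).
Proof.
move=> cTQ n f g.
apply: (@cvg_comp _ _ _ (fun g : {ptws 'I_n.+1 -> Gamma} =>
  (fun i => pi (g i)) : {ptws 'I_n.+1 -> Q}) (TQ n f)); last exact: cTQ.
exact: map_tuple_continuous.
Qed.

(** Preimages of closed sets are images of compact sets under the map induced by [pi], hence closed
    in the Hausdorff space of tuples of [Q]. *)
Lemma deflation_continuous (A : comAlgType R) (TQ : pseudochar G Q A) :
  psc_continuous (inflate pi TQ) -> psc_continuous TQ.
Proof.
move=> cT n f; pose Pi (g : {ptws 'I_n.+1 -> Gamma}) : {ptws 'I_n.+1 -> Q} :=
  fun i => pi (g i).
have cPi : continuous Pi.
  exact: map_tuple_continuous.
pose lft x := sval (cid (pi_surj x)).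
have lftK x : pi (lft x) = x by rewrite /lft; case: cid.
apply/continuous_closedP => S _.
have -> : TQ n f @^-1` S = Pi @` ((inflate pi TQ) n f @^-1` S).
  rewrite eqEsubset; split=> [x Sx|_ [g Sg <-] //].
  have PiL : Pi (lft \o x) = x by apply: funext => i; rewrite /Pi /= lftK.
  by exists (lft \o x) => //; rewrite -PiL in Sx.
apply: compact_closed.
  by apply: hausdorff_product => _; exact: profinite_group_hausdorff.
have cpt : compact ((inflate pi TQ) n f @^-1` S : set {ptws 'I_n.+1 -> Gamma}).
  apply: (@subclosed_compact _ _ setT) => //; last first.
    exact/ptws_compact/profinite_group_compact.
  by have /continuous_closedP := cT n f; apply; exact: discrete_closed.
exact: (continuous_compact (continuous_subspaceT cPi) cpt).
Qed.

Lemma inflate_inj (A : comAlgType R) (T1 T2 : pseudochar G Q A) :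
  psc_eq (inflate pi T1) (inflate pi T2) -> psc_eq T1 T2.
Proof.
move=> T12 n f x; pose lft x := sval (cid (pi_surj x)).
have lftK z : pi (lft z) = z by rewrite /lft; case: cid.
have -> : x = (fun i => pi (lft (x i))) by apply: funext => i; rewrite lftK.
exact: T12.
Qed.

Lemma inflate_deformation (A : artLocalAlg res) (TQ : pseudochar G Q A) :
  is_deformation TbarQ TQ -> is_deformation Tbar (inflate pi TQ).
Proof.
move=> [cTQ TQE]; split; first exact: inflation_continuous.
by move=> n f g; rewrite -TbarQ_infl; exact: TQE.
Qed.

(** [T] is evaluated at arbitrary lifts. These are not multiplicative, but [T] is constant on the
    fibres of [pi], which rescues the merging axiom. *)
Lemma deformation_descends (A : artLocalAlg res) (T : pseudochar G Gamma A) :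
  is_deformation Tbar T ->
  exists2 TQ : pseudochar G Q A, is_deformation TbarQ TQ & psc_eq (inflate pi TQ) T.
Proof.
move=> T_def; pose lft x := sval (cid (pi_surj x)).
have lftK x : pi (lft x) = x by rewrite /lft; case: cid.
have T_pi n (f : invfun G n.+1) (g h : 'I_n.+1 -> Gamma) :
    (forall i, pi (g i) = pi (h i)) -> T n f g = T n f h.
  move=> gh; apply: (prop_kernel_invariant T_def) => i; apply: pi_ker.
  by rewrite gmulfM multiplicativeV gh mulVg.
have [TQ TQE] : exists TQ : pseudochar G Q A, forall n (f : invfun G n.+1) x,
    TQ n f x = T n f (lft \o x).
  pose th n (f : invfun G n.+1) x := T n f (lft \o x).
  have th_merge n (f : invfun G n.+1) x :
      th n.+1 (invfun_merge f) x = th n f (merge_last x).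
    rewrite /th theta_merge; apply: T_pi => i.
    by rewrite /merge_last /=; case: ifP => _; rewrite ?gmulfM !lftK.
  by exists (@Pseudochar _ _ _ _ th (fun _ _ => theta1 _ _) (fun _ _ _ _ => thetaD _ _ _ _)
    (fun _ _ _ _ => thetaM _ _ _ _) (fun _ _ _ _ => thetaZ _ _ _ _)
    (fun _ _ z f x => theta_subst T z f (lft \o x)) th_merge).
have infl : psc_eq (inflate pi TQ) T.
  by move=> n f g; rewrite /= TQE; apply: T_pi => i; rewrite /= lftK.
have [T_cont T_Tbar] := T_def.
exists TQ => //; split.
  apply: deflation_continuous => n f g.
  rewrite (_ : inflate pi TQ n f = T n f); first exact: T_cont.
  by apply: funext => h; exact: infl.
apply: inflate_inj => n f g; rewrite TbarQ_infl -T_Tbar /=.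
by congr (artl_res A _); exact: infl.
Qed.

End Descent.

(** * Profinite algebras and pro-representability *)

Section ZeroDimensional.
Local Open Scope classical_set_scope.

(** By normality the two halves of a separation lie in disjoint open sets U and V, and by
    compactness some clopen E containing x lies in their union. Then E meets U and V in clopen sets;
    the one containing x contains the whole quasi-component. *)
Lemma quasi_component_connected (T : topologicalType) (x : T) :
  hausdorff_space T -> compact [set: T] ->
  connected (\bigcap_(C in [set C : set T | C x /\ clopen C]) C).
Proof.
move=> hT cT; set D := [set C | _]; set Q := \bigcap_(C in D) C.
have Qx : Q x by move=> C [].
have Q_closed : closed Q by apply: closed_bigI => C [_ []].
have sub_clopen O : open O -> Q `<=` O -> exists2 C, D C & C `<=` O.
  move=> oO QO; apply: contrapT => noC.
  pose F := filter_from D (fun C => C `&` ~` O).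
  have FF : ProperFilter F.
    apply: filter_from_proper.
      apply: filter_from_filter; first by exists setT; split => //; exact: clopenT.
      move=> A B [Ax cA] [Bx cB]; exists (A `&` B).
        by split=> //; exact: clopenI.
      by move=> z [[Az Bz] Oz].
    move=> C DC; apply: contrapT => /set0P/negP; rewrite negbK => /eqP CO0.
    by apply: noC; exists C => //; rewrite -[O]setCK; apply/disjoints_subset.
  have FO : F (~` O).
    by exists setT => [|z []] //; split => //; exact: clopenT.
  have cO : compact (~` O) by apply: (subclosed_compact _ cT) => //; exact: open_closedC.
  have [z [Oz Fz]] := cO F FF FO; apply: Oz; apply: QO => C DC.
  have [_ [_ cC]] := DC; apply: cC => B Bz.
  have [w [[Cw _] Bw]] := Fz (C `&` ~` O) B (ex_intro2 _ _ C DC (fun _ h => h)) Bz.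
  by exists w.
have norm (B B' : set T) : closed B -> closed B' -> B `&` B' = set0 ->
    exists U V, [/\ open U, open V, B `<=` U, B' `<=` V & U `&` V = set0].
  move=> cB cB' BB'; have := compact_normal hT cT cB.
  move=> /(_ (~` B'))[|W /set_nbhsP[U [oU BU UW]] WB'].
    by apply/set_nbhsP; exists (~` B'); split=> //; [exact: closed_openC|exact/disjoints_subset].
  exists U, (~` closure W); split=> //.
  - exact/closed_openC/closed_closure.
  - by move=> z B'z /WB'.
  - by rewrite -subset0 => z [/UW/subset_closure].
move=> B [b Bb] [C oC BC] [C' cC' BC'].
have cB : closed B by rewrite BC'; exact: closedI.
have cB' : closed (Q `&` ~` C) by apply: closedI => //; exact: open_closedC.
have [|U [V [oU oV BU BV UV]]] := norm _ _ cB cB'.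
  by rewrite BC -subset0 => z [[_ Cz] [_ Cz']].
have QUV : Q `<=` U `|` V.
  move=> z Qz; have [Cz|Cz] := pselect (C z).
    by left; apply: BU; rewrite BC.
  by right; apply: BV.
have [E [Ex [oE cE]] EUV] := sub_clopen _ (openU oU oV) QUV.
have cEU : clopen (E `&` U).
  split; first exact: openI.
  rewrite (_ : E `&` U = E `&` ~` V); first by apply: closedI => //; exact: open_closedC.
  rewrite eqEsubset; split=> z [Ez Uz]; split=> //.
    by move=> Vz; have : (U `&` V) z by []; rewrite UV.
  by have [] := EUV _ Ez.
have cEV : clopen (E `&` V).
  split; first exact: openI.
  rewrite (_ : E `&` V = E `&` ~` U); first by apply: closedI => //; exact: open_closedC.
  rewrite eqEsubset; split=> z [Ez Uz]; split=> //.
    by move=> Vz; have : (U `&` V) z by []; rewrite UV.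
  by have [] := EUV _ Ez.
have [Ux|Ux] := pselect (U x); last first.
  have Vx : V x by have [] := EUV _ Ex.
  have [_ Vb] : (E `&` V) b.
    have Qb : Q b by move: Bb; rewrite BC => -[].
    by apply: Qb; split.
  have : (U `&` V) b by split=> //; exact: BU.
  by rewrite UV.
rewrite eqEsubset; split=> [z|z Qz]; first by rewrite BC => -[].
rewrite BC; split=> //; apply: contrapT => Cz.
have [_ Uz] : (E `&` U) z by apply: Qz; split.
have : (U `&` V) z by split=> //; exact: BV.
by rewrite UV.
Qed.

(** Quasi-components are connected, hence reduced to points; so clopen sets separate points and, by
    compactness, form a basis. *)
Lemma clopen_nbhs_basis (T : topologicalType) (x : T) (U : set T) :
  hausdorff_space T -> compact [set: T] -> totally_disconnected [set: T] ->
  nbhs x U -> exists C, [/\ clopen C, C x & C `<=` U].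
Proof.
move=> hT cT dT Ux; have zdT : zero_dimensional T.
  move=> y z /eqP yz; apply: contrapT => noC; apply: yz.
  have : connected_component setT y z.
    apply: (@connected_component_max _ setT
      (\bigcap_(C in [set C : set T | C y /\ clopen C]) C)) => //.
    - by move=> C [].
    - exact: quasi_component_connected.
    - move=> C [Cy cC]; apply: contrapT => Cz; apply: noC.
      by exists C.
  by rewrite dT // => ->.
have := zero_dimensional_cvg hT zdT cT Ux.
by case=> C [Cx cC] CU; exists C.
Qed.

End ZeroDimensional.

Section ProfiniteAlgebras.
Local Open Scope classical_set_scope.
Variables (R : comNzRingType) (X : profiniteAlgType R).

Lemma profinite_continuousD (T : topologicalType) (f g : T -> X) :
  continuous f -> continuous g -> continuous (fun x => f x + g x).
Proof.
move=> cf cg x; apply: (@cvg_comp _ _ _ (fun x => (f x, g x)) (fun q => q.1 + q.2)).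
  exact: (cvg_pair (cf x) (cg x)).
exact: (@profinite_addr_continuous R X (f x, g x)).
Qed.

Lemma profinite_continuousM (T : topologicalType) (f g : T -> X) :
  continuous f -> continuous g -> continuous (fun x => f x * g x).
Proof.
move=> cf cg x; apply: (@cvg_comp _ _ _ (fun x => (f x, g x)) (fun q => q.1 * q.2)).
  exact: (cvg_pair (cf x) (cg x)).
exact: (@profinite_mulr_continuous R X (f x, g x)).
Qed.

Lemma nbhs_shift (x : X) (I : set X) : open I -> I 0 -> nbhs x [set y | I (y - x)].
Proof.
move=> oI I0; have := @profinite_continuousD X id (fun=> - x) (fun _ => cvg_id)
  (fun _ => cvg_cst _) x I.
by apply; apply: open_nbhs_nbhs; rewrite subrr.
Qed.

(* The ideal of the a with V + X a in V is open since X and V are compact. *)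
Lemma open_ideal_basis (U : set X) : nbhs 0 U ->
  exists I, [/\ is_ideal I, open I & I `<=` U].
Proof.
move=> /clopen_nbhs_basis[||| V [[oV cV] V0 VU]].
- exact: profinite_alg_hausdorff.
- exact: profinite_alg_compact.
- exact: profinite_alg_disconnected.
exists [set a | forall q : X * X, V q.2 -> V (q.2 + q.1 * a)]; split.
- split=> /= [q|a b Ia Ib q Vq|c a Ia q Vq]; first by rewrite mulr0 addr0.
    by rewrite mulrDr addrA; apply: (Ib (q.1, _)); exact: Ia.
  by rewrite mulrA; exact: (Ia (q.1 * c, q.2)).
- apply: (@open_forall X (X * X)%type (fun a q => V q.2 -> V (q.2 + q.1 * a))).
    by rewrite -setXTT; apply: compact_setX; exact: profinite_alg_compact.
  move=> a q Paq; pose Z := ((X * X) * X)%type.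
  pose f1 (z : Z) := z.1.2; pose f2 (z : Z) := z.1.2 + z.1.1 * z.2.
  have c1 : continuous (fun z : Z => z.1.1).
    by move=> z; apply: (@cvg_comp _ _ _ fst fst); exact: cvg_fst.
  have c2 : continuous f1.
    by move=> z; apply: (@cvg_comp _ _ _ fst snd); [exact: cvg_fst|exact: cvg_snd].
  have c3 : continuous (fun z : Z => z.2) by move=> z; exact: cvg_snd.
  have c4 : continuous f2.
    exact: (profinite_continuousD c2 (profinite_continuousM c1 c3)).
  have [Vq|Vq] := pselect (V q.2).
    have : nbhs ((q, a) : Z) (f2 @^-1` V).
      by apply: c4; apply: open_nbhs_nbhs; split => //; exact: Paq.
    by apply: filterS => z Vz _.
  have : nbhs ((q, a) : Z) (f1 @^-1` (~` V)).
    by apply: c2; apply: open_nbhs_nbhs; split => //; exact: closed_openC.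
  by apply: filterS => z Vz /Vz.
- by move=> a /(_ (1, 0) V0); rewrite /= add0r mul1r => /VU.
Qed.

Lemma open_ideal_separated (z : X) :
  (forall I, is_ideal I -> open I -> ~ I 1 -> I z) -> z = 0.
Proof.
move=> Iz; apply/eqP; apply: contrapT => /negP z0.
have : nbhs (0 : X) [set~ z].
  apply: open_nbhs_nbhs; split; last by move=> /= z0'; rewrite -z0' eqxx in z0.
  apply: closed_openC; apply: compact_closed; last exact: compact_set1.
  exact: profinite_alg_hausdorff.
move=> /open_ideal_basis[I [iI oI Isub]]; have nIz : ~ I z by move=> /Isub; apply.
apply: nIz; apply: Iz => // I1; apply: (Isub z) => //.
by have [_ _ IM] := iI; rewrite -[z]mulr1; exact: IM.
Qed.

Lemma discrete_continuousP (A : comAlgType R) (u : {lrmorphism X -> A}) :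
  discrete_continuous u <-> open [set x | u x = 0].
Proof.
split=> [cu|ou].
  have := @open_comp _ _ (u : X -> discrete_topology A) [set a | a = 0].
  apply; last exact: discrete_open.
  by move=> x _; exact: cu.
move=> x U; rewrite nbhs_principalE => /principal_filterP Ux.
have := nbhs_shift x ou (rmorph0 u); apply: filterS => y /=.
by rewrite rmorphB => /eqP; rewrite subr_eq0 => /eqP uy; rewrite uy.
Qed.

Lemma ker_ideal (A : comAlgType R) (u : {lrmorphism X -> A}) :
  is_ideal [set x | u x = 0].
Proof.
split=> /= [|x y ux uy|a x ux]; rewrite ?rmorph0 ?rmorphD ?rmorphM //= ?ux ?uy ?addr0 //.
by rewrite mulr0.
Qed.

Lemma ker_proper (A : comAlgType R) (u : {lrmorphism X -> A}) : ~ [set x | u x = 0] 1.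
Proof. by rewrite /= rmorph1; exact/eqP/oner_neq0. Qed.

Lemma finite_artinian (A : comNzRingType) (s : seq A) : (forall a, a \in s) -> artinian A.
Proof.
move=> sP I iI decI.
have dec n m : (n <= m)%N -> I m `<=` I n.
  move=> /subnK <-; elim: (m - n)%N => // l IHl x /decI; exact: IHl.
suff [N NP] : exists N, forall n x, (N <= n)%N -> x \in s -> I N x -> I n x.
  exists N => n Nn; rewrite eqEsubset; split; first exact: dec.
  by move=> x; exact: NP.
elim: s {sP} => [|a s [N NP]]; first by exists 0%N.
have [[m Im]|allI] := pselect (exists m, ~ I m a); last first.
  exists N => n x Nn; rewrite inE => /orP[/eqP-> _|xs]; last exact: NP.
  by apply: contrapT => na; apply: allI; exists n.
exists (maxn N m) => n x; rewrite geq_max => /andP[Nn mn].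
rewrite inE => /orP[/eqP->|xs] Ix.
  by case: Im; apply: dec Ix; rewrite leq_maxr.
by apply: NP => //; apply: dec Ix; rewrite leq_maxl.
Qed.

Variables (k : fieldType) (res : {rmorphism R -> k}).
Hypothesis X_local : is_local_with_residue_field res X.

(** Compactness makes the quotient by an open ideal finite, hence artinian. A proper ideal consists
    of non-units and so lies in the kernel of the residue map, which therefore factors. *)
Lemma artinian_quotient (I : set X) : is_ideal I -> open I -> ~ I 1 ->
  exists (A : artLocalAlg res) (pr : {lrmorphism X -> A}),
    [/\ discrete_continuous pr, forall a, exists x, pr x = a
      & forall x, pr x = 0 <-> I x].
Proof.
move=> iI oI I1; have [D [pr [prS prK]]] := quotient_alg iI I1.
have [r _ [rS rU]] := X_local; have [I0 ID IM] := iI.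
have [x|rD rDE] := lrmorphism_factor (f := r) prS.
  move=> /prK Ix; apply: contrapT => /rU[y yx]; apply: I1.
  by rewrite -yx; exact: IM.
have resP : is_residue_map (rD : D -> k).
  split=> [c|d].
    by have [x rx] := rS c; exists (pr x); rewrite -rx -[RHS]rDE.
  have [x <-] := prS d => rx.
  have [|y yx] := rU x; first by rewrite -[r x]rDE.
  by exists (pr y); rewrite -rmorphM yx rmorph1.
have art : artinian D.
  have [x|s sP] := @compact_finite_cover X (fun x y => I (y - x)) (@profinite_alg_compact R X).
    exact: nbhs_shift.
  apply: (@finite_artinian D [seq pr x | x <- s]) => d.
  have [y <-] := prS d; have [x xs /prK] := sP y.
  by rewrite rmorphB => /eqP; rewrite subr_eq0 => /eqP ->; exact: map_f.
exists (ArtLocalAlg resP art), pr; split=> //; apply/discrete_continuousP.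
rewrite (_ : [set x | _] = I) // eqEsubset; split=> x /=; first by move/prK.
by move=> Ix; apply/prK.
Qed.

End ProfiniteAlgebras.

Lemma discrete_continuous_comp (R : comNzRingType) (X : preTopAlgType R) (A B : comAlgType R)
    (u : {lrmorphism X -> A}) (f : {lrmorphism A -> B}) :
  discrete_continuous u -> discrete_continuous (f \o u).
Proof.
move=> cu x U; rewrite nbhs_principalE => /principal_filterP Ufx.
have ux : nbhs x [set y | u y = u x]%classic := cu x _ (discrete_set1 _).
suff : nbhs x [set y | U (f (u y))]%classic by [].
by apply: filterS ux => y /= ->.
Qed.

Section ProRepresentability.
Local Open Scope classical_set_scope.
Variables (R : comNzRingType) (k : fieldType) (res : {rmorphism R -> k}).
Variables (X Y : profiniteAlgType R) (Y_local : is_local_with_residue_field res Y).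
Variable rel : forall A : artLocalAlg res, {lrmorphism Y -> A} -> {lrmorphism X -> A} -> Prop.
Hypothesis rel_total : forall (A : artLocalAlg res) (u : {lrmorphism Y -> A}),
  discrete_continuous u -> exists2 v : {lrmorphism X -> A}, discrete_continuous v & rel u v.
Hypothesis rel_functional : forall (A : artLocalAlg res) (u : {lrmorphism Y -> A})
  (v w : {lrmorphism X -> A}), discrete_continuous v -> discrete_continuous w ->
  rel u v -> rel u w -> v =1 w.
Hypothesis rel_natural : forall (A B : artLocalAlg res) (u : {lrmorphism Y -> A})
  (v : {lrmorphism X -> A}) (f : {lrmorphism A -> B}), discrete_continuous u ->
  discrete_continuous v -> rel u v -> rel (f \o u) (f \o v).

(* [y] is the image of [x] under the morphism to be built. *)
Let compat (x : X) (y : Y) := forall (A : artLocalAlg res) (u : {lrmorphism Y -> A})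
  (v : {lrmorphism X -> A}), discrete_continuous u -> discrete_continuous v ->
  rel u v -> u y = v x.

Let compat_at (J : set Y) (x : X) : set Y := [set y |
  forall (A : artLocalAlg res) (u : {lrmorphism Y -> A}) (v : {lrmorphism X -> A}),
    discrete_continuous u -> discrete_continuous v -> rel u v ->
    (forall z, J z -> u z = 0) -> u y = v x].

Let proper_open (J : set Y) := [/\ is_ideal J, open J & ~ J 1].

(** The projection onto Y/J is universal among the [u] that kill [J], so by naturality the whole
    condition reduces to one equation in Y/J. *)
Let compat_atP (J : set Y) x : proper_open J -> exists (A : artLocalAlg res)
  (pr : {lrmorphism Y -> A}) (v : {lrmorphism X -> A}),
  [/\ discrete_continuous pr, discrete_continuous v, rel pr v,
      forall a, exists y, pr y = a
    & forall y, (pr y = 0 <-> J y) /\ (pr y = v x <-> compat_at J x y)].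
Proof.
move=> [iJ oJ J1]; have [A [pr [cpr prS prK]]] := artinian_quotient Y_local iJ oJ J1.
have [v cv prv] := rel_total cpr; exists A, pr, v; split=> // y; split=> //.
split=> [yx B u w cu cw uw Ju|]; last by apply=> // z /prK.
have [z|f fE] := lrmorphism_factor (f := u) prS; first by move=> /prK/Ju.
have fu := lrmorphism_ext fE.
have fv : f \o v =1 w.
  apply: (rel_functional (u := u)) => //; first exact: discrete_continuous_comp.
  by rewrite -fu; exact: rel_natural.
by rewrite -fu -fv /= yx.
Qed.

(* The sets [compat_at J x] form a filter base of closed sets, and [Y] is compact. *)
Let compat_exists x : exists y, compat x y.
Proof.
pose F := filter_from proper_open (fun J => compat_at J x).
have FF : ProperFilter F.
  apply: filter_from_proper; last first.
    move=> J /(compat_atP x)[A [pr [v [_ _ _ prS prP]]]].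
    by have [y yx] := prS (v x); exists y; apply/(prP y).2.
  apply: filter_from_filter.
    have [r cr _] := Y_local; exists [set y | r y = 0]; split.
    - exact: ker_ideal.
    - exact/discrete_continuousP.
    - exact: ker_proper.
  move=> J J' [[J0 JD JM] oJ J1] [[J'0 J'D J'M] oJ' J'1]; exists (J `&` J').
    split; [split=> // [a b [? ?] [? ?]|a b [? ?]]|exact: openI|by case].
      by split; [exact: JD|exact: J'D].
    by split; [exact: JM|exact: J'M].
  move=> y yJJ'; split=> A u v cu cv uv Ju; apply: (yJJ' A u v) => // z [Jz J'z];
    exact: Ju.
have [y [_ Fy]] := @profinite_alg_compact R Y F FF filterT.
have yJ J : proper_open J -> compat_at J x y.
  move=> pJ; have [A [pr [v [_ _ _ _ prP]]]] := compat_atP x pJ.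
  apply/(prP y).2; have [[J0 _ _] oJ _] := pJ.
  have [z [Jz]] := Fy (compat_at J x) _ (ex_intro2 _ _ J pJ (fun _ h => h))
    (nbhs_shift y oJ J0).
  move=> /(prP _).1; rewrite rmorphB => /eqP; rewrite subr_eq0 => /eqP <-.
  exact/(prP z).2.
exists y => A u v cu cv uv; apply: (yJ [set z | u z = 0]) => //; split.
- exact: ker_ideal.
- exact/discrete_continuousP.
- exact: ker_proper.
Qed.

Let compat_unique x y z : compat x y -> compat x z -> y = z.
Proof.
move=> xy xz; apply/eqP; rewrite -subr_eq0; apply/eqP.
apply: open_ideal_separated => J iJ oJ J1.
have [A [pr [v [cpr cv prv _ prP]]]] := compat_atP x (And3 iJ oJ J1).
by apply/(prP _).1; rewrite rmorphB /= (xy A pr v) // (xz A pr v) // subrr.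
Qed.

(** Yoneda in the pro-category. The correspondence is a relation, not a function, since deformations
    determine the morphisms only through [psc_eq]. *)
Lemma prorepresentable_morphism : exists2 phi : {lrmorphism X -> Y}, continuous phi &
  forall (A : artLocalAlg res) (u : {lrmorphism Y -> A}), discrete_continuous u ->
    rel u (u \o phi).
Proof.
pose phi0 x := sval (cid (compat_exists x)).
have phi0P x : compat x (phi0 x) by rewrite /phi0; case: cid.
have [|x y|x y|a x|phi phiE] := @lrmorphism_of R X Y phi0.
- by apply: compat_unique (phi0P 1) _ => A u v *; rewrite !rmorph1.
- apply: compat_unique (phi0P _) _ => A u v cu cv uv.
  by rewrite !rmorphD /= !(phi0P _ A u v).
- apply: compat_unique (phi0P _) _ => A u v cu cv uv.
  by rewrite !rmorphM /= !(phi0P _ A u v).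
- apply: compat_unique (phi0P _) _ => A u v cu cv uv.
  by rewrite !linearZ /= !(phi0P _ A u v).
have {}phi0P x : compat x (phi x) by rewrite phiE.
exists phi => [x U Ux|A u cu]; last first.
  have [v cv uv] := rel_total cu.
  have uphi : u \o phi =1 v by move=> x; exact: phi0P.
  by rewrite (lrmorphism_ext uphi).
have : nbhs (0 : Y) [set z | U (z + phi x)].
  have := @profinite_continuousD R Y Y id (fun=> phi x) (fun _ => cvg_id)
    (fun _ => cvg_cst _) 0 U.
  by apply; rewrite add0r.
move=> /open_ideal_basis[J [iJ oJ JU]].
(* The unit ideal has no quotient algebra, but then U is everything. *)
have [J1|J1] := pselect (J 1).
  suff UT z : U z by apply: filterS filterT => y _ /=; exact: UT.
  rewrite -(subrK (phi x) z); apply: JU.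
  by have [_ _ JM] := iJ; rewrite -[_ - _]mulr1; exact: JM.
have [A [pr [v [cpr cv prv _ prP]]]] := compat_atP x (And3 iJ oJ J1).
have vx : nbhs x [set y | v y = v x] := cv x _ (discrete_set1 _).
suff : nbhs x [set y | U (phi y)] by [].
apply: filterS vx => y /= vy.
rewrite -(subrK (phi x) (phi y)); apply: JU; apply/(prP _).1.
by rewrite rmorphB /= !(phi0P _ A pr v) // vy subrr.
Qed.

End ProRepresentability.

Section InflationIsomorphism.
Variables (R : comNzRingType) (k : fieldType) (res : {rmorphism R -> k}).

Lemma discrete_continuous_precomp (X Y : profiniteAlgType R) (A : comAlgType R)
    (f : {lrmorphism X -> Y}) (u : {lrmorphism Y -> A}) :
  continuous f -> discrete_continuous u -> discrete_continuous (u \o f).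
Proof. by move=> cf cu x; exact: (continuous_comp (cf x) (cu _)). Qed.

(** Proper open ideals separate points and have artinian quotients. *)
Lemma eq_on_artinian (P : comAlgType R) (X : profiniteAlgType R)
    (f g : {lrmorphism P -> X}) : is_local_with_residue_field res X ->
  (forall (A : artLocalAlg res) (u : {lrmorphism X -> A}), discrete_continuous u ->
    u \o f =1 u \o g) -> f =1 g.
Proof.
move=> X_local fg x; apply/eqP; rewrite -subr_eq0; apply/eqP.
apply: open_ideal_separated => I iI oI I1.
have [A [pr [cpr _ prK]]] := artinian_quotient X_local iI oI I1.
apply/prK; rewrite rmorphB; apply/eqP; rewrite subr_eq0; apply/eqP.
exact: (fg A pr cpr x).
Qed.

Variables (G : affineGroupScheme R) (Gamma Q : profiniteGroupType).
Variables (Tbar : pseudochar G Gamma (alg_of res)) (TbarQ : pseudochar G Q (alg_of res)).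
Variable pi : {multiplicative Gamma -> Q}.
Hypothesis pi_surj : forall x, exists g, pi g = x.
Hypothesis inflates : forall (A : artLocalAlg res) (TQ : pseudochar G Q A),
  is_deformation TbarQ TQ -> is_deformation Tbar (inflate pi TQ).
Hypothesis descends : forall (A : artLocalAlg res) (T : pseudochar G Gamma A),
  is_deformation Tbar T ->
  exists2 TQ : pseudochar G Q A, is_deformation TbarQ TQ & psc_eq (inflate pi TQ) T.
Variables (X Y : profiniteAlgType R) (UX : prorepresents Tbar X) (UY : prorepresents TbarQ Y).

Lemma prorep_inflation : exists2 phi : {lrmorphism X -> Y}, continuous phi &
  forall (A : artLocalAlg res) (u : {lrmorphism Y -> A}), discrete_continuous u ->
    psc_eq (UX A (u \o phi)) (inflate pi (UY A u)).
Proof.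
pose rel (A : artLocalAlg res) (u : {lrmorphism Y -> A}) (v : {lrmorphism X -> A}) :=
  psc_eq (UX A v) (inflate pi (UY A u)).
apply: (@prorepresentable_morphism R k res X Y (prorep_local UY) rel).
- by move=> A u /(prorep_defP UY)/inflates/(prorep_surj UX).
- move=> A u v w cv cw uv uw; apply: (prorep_inj (p := UX)) => // n f g.
  by rewrite uv uw.
- move=> A B u v f cu cv uv n h g.
  rewrite (prorep_nat UX f cv) /= (prorep_nat UY f cu) /=.
  by congr (f _); exact: uv.
Qed.

(** Descent makes the inverse correspondence total, and surjectivity of [pi] makes it functional. *)
Lemma prorep_deflation : exists2 psi : {lrmorphism Y -> X}, continuous psi &
  forall (A : artLocalAlg res) (u : {lrmorphism X -> A}), discrete_continuous u ->
    psc_eq (UX A u) (inflate pi (UY A (u \o psi))).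
Proof.
pose rel (A : artLocalAlg res) (u : {lrmorphism X -> A}) (v : {lrmorphism Y -> A}) :=
  psc_eq (UX A u) (inflate pi (UY A v)).
apply: (@prorepresentable_morphism R k res Y X (prorep_local UX) rel).
- move=> A u /(prorep_defP UX)/descends[T /(prorep_surj UY)[v cv vT] Tu].
  by exists v => // n f g; rewrite -Tu /= vT.
- move=> A u v w cv cw uv uw; apply: (prorep_inj (p := UY)) => //.
  by apply: (inflate_inj pi_surj) => n f g; rewrite -uv -uw.
- move=> A B u v f cu cv uv n h g.
  rewrite (prorep_nat UX f cu) /= (prorep_nat UY f cv) /=.
  by congr (f _); exact: uv.
Qed.

(** Both composites induce the identity on deformations, and a morphism is determined by what it
    induces. *)
Lemma inflation_iso : exists phi : {lrmorphism X -> Y},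
  [/\ represents_inflation pi UX UY phi,
      forall phi' : {lrmorphism X -> Y}, represents_inflation pi UX UY phi' -> phi' =1 phi
    & is_topological_iso phi].
Proof.
have [phi cphi phiP] := prorep_inflation.
have [psi cpsi psiP] := prorep_deflation.
have phi_comp (A : artLocalAlg res) (u : {lrmorphism Y -> A}) :
    discrete_continuous u -> discrete_continuous (u \o phi).
  exact: discrete_continuous_precomp.
have psi_comp (A : artLocalAlg res) (u : {lrmorphism X -> A}) :
    discrete_continuous u -> discrete_continuous (u \o psi).
  exact: discrete_continuous_precomp.
exists phi; split=> //.
  move=> phi' [cphi' phi'P]; apply: eq_on_artinian (prorep_local UY) _ => A u cu.
  apply: (prorep_inj (p := UX)) => [||n f g].
  - exact: discrete_continuous_precomp.
  - exact: phi_comp.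
  - by rewrite phi'P // phiP.
split=> //; exists psi; split=> // [x|y].
  have := @eq_on_artinian X X (psi \o phi) idfun (prorep_local UX).
  apply=> A u cu; pose w : {lrmorphism X -> A} := (u \o psi) \o phi.
  apply: (prorep_inj (p := UX) (u := w) (v := u)) => // [|n f g].
    exact: (phi_comp A (u \o psi) (psi_comp A u cu)).
  by rewrite [RHS]psiP //; exact: (phiP A (u \o psi) (psi_comp A u cu)).
have := @eq_on_artinian Y Y (phi \o psi) idfun (prorep_local UY).
apply=> A u cu; pose w : {lrmorphism Y -> A} := (u \o phi) \o psi.
apply: (prorep_inj (p := UY) (u := w) (v := u)) => // [|].
  exact: (psi_comp A (u \o phi) (phi_comp A u cu)).
apply: (inflate_inj pi_surj) => n f g.
rewrite -(phiP A u cu).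
by symmetry; exact: (psiP A (u \o phi) (phi_comp A u cu)).
Qed.

End InflationIsomorphism.

Theorem theorem1p1
  (p : nat) (p_pr : prime p)
  (L : fieldExtType {fraction padic_int p_pr})
  (k : fieldType) (res : {rmorphism ring_of_integers L -> k})
  (k_res : is_residue_map res)
  (kbar : closedFieldType) (iota : {rmorphism k -> kbar})
  (kbar_alg : forall x, algebraicOver iota x)
  (G : affineGroupScheme (ring_of_integers L))
  (G_red : generalised_reductive G)
  (Gamma : profiniteGroupType)
  (Tbar : pseudochar G Gamma (alg_of res)) (Tbar_cont : psc_continuous Tbar)
  (rho : {multiplicative Gamma -> G (alg_of (iota \o res))})
  (rho_cont : continuous (rho : Gamma -> discrete_topology (G (alg_of (iota \o res)))))
  (rho_Tbar : psc_eq (psc_of_rep rho) (base_change (alg_of_map res iota) Tbar))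
  (Q : profiniteGroupType) (pi : {multiplicative Gamma -> Q})
  (pi_cont : continuous pi)
  (pi_surj : forall x, exists g, pi g = x)
  (pi_ker : forall g, pi g = 1%g <-> prop_kernel p [set h | rho h = 1%g]%classic g)
  (TbarQ : pseudochar G Q (alg_of res))
  (TbarQ_infl : psc_eq (inflate pi TbarQ) Tbar) :
  (forall (RGamma RQ : profiniteAlgType (ring_of_integers L))
     (UGamma : prorepresents Tbar RGamma) (UQ : prorepresents TbarQ RQ),
     exists phi : {lrmorphism RGamma -> RQ},
       [/\ represents_inflation pi UGamma UQ phi,
           forall phi' : {lrmorphism RGamma -> RQ},
             represents_inflation pi UGamma UQ phi' -> phi' =1 phi
         & is_topological_iso phi])
  /\
  (forall (A : artLocalAlg res) (T : pseudochar G Gamma A),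
     is_deformation Tbar T ->
     exists2 TQ : pseudochar G Q A,
       is_deformation TbarQ TQ & psc_eq (inflate pi TQ) T).
Proof.
have G_smooth : smooth (coordRing G) by case: G_red.
have vR := ring_of_integers_valuation k_res.
have noeth := ring_of_integers_noetherian k_res.
have sub_ker g : pi g = 1%g -> prop_kernel p [set h | rho h = 1%g]%classic g.
  by move/pi_ker.
have descends := deformation_descends p_pr (residue_p k_res) vR noeth G_smooth rho_Tbar
  pi_cont pi_surj sub_ker TbarQ_infl.
split=> [RGamma RQ UGamma UQ|A T]; last exact: descends.
apply: inflation_iso => // A TQ; exact: inflate_deformation.
Qed.
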